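(* For any $\gamma\in S$ there is an $\varepsilon>0$ such that for all $\beta\in(1,2)$ with $1/\beta\in[1/\gamma,1/\gamma+\varepsilon)$ and Lebesgue almost every $\lambda\in(1/\beta,1/\gamma+\varepsilon)$, the SRB-measure of $T_{\beta,\lambda}$ is absolutely continuous with respect to two-dimensional Lebesgue measure.
   Context: For $0<\lambda<1$ and $1<\beta<2$, let $Q=[0,1)\times[0,1)$ and define $T_{\beta,\lambda}\colon Q\to Q$ by $T_{\beta,\lambda}(x,y)=(\lambda x,\beta y)$ if $y<1/\beta$ and $T_{\beta,\lambda}(x,y)=(\lambda x+1-\lambda,\beta y-1)$ if $y\ge 1/\beta$. Let $\nu$ be two-dimensional Lebesgue measure on $Q$ and $\nu_n=\frac1n\sum_{k=0}^{n-1}\nu\circ T_{\beta,\lambda}^{-k}$; the SRB-measure of $T_{\beta,\lambda}$ is the (unique) weak limit of $\nu_n$ as $n\to\infty$. $\beta$-shifts: for $\beta>1$ let $f_\beta(x)=\beta x\bmod 1$ on $[0,1]$, $d(x,\beta)=(\lfloor\beta f_\beta^{k-1}(x)\rfloor)_{k\ge1}$, and $S_\beta^+$ the closure in the product topology of $\{d(x,\beta):x\in[0,1)\}$. Let $S_\beta$ be the set of bi-infinite sequences $(\ldots,a_{-1},a_0,a_1,\ldots)$ with $(a_n,a_{n+1},\ldots)\in S_\beta^+$ for all $n\in\mathbb Z$, and $S_\beta^-$ the set of $(b_1,b_2,\ldots)$ such that $(\ldots,b_2,b_1,0,0,\ldots)\in S_\beta$ (with $b_1$ at position $0$ and zeros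 at positive positions). Define $S=\{\beta>1: S_\beta^+=S_\beta^-\}$. *)

(* Defs.v *)
From HB Require Import structures.
From mathcomp Require Import all_boot all_order all_algebra.
From mathcomp Require Import all_classical all_reals all_analysis.
Set Implicit Arguments. Unset Strict Implicit. Unset Printing Implicit Defensive.
Import Order.TTheory GRing.Theory Num.Theory.
Import numFieldNormedType.Exports.
Local Open Scope classical_set_scope.
Local Open Scope ring_scope.

Section Defs.
Variable R : realType.

Definition fbeta (b x : R) : R := b * x - (Num.floor (b * x))%:~R.

(* d(x,beta): the k-th entry (0-indexed, i.e. k = paper's k-1)
   is floor(beta f_beta^{k}(x)) *)
Definition beta_digits (b x : R) : nat -> int :=
  fun k => Num.floor (b * iter k (fbeta b) x).

(* S_beta^+ : closure of {d(x,beta) : x in [0,1)} in the product topology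
   of int^nat (int discrete).  Written out: every finite prefix of s is
   a prefix of some d(x,beta), x in [0,1). *)
Definition Splus (b : R) : set (nat -> int) :=
  [set s | forall N : nat, exists x : R, (0 <= x < 1) /\
       forall k : nat, (k < N)%N -> beta_digits b x k = s k].

Definition Sbi (b : R) : set (int -> int) :=
  [set a | forall n : int, Splus b (fun k : nat => a (n + k%:Z)%R)].

(* S_beta^- : s (0-indexed: s 0 = b_1, s 1 = b_2, ...) such that
   (..., b_2, b_1, 0, 0, ...) (b_1 at position 0) lies in S_beta *)
Definition Sminus (b : R) : set (nat -> int) :=
  [set s | Sbi b (fun i : int => if (i <= 0)%R then s `|i|%N else 0)].

Definition Sset : set R := [set b | 1 < b /\ Splus b = Sminus b].

Definition Qsq : set (R * R) :=
  [set p | (0 <= p.1 < 1) /\ (0 <= p.2 < 1)].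

Definition Tbl (b l : R) (p : R * R) : R * R :=
  if p.2 < b^-1 then (l * p.1, b * p.2)
  else (l * p.1 + 1 - l, b * p.2 - 1).

Definition mR2 := (measurableTypeR R * measurableTypeR R)%type.

Definition leb2 : set mR2 -> \bar R :=
  (@lebesgue_measure R \x @lebesgue_measure R)%E.

Definition nuQ : set mR2 -> \bar R := fun A => leb2 (A `&` Qsq).

Definition nu_n (b l : R) (n : nat) : set mR2 -> \bar R :=
  fun A => (((n%:R)^-1)%:E *
    \sum_(k < n) pushforward nuQ (iter k (Tbl b l) : mR2 -> mR2) A)%E.

Definition weak_limit_on_Q (nus : nat -> set mR2 -> \bar R)
  (mu : set mR2 -> \bar R) : Prop :=
  forall f : R * R -> R,
    {within Qsq, continuous f} ->
    (exists M : R, forall p, Qsq p -> `|f p| <= M) ->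
    (fun n => integral (nus n) (Qsq : set mR2) (fun p => (f p)%:E))
      @ \oo --> integral mu (Qsq : set mR2) (fun p => (f p)%:E).

Definition is_SRB (b l : R) (mu : {measure set mR2 -> \bar R}) : Prop :=
  mu (~` Qsq) = 0%E /\ weak_limit_on_Q (nu_n b l) mu.

End Defs.

(* Main.v *)
Require Import Defs.
From HB Require Import structures.
From mathcomp Require Import all_boot all_order all_algebra.
From mathcomp Require Import all_classical all_reals all_analysis.
From mathcomp Require Import measurable_realfun ring lra zify.
Set Implicit Arguments. Unset Strict Implicit. Unset Printing Implicit Defensive.
Import Order.TTheory GRing.Theory Num.Theory.
Import numFieldNormedType.Exports.
Local Open Scope classical_set_scope.
Local Open Scope ring_scope.

(* The beta-map y |-> b y mod 1 has a piecewise affine, area preserving natural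
   extension on a tower {(v, y) : 0 <= v < b / (b - 1), 0 <= y < height v}, in
   which v encodes the past digits e_0, e_1, ... of y.  The map
   (v, y) |-> (x(v), y), where x(v) = (1 - l) sum_k e_k l^k, semiconjugates it
   to T_{b,l}; since T_{b,l} contracts horizontally and the orbit of 1 yields a
   renewal relation for Cesaro averages of the beta-map, the image of the
   normalised area of the tower is the SRB measure.  It is absolutely
   continuous as soon as the law of x(v) is.

   Take g in S and b <= g close to g.  Truncated past sequences of b belong to
   S_g^- = S_g^+, so they are digit sequences of numbers in [0, 1] in base g.
   If two pasts first differ at index m, the difference of their x-values is
   (1 - l) l^m G(l) up to sign, with G(l) = 1 + sum_k (a_k - c_k) l^k.  At
   l = 1/g the value is 1 + A - C with A, C in [0, 1]; if it is small, then A is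
   close to 0 and C is close to 1, which forces G to be strictly decreasing near
   1/g.  Hence |{l : |G(l)| < r}| = O(r).  As two pasts agree up to index m with
   probability O(b^-m), integrating over l >= l0 > 1/b gives
   sum_m (b l0)^-m < oo as a bound for the mean L^2-norm of the law of x(v) at
   every scale, and Fatou's lemma concludes. *)

(** * The expansion of 1 and the tower *)

(** The condition on g is about the order of reading: x(v) lists the digits of a past from the most
    recent one backwards, whereas admissibility concerns words read forwards. Finite pieces of a
    past, read forwards, stay admissible when the base grows from b to g, so the past lies in S_g^-;
    the equality with S_g^+ then gives a bound for the sum of e_k g^-(k+1). As this bound is in base
    g, the transversality constants depend on g alone and serve every b. Transversality comes from
    two opposite effects: a small A forces the first many a_k to vanish, so the a-part adds only a
    small tail to the slope of G, while C close to 1 gives the c-part a slope of at least 3/4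
    downwards. Two degeneracies shape the estimates. The orbit of 1 may reach 0; the levels of
    height 0 that result carry no area and are excluded through [live]. The series over m diverges
    as l0 tends to 1/b, hence a countable exhaustion in l0. The limit of the averages needs no
    ergodic theorem: the renewal relation is integrated over the tower, which identifies the limit.
    As Q is not closed, continuous test functions need not be uniformly continuous; they are
    approximated from below by Lipschitz ones. *)

Section BetaExpansionOfOne.
Variables (R : realType) (b : R).
Hypothesis hb : 1 < b < 2.

Definition orbit1 (j : nat) : R := iter j (fbeta b) 1.
Arguments orbit1 : simpl never.
(** A boolean is enough: [b < 2] and [orbit1 j <= 1] leave only the digits 0 and 1. *)
Definition digit1 (j : nat) : bool := 1 <= b * orbit1 j.

Lemma base_gt0 : 0 < b. Proof. by case/andP: hb => h _; apply: lt_trans h. Qed.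
Lemma inv_base_gt0 : 0 < b^-1. Proof. by rewrite invr_gt0 base_gt0. Qed.
Lemma inv_base_lt1 : b^-1 < 1. Proof. by rewrite invf_lt1 ?base_gt0//; case/andP: hb. Qed.
Lemma base_neq0 : b != 0. Proof. by rewrite gt_eqF ?base_gt0. Qed.

Lemma floor01 (x : R) : 0 <= x < 2 -> Num.floor x = ((1 <= x)%R : nat)%:Z.
Proof.
move=> /andP[x0 x2]; apply: floor_def.
by case: (leP 1 x) => x1 /=; apply/andP; split => //; lra.
Qed.

Lemma orbit1_bounds j : 0 <= orbit1 j <= 1 /\ ((0 < j)%N -> orbit1 j < 1).
Proof.
case: j => [|j]; first by rewrite /orbit1 /= ler01 lexx.
rewrite /orbit1 iterS /fbeta; set z := b * _.
have := floor_itv z; rewrite intrD => /andP[h1 h2].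
split; [|move=> _]; lra.
Qed.

Lemma orbit1_ge0 j : 0 <= orbit1 j.
Proof. by have [/andP[]] := orbit1_bounds j. Qed.

Lemma orbit1_le1 j : orbit1 j <= 1.
Proof. by have [/andP[]] := orbit1_bounds j. Qed.

Lemma orbit1S j : orbit1 j.+1 = b * orbit1 j - (digit1 j)%:R.
Proof.
rewrite {1}/orbit1 iterS /fbeta -/(orbit1 j) floor01 //.
have := orbit1_ge0 j; have := orbit1_le1 j; move: hb => /andP[h1 h2] h3 h4.
by apply/andP; split; nra.
Qed.


(** Closed form of the partial sum of [b^-i] over [i < j]: level i has width [b^-i]. *)
Definition level_left (j : nat) : R := (1 - b^-1 ^+ j) * (b / (b - 1)).
(** Closed form of the partial sum of [digit1 i * b^-(i+1)] over [i < j], i.e. of the expansion of 1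
    in base b; [b^-j * orbit1 j] is the remainder. *)
Definition return_left (j : nat) : R := 1 - b^-1 ^+ j * orbit1 j.
Definition tower_width : R := b / (b - 1).

Lemma inv_base_exp_gt0 j : 0 < b^-1 ^+ j.
Proof. by rewrite exprn_gt0// inv_base_gt0. Qed.

Lemma tower_width_gt1 : 1 < tower_width.
Proof. by rewrite /tower_width ltr_pdivlMr; move: hb => /andP[h1 h2]; lra. Qed.

Lemma level_leftS j : level_left j.+1 = level_left j + b^-1 ^+ j.
Proof.
have b1 : b - 1 != 0 by rewrite subr_eq0 gt_eqF//; case/andP: hb.
by rewrite /level_left exprSr; field; rewrite b1 base_neq0.
Qed.

Lemma level_left0 : level_left 0 = 0. Proof. by rewrite /level_left expr0 subrr mul0r. Qed.

Lemma level_left1 : level_left 1 = 1. Proof. by rewrite level_leftS level_left0 expr0 add0r. Qed.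

Lemma return_leftS j : return_left j.+1 = return_left j + (digit1 j)%:R * b^-1 ^+ j.+1.
Proof. by rewrite /return_left orbit1S !exprS; field; exact: base_neq0. Qed.

Lemma return_left0 : return_left 0 = 0.
Proof. by rewrite /return_left expr0 mul1r /orbit1 /= subrr. Qed.

Lemma inv_base_exp_cvg : (fun j => b^-1 ^+ j) @ \oo --> (0 : R).
Proof.
apply: cvg_expr; rewrite gtr0_norm ?inv_base_gt0//; exact: inv_base_lt1.
Qed.

Lemma step_locate (u : nat -> R) (l v : R) :
  u @ \oo --> l -> u 0 <= v -> v < l -> exists j, u j <= v < u j.+1.
Proof.
move=> ul u0 vl.
have [n un] : exists n, v < u n.
  have : \forall n \near \oo, v < u n by apply: cvgr_gt ul _ vl.
  by case=> n _ /(_ n (leqnn n)) /= h; exists n.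
elim: n un => [|n IH un]; first by rewrite ltNge u0.
have [un'|un'] := leP (u n) v; last exact: IH.
by exists n; rewrite un' un.
Qed.

Lemma step_unique (u : nat -> R) (v : R) i j : (forall n, u n <= u n.+1) ->
  u i <= v < u i.+1 -> u j <= v < u j.+1 -> i = j.
Proof.
move=> /nondecreasing_seqP nd /andP[i1 i2] /andP[j1 j2].
have [ij|ji|//] := ltngtP i j.
  by exfalso; have := nd _ _ ij; lra.
by exfalso; have := nd _ _ ji; lra.
Qed.

Lemma level_left_nd n : level_left n <= level_left n.+1.
Proof. by rewrite level_leftS lerDl ltW// inv_base_exp_gt0. Qed.

Lemma return_left_nd n : return_left n <= return_left n.+1.
Proof. by rewrite return_leftS lerDl mulr_ge0// ltW// inv_base_exp_gt0. Qed.

Lemma level_left_cvg : level_left @ \oo --> tower_width.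
Proof.
have : (fun j => (1 - b^-1 ^+ j) * tower_width) @ \oo --> (1 - 0) * tower_width.
  apply: cvgM; last exact: cvg_cst.
  by apply: cvgB; [exact: cvg_cst|exact: inv_base_exp_cvg].
by rewrite subr0 mul1r.
Qed.

Lemma return_left_cvg : return_left @ \oo --> (1 : R).
Proof.
rewrite -[X in _ --> X]subr0; apply: cvgB; first exact: cvg_cst.
apply: (@squeeze_cvgr _ _ _ _ (cst 0) (fun j => b^-1 ^+ j)).
- near=> j; rewrite /= mulr_ge0 ?orbit1_ge0 ?(ltW (inv_base_exp_gt0 _))//=.
  by rewrite ler_piMr ?orbit1_le1// ltW// inv_base_exp_gt0.
- exact: cvg_cst.
- exact: inv_base_exp_cvg.
Unshelve. all: by end_near. Qed.

(* The point [v] of [0, tower_width) encodes a past.  The interval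
   [level_left j, level_left j.+1), called level j, consists of the pasts ending
   with the first j digits of the expansion of 1, so that the present lies in
   [0, orbit1 j).  Appending [digit1 j] leads to level j + 1; appending 0 when
   [digit1 j] is 1 leads back to level 0, i.e. the present fills [0, 1).  The
   left end of the interval onto which level j is contracted when [a] is
   appended is [cell_left j a]. *)
Definition cell_left (j : nat) (a : bool) : R :=
  if a == digit1 j then level_left j.+1 else return_left j.

Definition cell (p : nat * bool) (v : R) : Prop :=
  (p.2 ==> digit1 p.1) /\ cell_left p.1 p.2 <= v < cell_left p.1 p.2 + b^-1 ^+ p.1.+1.

Definition cell_index (v : R) : nat * bool := get (cell ^~ v).
Definition last_digit (v : R) : bool := (cell_index v).2.
Definition past (v : R) : R :=
  level_left (cell_index v).1 + b * (v - cell_left (cell_index v).1 (cell_index v).2).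
Definition height (v : R) : R :=
  if (cell_index v).2 == digit1 (cell_index v).1 then orbit1 (cell_index v).1.+1 else 1.

Lemma cell_last j v : cell (j, digit1 j) v <-> level_left j.+1 <= v < level_left j.+2.
Proof.
rewrite /cell /= /cell_left eqxx implybb (level_leftS j.+1); split => [[]//|h]; by split.
Qed.

Lemma cell_first j a v : a != digit1 j ->
  cell (j, a) v <-> a = false /\ return_left j <= v < return_left j.+1.
Proof.
rewrite /cell /= /cell_left => /negPf aj; rewrite aj return_leftS.
case: a aj; case: (digit1 j) => //= _; rewrite ?mul1r ?mul0r ?addr0.
  by split => [[]|[]].
by split => [[]|[]].
Qed.

Lemma return_left_ge0 j : 0 <= return_left j.
Proof.
rewrite -return_left0; exact/(nondecreasing_seqP return_left).1/leq0n/return_left_nd.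
Qed.

(** The returning cells tile [[0, 1)] because the expansion of 1 sums to 1, and the levels of
    positive index tile [[1, tower_width)]. *)
Lemma cell_cover v : 0 <= v < tower_width -> exists p, cell p v.
Proof.
move=> /andP[v0 vM]; have [v1|v1] := ltP v 1.
  have [|j hj] := step_locate return_left_cvg _ v1; first by rewrite return_left0.
  (* The interval from [return_left j] to [return_left j.+1] contains v, so it is not empty and the
     digit cannot be 0. *)
  have dj : digit1 j.
    by move: hj; rewrite return_leftS; case: (digit1 j) => //; rewrite mul0r addr0; lra.
  by exists (j, false); apply/cell_first => //; rewrite dj.
have h : (fun n => level_left n.+1) @ \oo --> tower_width.
  by rewrite (@cvg_shiftS _ level_left); exact: level_left_cvg.
have [|j hj] := step_locate h _ vM; first by rewrite level_left1.
by exists (j, digit1 j); apply/cell_last.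
Qed.

Lemma cell_bounds p v : cell p v -> 0 <= v < tower_width.
Proof.
case: p => j a; have [->|aj] := eqVneq a (digit1 j).
  move=> /cell_last /andP[h1 h2].
  have h3 : 0 <= level_left j.+1.
    by rewrite /level_left mulr_ge0// ?subr_ge0 ?(ltW (lt_trans ltr01 tower_width_gt1))//
      exprn_ile1// ltW// ?inv_base_gt0// inv_base_lt1.
  have h4 : level_left j.+2 < tower_width.
    by rewrite /level_left gtr_pMl ?(lt_trans ltr01 tower_width_gt1)// gtrBl inv_base_exp_gt0.
  by apply/andP; split; lra.
move=> /cell_first-/(_ aj)[_ /andP[h1 h2]].
have := return_left_ge0 j; have := tower_width_gt1.
have : return_left j.+1 <= 1 by rewrite gerBl mulr_ge0// ?orbit1_ge0 ?(ltW (inv_base_exp_gt0 _)).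
by move=> ? ? ?; apply/andP; split; lra.
Qed.

Lemma cell_unique p q v : cell p v -> cell q v -> p = q.
Proof.
have Q1 j : return_left j.+1 <= 1.
  by rewrite gerBl mulr_ge0// ?orbit1_ge0 ?(ltW (inv_base_exp_gt0 _)).
have V1 j : 1 <= level_left j.+1.
  by rewrite -level_left1; apply/(nondecreasing_seqP level_left).1 => //; exact: level_left_nd.
case: p q => i a [j c].
have [->|ai] := eqVneq a (digit1 i); have [->|cj] := eqVneq c (digit1 j).
- move=> /cell_last h1 /cell_last h2.
  by rewrite (@step_unique (fun n => level_left n.+1) v i j)// => n; exact: level_left_nd.
- move=> /cell_last /andP[h1 _] /cell_first-/(_ cj)[_ /andP[_ h2]].
  by exfalso; have := Q1 j; have := V1 i; lra.
- move=> /cell_first-/(_ ai)[_ /andP[_ h2]] /cell_last /andP[h1 _].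
  by exfalso; have := Q1 i; have := V1 j; lra.
move=> /cell_first-/(_ ai)[-> h1] /cell_first-/(_ cj)[-> h2].
by rewrite (step_unique return_left_nd h1 h2).
Qed.

Lemma cell_indexE p v : cell p v -> cell_index v = p.
Proof.
move=> pv; apply: (@cell_unique _ _ v) => //.
by rewrite /cell_index; apply: (@getPex _ (cell ^~ v)); exists p.
Qed.

Lemma last_digitE j a v : cell (j, a) v -> last_digit v = a.
Proof. by rewrite /last_digit => /cell_indexE ->. Qed.

Lemma pastE j a v : cell (j, a) v -> past v = level_left j + b * (v - cell_left j a).
Proof. by rewrite /past => /cell_indexE ->. Qed.

Lemma heightE j a v : cell (j, a) v ->
  height v = if a == digit1 j then orbit1 j.+1 else 1.
Proof. by rewrite /height => /cell_indexE ->. Qed.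

Lemma past_level j a v : cell (j, a) v -> level_left j <= past v < level_left j.+1.
Proof.
move=> h; rewrite (pastE h); case: h => _ /= /andP[h1 h2].
rewrite level_leftS lerDl mulr_ge0 ?subr_ge0// ?(ltW base_gt0)//= ltrD2l.
by rewrite mulrC -ltr_pdivlMr ?base_gt0// mulrC -exprS ltrBlDl.
Qed.

(** A cell reached by appending [digit1] is a whole level; all other cells lie in level 0, whose
    height is [orbit1 0 = 1]. *)
Lemma height_level j v : level_left j <= v < level_left j.+1 -> height v = orbit1 j.
Proof.
case: j => [|j] h; last by move/cell_last/heightE : h => ->; rewrite eqxx.
move: h; rewrite level_left0 level_left1 => /andP[v0 v1].
have [[j a] /[dup] h] : exists p, cell p v.
  by apply: cell_cover; rewrite v0 (lt_trans v1)// tower_width_gt1.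
rewrite (heightE h); have [->|aj _] := eqVneq a (digit1 j); last by rewrite /orbit1.
have := (nondecreasing_seqP level_left).1 level_left_nd 1%N j.+1 (ltn0Sn _).
by rewrite level_left1 => h1 /cell_last; lra.
Qed.

Lemma level_range j v : level_left j <= v < level_left j.+1 -> 0 <= v < tower_width.
Proof.
case: j => [|j]; last by move/cell_last/cell_bounds.
by rewrite level_left0 level_left1 => /andP[-> h]; rewrite (lt_trans h)// tower_width_gt1.
Qed.

Lemma past_range v : 0 <= v < tower_width -> 0 <= past v < tower_width.
Proof. by move=> /cell_cover[[j a] /past_level/level_range]. Qed.

Lemma level_cover v : 0 <= v < tower_width -> exists j, level_left j <= v < level_left j.+1.
Proof.
by move=> /andP[v0 vM]; apply: (step_locate level_left_cvg) => //; rewrite level_left0.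
Qed.

Lemma height_ge0 v : 0 <= height v.
Proof. by rewrite /height; case: ifP => // _; exact: orbit1_ge0. Qed.

Lemma height_le1 v : height v <= 1.
Proof. by rewrite /height; case: ifP => // _; exact: orbit1_le1. Qed.

(** If the digit follows the expansion of 1, then [b * orbit1 j = orbit1 j.+1 + digit1 j]. If it is
    0 where [digit1 j] is 1, then [b * orbit1 j >= 1] leaves room for all of [[0, 1)]. *)
Lemma height_past v y : 0 <= v < tower_width -> 0 <= y < height v ->
  0 <= (y + (last_digit v)%:R) / b < height (past v).
Proof.
move=> /cell_cover[[j a] h] /andP[y0 yh].
rewrite (height_level (past_level h)) (last_digitE h) divr_ge0 ?addr_ge0 ?(ltW base_gt0)//=.
rewrite ltr_pdivrMr ?base_gt0// mulrC.
move: yh; rewrite (heightE h); case: h => /= + _.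
case: eqVneq => [-> _|]; first by rewrite orbit1S; lra.
by case: a => //=; case: (boolP (digit1 j)) => // + _ _; rewrite /digit1; lra.
Qed.

End BetaExpansionOfOne.
Arguments orbit1 : simpl never.

(** * Tools: image measures, plane Lebesgue measure, affine substitution, slices *)

Definition image_measure d d' (T1 : measurableType d) (T2 : measurableType d')
  (R : realType) (m : {measure set T1 -> \bar R}) (f : T1 -> T2)
  (mf : measurable_fun setT f) : {measure set T2 -> \bar R}.
Proof. by refine (pushforward m f : {measure set T2 -> \bar R}). Defined.

Section PlaneMeasure.
Variable R : realType.
Notation leb := (@lebesgue_measure R).

HB.instance Definition _ := Measure.on (@leb2 R).

(* For [\x] the library's sigma-finite instance is shadowed by the one for
   subprobabilities, hence this direct one. *)
Let leb2_sigma_finite : sigma_finite setT (@leb2 R).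
Proof.
have /sigma_finiteP[F [TF ndF Foo]] := sigma_finiteT leb.
exists (fun n => F n `*` F n).
  rewrite -setXTT TF predeqE => -[x y]; split.
    move=> [/= [n _ Fnx] [k _ Fky]]; exists (maxn n k) => //; split.
    - by move: x Fnx; exact/subsetPset/ndF/leq_maxl.
    - by move: y Fky; exact/subsetPset/ndF/leq_maxr.
  by move=> [n _ []/= ? ?]; split; exists n.
move=> k; have [? ?] := Foo k; split; first exact: measurableX.
by rewrite /leb2 product_measure1E// lte_mul_pinfty// ge0_fin_numE.
Qed.

HB.instance Definition _ := Measure_isSigmaFinite.Build _ _ _ (@leb2 R)
  leb2_sigma_finite.

End PlaneMeasure.

Section AffineChange.
Variable R : realType.
Notation leb := (@lebesgue_measure R).
Notation MR := (measurableTypeR R).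

Lemma affine_preimage_itv (s t p q : R) b0 b1 : 0 < s ->
  (fun x : R => s * x + t) @^-1` [set` Interval (BSide b0 p) (BSide b1 q)] =
  [set` Interval (BSide b0 ((p - t) / s)) (BSide b1 ((q - t) / s))].
Proof.
move=> s0; apply/seteqP; split => x /=; case: b0; case: b1; rewrite !in_itv /=;
  rewrite ?ler_pdivrMr ?ltr_pdivrMr ?ler_pdivlMr ?ltr_pdivlMr//;
  by move=> /andP[h1 h2]; apply/andP; split; lra.
Qed.

Lemma measurable_affine (s t : R) :
  measurable_fun [set: MR] ((fun x : R => s * x + t) : MR -> MR).
Proof.
have h : measurable_fun [set: R] (fun x : R => s * x + t).
  by apply: measurable_funD => //; apply: measurable_funM.
exact: h.
Qed.

Lemma integral_affine (s t p q : R) (phi : MR -> \bar R) : 0 < s ->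
  measurable_fun setT phi -> (forall x, 0 <= phi x)%E ->
  (\int[leb]_(x in `[p, q[) phi (s * x + t)%R =
  (s^-1)%:E * \int[leb]_(x in `[(s * p + t)%R, (s * q + t)%R[) phi x)%E.
Proof.
move=> s0 mphi phi0.
pose T : MR -> MR := fun x : R => s * x + t.
have mT : measurable_fun setT T by exact: measurable_affine.
have s1 : 0 <= s by exact: ltW.
(* [m] is Lebesgue measure again: by uniqueness it suffices to compare the two on intervals. The
   substitution then becomes integration against an image measure. *)
pose m := mscale (NngNum s1) (image_measure leb mT).
have -> : (\int[leb]_(x in `[(s * p + t)%R, (s * q + t)%R[) phi x =
   \int[m]_(x in `[(s * p + t)%R, (s * q + t)%R[) phi x)%E.
  apply: eq_measure_integral => A mA _; apply: lebesgue_measure_unique => // X.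
  move=> [[x y] _ <-] /=.
  rewrite /m /mscale /= /pushforward /T affine_preimage_itv// !lebesgue_measure_itv /=.
  rewrite !lte_fin ltr_pM2r ?invr_gt0// ltrD2r.
  by case: ifP => _; rewrite ?mule0// -!EFinB -EFinM; congr EFin; field; rewrite gt_eqF.
rewrite /m ge0_integral_mscale//; last exact: measurable_funTS.
rewrite muleA -EFinM mulVf ?gt_eqF// mul1e ge0_integral_pushforward//=.
- rewrite /T affine_preimage_itv//.
  have hs z : (s * z + t - t) / s = z by field; rewrite gt_eqF.
  by rewrite !hs.
- exact: measurable_funTS.
Qed.

End AffineChange.

Section SliceIntegrals.
Variable R : realType.
Notation leb := (@lebesgue_measure R).
Notation MR := (measurableTypeR R).

Lemma measurable_slice_integral (A : set MR) (F : MR * MR -> \bar R) :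
  measurable A -> measurable_fun setT F -> (forall p, 0 <= F p)%E ->
  measurable_fun setT (fun u : MR => \int[leb]_(z in A) F (u, z))%E.
Proof.
move=> mA mF F0.
pose G := F \_ (setT `*` A).
have mG : measurable_fun setT G.
  by apply/(measurable_restrictT F) => //; [exact: measurableX|exact: measurable_funTS].
have G0 p : (0 <= G p)%E by rewrite /G patchE; case: ifP.
have := @measurable_fun_fubini_tonelli_F _ _ MR MR R leb G mG G0.
congr (measurable_fun _ _); apply/funext => u.
rewrite /fubini_F [RHS]integral_mkcond; apply: eq_integral => z _.
rewrite /G !patchE; congr (if _ then _ else _).
by apply/idP/idP; rewrite !inE /=; tauto.
Qed.

Lemma integral_leb2 (B : set (mR2 R)) (F : mR2 R -> \bar R) :
  measurable B -> measurable_fun setT F -> (forall p, 0 <= F p)%E ->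
  (\int[@leb2 R]_(p in B) F p =
   \int[leb]_v \int[leb]_(y in [set y | B (v, y)]) F (v, y))%E.
Proof.
move=> mB mF F0; rewrite integral_mkcond /leb2 fubini_tonelli1; last 2 first.
- by apply/(measurable_restrictT F) => //; exact: measurable_funTS.
- by move=> p; rewrite patchE; case: ifP.
apply: eq_integral => v _; rewrite /fubini_F [RHS]integral_mkcond.
apply: eq_integral => y _; by rewrite !patchE; congr (if _ then _ else _).
Qed.

End SliceIntegrals.

(** * Invariance of area under the inverse of the natural extension *)

Section NaturalExtension.
Variables (R : realType) (b : R).
Hypothesis hb : 1 < b < 2.
Notation leb := (@lebesgue_measure R).
Notation MR := (measurableTypeR R).
Notation V := (level_left b).

Definition level (j : nat) : set MR := [set` `[V j, V j.+1[].

Lemma levelP j v : level j v <-> V j <= v < V j.+1.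
Proof. by rewrite /level /= in_itv. Qed.

Lemma measurable_level j : measurable (level j).
Proof. exact: measurable_itv. Qed.

Lemma cell_itv p : cell b p = if p.2 ==> digit1 b p.1 then
  [set` `[cell_left b p.1 p.2, (cell_left b p.1 p.2 + b^-1 ^+ p.1.+1)%R[] else set0.
Proof.
apply/seteqP; split => v; rewrite /cell; case: ifP => //= _.
all: try (by case).
all: by rewrite in_itv /=; try (by case).
Qed.

Lemma measurable_cell p : measurable (cell b p : set MR).
Proof. by rewrite cell_itv; case: ifP => _; [exact: measurable_itv|exact: measurable0]. Qed.

Lemma measurable_cell_index p : measurable ([set v | cell_index b v = p] : set MR).
Proof.
(* Where no cell contains v, [get] returns the default [point]; the fibre over [point] therefore
   also contains the complement of [[0, tower_width)]. *)
have [->|pp] := eqVneq p point.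
  have -> : [set v | cell_index b v = point] =
            cell b point `|` ~` [set` `[0, (tower_width b)%R[].
    apply/seteqP; split => v /=; rewrite in_itv /=.
      have [hv|hv _] := boolP (0 <= v < tower_width b); last by right => /=.
      have [p' hp'] := cell_cover hb hv.
      by rewrite (cell_indexE hb hp') => <-; left.
    case => [h|h]; first exact: cell_indexE.
    rewrite /cell_index getPN // => q hq; apply: h; exact: cell_bounds hq.
  apply: measurableU; first exact: measurable_cell.
  by apply: measurableC; exact: measurable_itv.
have -> : [set v | cell_index b v = p] = cell b p.
  apply/seteqP; split => v /=; last exact: cell_indexE.
  have [[q hq]|hN] := pselect (exists q, cell b q v).
    by rewrite (cell_indexE hb hq) => <-.
  rewrite /cell_index getPN => [/esym|q hq]; first by move: pp => /eqP.
  by apply: hN; exists q.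
exact: measurable_cell.
Qed.

(** Measurability of everything defined through [cell_index] rests on there being only countably
    many cells. *)
Lemma measurable_cellwise d (T : measurableType d) (F : nat * bool -> MR -> T) :
  (forall p, measurable_fun setT (F p)) ->
  measurable_fun setT (fun v : MR => F (cell_index b v) v).
Proof.
move=> mF _ Y mY; rewrite setTI.
have -> : (fun v => F (cell_index b v) v) @^-1` Y =
    \bigcup_p ([set v | cell_index b v = p] `&` F p @^-1` Y).
  by apply/seteqP; split => [v h|v [p _ [/= ->]]//]; exists (cell_index b v).
apply: countable_bigcupT_measurable => [|p]; first exact: countableP.
apply: measurableI; first exact: measurable_cell_index.
by rewrite -[X in measurable X]setTI; exact: mF.
Qed.

Lemma measurable_past : measurable_fun setT (past b : MR -> MR).
Proof.
apply: (@measurable_cellwise _ _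
  (fun p v => (V p.1 + b * (v - cell_left b p.1 p.2)) : MR)) => p.
have := measurable_affine b (V p.1 - b * cell_left b p.1 p.2).
by congr (measurable_fun _ _); apply/funext => v; ring.
Qed.

Lemma measurable_last_digit : measurable_fun setT (last_digit b : MR -> bool).
Proof. exact: (@measurable_cellwise _ _ (fun p _ => p.2)). Qed.

Lemma measurable_height : measurable_fun setT (height b : MR -> R).
Proof.
exact: (@measurable_cellwise _ _
  (fun p _ => if p.2 == digit1 b p.1 then orbit1 b p.1.+1 else 1)).
Qed.

Lemma bigcup_level : \bigcup_j level j = [set` `[0, (tower_width b)%R[].
Proof.
apply/seteqP; split => [v [j _ /levelP/(level_range hb)]|v]; rewrite /= in_itv//=.
by move=> /(level_cover hb)[j /levelP hj]; exists j.
Qed.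

Lemma trivIset_level : trivIset setT level.
Proof.
apply/trivIsetP => i j _ _ /eqP ij; apply/seteqP; split => // v [].
move=> /levelP hi /levelP hj; apply: ij.
exact: step_unique (level_left_nd hb) hi hj.
Qed.

(** Cells are grouped by the level onto which [past] maps them, so that sums over cells and over
    levels can be compared index by index. *)
Definition cells (j : nat) : set MR := cell b (j, false) `|` cell b (j, true).

Lemma bigcup_cells : \bigcup_j cells j = [set` `[0, (tower_width b)%R[].
Proof.
apply/seteqP; split => [v [j _ [|] /(cell_bounds hb)]|v]; rewrite /= in_itv//=.
by move=> /(cell_cover hb)[[j []] h]; exists j => //; [right|left].
Qed.

Lemma trivIset_cells : trivIset setT cells.
Proof.
apply/trivIsetP => i j _ _ /eqP ij; apply/seteqP; split => // v [].
by move=> [] hi [] hj; apply: ij; case: (cell_unique hb hi hj).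
Qed.

Lemma integral_levels (phi : MR -> \bar R) :
  measurable_fun setT phi -> (forall x, 0 <= phi x)%E ->
  (\int[leb]_(v in `[0%R, tower_width b[) phi v =
   \sum_(j <oo) \int[leb]_(v in level j) phi v)%E.
Proof.
move=> mphi phi0; rewrite -bigcup_level ge0_integral_bigcup//.
- exact: measurable_level.
- exact: measurable_funTS.
- exact: trivIset_level.
Qed.

Lemma integral_cells (phi : MR -> \bar R) :
  measurable_fun setT phi -> (forall x, 0 <= phi x)%E ->
  (\int[leb]_(v in `[0%R, tower_width b[) phi v =
   \sum_(j <oo) (\int[leb]_(v in cell b (j, false)) phi v +
                 \int[leb]_(v in cell b (j, true)) phi v))%E.
Proof.
move=> mphi phi0; rewrite -bigcup_cells ge0_integral_bigcup//.
- apply: eq_eseriesr => j _; rewrite /cells ge0_integral_setU//.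
  + exact: measurable_cell.
  + exact: measurable_cell.
  + exact: measurable_funTS.
  + apply/disj_setPS => v [h1 h2].
    by have := cell_unique hb h1 h2.
- by move=> j; apply: measurableU; exact: measurable_cell.
- exact: measurable_funTS.
- exact: trivIset_cells.
Qed.

Lemma integral_cell_past j a (phi : MR -> \bar R) : a ==> digit1 b j ->
  measurable_fun setT phi -> (forall x, 0 <= phi x)%E ->
  (\int[leb]_(v in cell b (j, a)) phi (past b v) =
   (b^-1)%:E * \int[leb]_(u in level j) phi u)%E.
Proof.
move=> aj mphi phi0.
transitivity (\int[leb]_(v in cell b (j, a)) phi (b * v + (V j - b * cell_left b j a))%R)%E.
  apply: eq_integral => v /[!inE] h; rewrite (pastE hb h).
  by have -> : V j + b * (v - cell_left b j a) = b * v + (V j - b * cell_left b j a) :> R by ring.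
rewrite cell_itv /= aj integral_affine ?base_gt0//; congr (_ * integral _ _ _)%E.
rewrite /level level_leftS// exprS; have b0 := base_neq0 hb.
have -> : b * cell_left b j a + (V j - b * cell_left b j a) = V j :> R by ring.
by have -> : b * (cell_left b j a + b^-1 * b^-1 ^+ j) + (V j - b * cell_left b j a) =
  V j + b^-1 ^+ j :> R by field.
Qed.

Lemma integral_cell_invalid j a (phi : MR -> \bar R) : ~~ (a ==> digit1 b j) ->
  (\int[leb]_(v in cell b (j, a)) phi v = 0)%E.
Proof. by move=> /negPf aj; rewrite cell_itv /= aj integral_set0. Qed.

Lemma integral_fibre_past (F : MR * MR -> \bar R) u (a : bool) h :
  measurable_fun setT F -> (forall p, 0 <= F p)%E ->
  (\int[leb]_(y in `[0%R, h[) F (u, (y + a%:R) / b)%R =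
   b%:E * \int[leb]_(z in `[(a%:R / b)%R, ((h + a%:R) / b)%R[) F (u, z))%E.
Proof.
move=> mF F0.
transitivity (\int[leb]_(y in `[0%R, h[) F (u, b^-1 * y + a%:R / b)%R)%E.
  by apply: eq_integral => y _; rewrite mulrDl [(y / b)%R]mulrC.
rewrite (@integral_affine R b^-1 (a%:R / b) 0 h (fun z => F (u, z))) ?(inv_base_gt0 hb)//; last first.
  exact: measurableT_comp mF (measurable_pair1 _).
rewrite invrK; congr (_ * integral _ _ _)%E.
by rewrite mulr0 add0r [(b^-1 * h)%R]mulrC -mulrDl.
Qed.

Definition fibre_height (j : nat) (a : bool) : R :=
  if a == digit1 b j then orbit1 b j.+1 else 1.

(** The expansion of [past] by b and the contraction of the fibre by [b^-1] cancel. *)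
Lemma integral_cell_fibre j a (F : MR * MR -> \bar R) : a ==> digit1 b j ->
  measurable_fun setT F -> (forall p, 0 <= F p)%E ->
  (\int[leb]_(v in cell b (j, a)) \int[leb]_(y in `[0%R, height b v[)
     F (past b v, (y + (last_digit b v)%:R) / b)%R =
   \int[leb]_(u in level j) \int[leb]_(z in
     `[(a%:R / b)%R, ((fibre_height j a + a%:R) / b)%R[) F (u, z))%E.
Proof.
move=> aj mF F0.
pose psi u := (\int[leb]_(z in `[(a%:R / b)%R, ((fibre_height j a + a%:R) / b)%R[)
  F (u, z))%E.
have mpsi : measurable_fun setT (psi : MR -> \bar R).
  by apply: measurable_slice_integral => //; exact: measurable_itv.
have psi0 u : (0 <= psi u)%E by apply: integral_ge0.
transitivity (\int[leb]_(v in cell b (j, a)) (b%:E * psi (past b v)))%E.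
  apply: eq_integral => v /[!inE] h.
  rewrite (last_digitE hb h) (heightE hb h) -/(fibre_height j a).
  exact: integral_fibre_past.
rewrite ge0_integralZl_EFin//.
- rewrite integral_cell_past// muleA -EFinM divff ?mul1e//; exact: base_neq0 hb.
- exact: measurable_cell.
- by apply: measurable_funTS; exact: measurableT_comp mpsi measurable_past.
- exact/ltW/base_gt0.
Qed.

(** Over level j, digit 0 fills the part of the fibre below [b^-1] and digit 1 the part above it. If
    [digit1 j] is 0, then [orbit1 j < b^-1] and digit 0 alone fills the fibre. *)
Lemma natural_extension_invariant (F : MR * MR -> \bar R) :
  measurable_fun setT F -> (forall p, 0 <= F p)%E ->
  (\int[leb]_(v in `[0%R, tower_width b[) \int[leb]_(y in `[0%R, height b v[)
     F (past b v, (y + (last_digit b v)%:R) / b)%R =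
   \int[leb]_(v in `[0%R, tower_width b[) \int[leb]_(y in `[0%R, height b v[) F (v, y))%E.
Proof.
move=> mF F0.
have mP (G : MR * MR -> \bar R) : measurable_fun setT G -> (forall p, 0 <= G p)%E ->
    measurable_fun setT (fun v : MR => \int[leb]_(y in `[0%R, height b v[) G (v, y))%E.
  move=> mG G0.
  have := @measurable_cellwise _ _ (fun p v => \int[leb]_(y in `[0%R,
    fibre_height p.1 p.2[) G (v, y))%E.
  apply=> p; apply: measurable_slice_integral => //; exact: measurable_itv.
pose F' (p : MR * MR) := F (past b p.1, (p.2 + (last_digit b p.1)%:R) / b).
have mF' : measurable_fun setT F'.
  apply: measurableT_comp mF _; apply: measurable_fun_pair => /=.
    exact: measurableT_comp measurable_past measurable_fst.
  have h : measurable_fun setT (fun p : MR * MR => ((p.2 : R) + (last_digit b p.1)%:R) / b).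
    apply: measurable_funM; last exact: measurable_cst.
    apply: measurable_funD; first exact: measurable_snd.
    have : measurable_fun setT (fun a : bool => (a%:R : R)) by [].
    move=> /measurableT_comp; apply.
    exact: measurableT_comp measurable_last_digit measurable_fst.
  exact: h.
rewrite (integral_cells (mP F' mF' _)); last 2 first.
- by move=> p; exact: F0.
- by move=> v; apply: integral_ge0 => y _; exact: F0.
rewrite (integral_levels (mP F mF _))//; last first.
  by move=> v; apply: integral_ge0 => y _; exact: F0.
apply: eq_eseriesr => j _.
have mI (p q : R) : measurable_fun setT (fun u : MR => \int[leb]_(z in `[p, q[) F (u, z))%E.
  by apply: measurable_slice_integral => //; exact: measurable_itv.
have b0 := base_gt0 hb; have ib0 := inv_base_gt0 hb.
have -> : (\int[leb]_(v in level j) \int[leb]_(y in `[0%R, height b v[) F (v, y) =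
   \int[leb]_(v in level j) \int[leb]_(y in `[0%R, orbit1 b j[) F (v, y))%E.
  by apply: eq_integral => v /[!inE] /levelP h; rewrite (height_level hb h).
have [dj|dj] := boolP (digit1 b j).
- have vt : true ==> digit1 b j by rewrite dj.
  have vf : false ==> digit1 b j by [].
  rewrite (integral_cell_fibre vt mF F0) (integral_cell_fibre vf mF F0).
  rewrite -ge0_integralD//; last 5 first.
  + exact: measurable_level.
  + by move=> u _; apply: integral_ge0.
  + exact: measurable_funTS.
  + by move=> u _; apply: integral_ge0.
  + exact: measurable_funTS.
  apply: eq_integral => u _.
  rewrite /fibre_height dj /= mul0r addr0 !mul1r orbit1S//. rewrite dj subrK.
  rewrite [(b * _)%R]mulrC mulfK ?gt_eqF//.
  (* The two fibre pieces [[0, b^-1)] and [[b^-1, orbit1 j)] are glued together. *)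
  rewrite -ge0_integral_setU//.
  + congr (integral _ _ _); apply/seteqP; split => z /=; rewrite !in_itv /=.
      move: dj; rewrite /digit1 -ler_pdivrMl// mulr1 => dj.
      by case=> /andP[h1 h2]; apply/andP; split => //; lra.
    by move=> /andP[h1 h2]; case: (ltP z b^-1) => h; [left|right]; rewrite ?h1 ?h2.
  + by apply: measurable_funTS; exact: measurableT_comp mF (measurable_pair1 _).
  + apply/disj_setPS => z [] /=; rewrite !in_itv /=; lra.
have vf : false ==> digit1 b j by [].
have vt : ~~ (true ==> digit1 b j) by [].
rewrite (integral_cell_invalid _ vt) adde0 (integral_cell_fibre vf mF F0).
apply: eq_integral => u _.
rewrite /fibre_height (negPf dj) /= mul0r addr0 orbit1S//.
rewrite (negPf dj) subr0.
by rewrite [(b * _)%R]mulrC mulfK ?gt_eqF.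
Qed.

End NaturalExtension.

(** * Measure of the sets of pasts with prescribed recent digits *)

Section PastDigits.
Variables (R : realType) (b : R).
Hypothesis hb : 1 < b < 2.
Notation leb := (@lebesgue_measure R).
Notation MR := (measurableTypeR R).

Definition past_digit (v : R) (i : nat) : bool := last_digit b (iter i (past b) v).

Lemma past_digitS v i : past_digit v i.+1 = past_digit (past b v) i.
Proof. by rewrite /past_digit iterSr. Qed.

Lemma iter_past_range v i : 0 <= v < tower_width b -> 0 <= iter i (past b) v < tower_width b.
Proof. by move=> h; elim: i => //= i; exact: past_range. Qed.

Lemma measurable_iter_past i : measurable_fun setT (iter i (past b) : MR -> MR).
Proof.
elim: i => [|i IH]; first exact: measurable_id.
exact: measurableT_comp (measurable_past hb) IH.
Qed.

Lemma measurable_past_digit i : measurable_fun setT ((fun v => past_digit v i) : MR -> bool).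
Proof. exact: measurableT_comp (measurable_last_digit hb) (measurable_iter_past i). Qed.

(** Every level is the image under [past] of at most one cell with last digit [a], and [past]
    expands that cell by b. Prescribing one digit thus costs a factor [b^-1]. *)
Lemma integral_past_digit_le (a : bool) (phi : MR -> \bar R) :
  measurable_fun setT phi -> (forall x, 0 <= phi x)%E ->
  (\int[leb]_(v in `[0%R, tower_width b[) (if last_digit b v == a then phi (past b v) else 0) <=
   (b^-1)%:E * \int[leb]_(v in `[0%R, tower_width b[) phi v)%E.
Proof.
move=> mphi phi0.
set F := fun v : MR => if last_digit b v == a then phi (past b v) else 0%E.
have mF : measurable_fun setT F.
  apply: measurable_fun_ifT => //.
    have : measurable_fun setT (fun c : bool => c == a) by [].
    by move=> /measurableT_comp; apply; exact: measurable_last_digit.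
  exact: measurableT_comp mphi (measurable_past hb).
have F0 v : (0 <= F v)%E by rewrite /F; case: ifP.
have ib0 : 0 <= b^-1 by rewrite ltW// inv_base_gt0.
rewrite (integral_cells hb mF F0) (integral_levels hb mphi phi0) -nneseriesZl//; last first.
  by move=> j _; exact: integral_ge0.
apply: lee_nneseries => [j _ _|j _].
  by apply: adde_ge0; exact: integral_ge0.
have FE c : (\int[leb]_(v in cell b (j, c)) F v)%E =
    if c == a then (\int[leb]_(v in cell b (j, c)) phi (past b v))%E else 0%E.
  case: eqP => ca.
    by apply: eq_integral => v /[!inE] h; rewrite /F (last_digitE hb h) ca eqxx.
  rewrite (eq_integral (cst 0%E)) ?integral0// => v /[!inE] h.
  by rewrite /F (last_digitE hb h); case: eqP.
have le c : (\int[leb]_(v in cell b (j, c)) phi (past b v) <=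
    (b^-1)%:E * \int[leb]_(u in level b j) phi u)%E.
  have [cj|cj] := boolP (c ==> digit1 b j); first by rewrite integral_cell_past.
  by rewrite integral_cell_invalid// mule_ge0// integral_ge0.
by rewrite !FE; case: (a) => /=; rewrite ?add0e ?adde0; exact: le.
Qed.

Definition cylinder (m : nat) (w : nat -> bool) : set MR :=
  [set v | 0 <= v < tower_width b /\ forall i, (i < m)%N -> past_digit v i = w i].

Lemma measurable_cylinder m w : measurable (cylinder m w).
Proof.
have -> : cylinder m w = `[0, (tower_width b)[ `&`
    \bigcap_(i in [set i | (i < m)%N]) ((fun v => past_digit v i) @^-1` [set w i]).
  by apply/seteqP; split => v; rewrite /cylinder /= in_itv.
apply: measurableI; first exact: measurable_itv.
apply: bigcap_measurableType => i _.
by rewrite -[X in measurable X]setTI; exact: measurable_past_digit.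
Qed.

(** The most recent digit is peeled off and the remaining ones are read at [past v]; each peeling
    gains [b^-1]. *)
Lemma lebesgue_cylinder m w : (leb (cylinder m w) <= (b^-1 ^+ m * tower_width b)%:E)%E.
Proof.
elim: m w => [|m IH] w.
  rewrite expr0 mul1r.
  have -> : cylinder 0 w = `[0, (tower_width b)[%classic.
    by apply/seteqP; split => v; rewrite /cylinder /= in_itv /=; [case|].
  rewrite lebesgue_measure_itv /= lte_fin (lt_trans ltr01 (tower_width_gt1 hb)).
  by rewrite oppr0 adde0.
set w' := fun i => w i.+1.
have -> : leb (cylinder m.+1 w) = (\int[leb]_(v in `[0%R, tower_width b[)
    (if last_digit b v == w 0%N then (\1_(cylinder m w') (past b v))%:E else 0))%E.
  rewrite -[LHS]mul1e -integral_cst; last exact: measurable_cylinder.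
  rewrite [LHS]integral_mkcond [RHS]integral_mkcond; apply: eq_integral => v _.
  rewrite !patchE /indic; case: ifPn => [|].
    rewrite inE => -[h1 h2].
    have hv : v \in ([set` `[0%R, tower_width b[] : set R) by rewrite inE /= in_itv.
    have h20 : last_digit b v = w 0%N by exact: (h2 0%N).
    rewrite hv h20 eqxx mem_set//.
    by split => [|i im]; [exact: past_range|rewrite -past_digitS h2].
  rewrite notin_setE /cylinder /= => h; case: ifPn => //; rewrite inE /= in_itv /= => hv.
  case: eqP => // h0; rewrite memNset// => -[_ h2]; apply: h; split => // -[|i] im //.
  by rewrite past_digitS h2.
apply: (le_trans (@integral_past_digit_le (w 0%N)
    (fun v => (\1_(cylinder m w') v)%:E) _ _)) => //.
- by apply/measurable_EFinP/measurable_indic; exact: measurable_cylinder.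
rewrite integral_indic//; last exact: measurable_cylinder.
rewrite exprS -mulrA EFinM lee_pmul2l ?lte_fin ?inv_base_gt0//.
apply: le_trans (IH w'); apply: le_measure; rewrite ?inE.
- by apply: measurableI; [exact: measurable_cylinder|exact: measurable_itv].
- exact: measurable_cylinder.
- exact: subIsetl.
Qed.

Definition agree (m : nat) : set (mR2 R) :=
  [set p | [/\ 0 <= p.1 < tower_width b, 0 <= p.2 < tower_width b &
    forall i, (i < m)%N -> past_digit p.1 i = past_digit p.2 i]].

Lemma measurable_agree m : measurable (agree m).
Proof.
have -> : agree m = (`[0, (tower_width b)[ `*` `[0, (tower_width b)[) `&`
    \bigcap_(i in [set i | (i < m)%N])
      ((fun p : mR2 R => past_digit p.1 i == past_digit p.2 i) @^-1` [set true]).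
  apply/seteqP; split => v; rewrite /agree /= !in_itv /=.
    by case=> h1 h2 h3; split => // i /= im; apply/eqP; exact: h3.
  by case=> -[h1 h2] h3; split => // i im; apply/eqP; exact: h3.
apply: measurableI; first by apply: measurableX; exact: measurable_itv.
apply: bigcap_measurableType => i _.
rewrite -[X in measurable X]setTI.
have m1 : measurable_fun setT (fun p : mR2 R => past_digit p.1 i).
  exact: measurableT_comp (measurable_past_digit i) measurable_fst.
have m2 : measurable_fun setT (fun p : mR2 R => past_digit p.2 i).
  exact: measurableT_comp (measurable_past_digit i) measurable_snd.
have : measurable_fun setT (fun p : mR2 R => past_digit p.1 i == past_digit p.2 i).
  have -> : (fun p : mR2 R => past_digit p.1 i == past_digit p.2 i) =
    (fun p => if past_digit p.1 i then past_digit p.2 i else ~~ past_digit p.2 i).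
    by apply/funext => p; case: (past_digit p.1 i); case: (past_digit p.2 i).
  by apply: measurable_fun_ifT => //; exact: measurable_neg.
by apply.
Qed.

(** For a fixed first past, the second one is confined to a single cylinder of length m. *)
Lemma leb2_agree m : (@leb2 R (agree m) <= (tower_width b ^+ 2 * b^-1 ^+ m)%:E)%E.
Proof.
have M0 : 0 <= tower_width b by rewrite ltW// (lt_trans ltr01)// tower_width_gt1.
rewrite /leb2 /product_measure1 /=.
pose B := fun v : MR => if (v : R) \in `[0, tower_width b[ then (b^-1 ^+ m * tower_width b)%:E else 0%E.
have BE : B = cst (b^-1 ^+ m * tower_width b)%:E \_ `[0, tower_width b[.
  by apply/funext => v; rewrite patchE /B mem_setE.
apply: (@le_trans _ _ (\int[leb]_v B v)%E).
  apply: ge0_le_integral => //.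
  - exact: measurable_fun_xsection (measurable_agree m).
  - rewrite BE; apply/(measurable_restrictT _ _).1 => //; exact: measurable_itv.
  move=> v _ /=; rewrite /B; case: ifPn => hv.
    apply: le_trans (lebesgue_cylinder m (past_digit v)); apply: le_measure; rewrite ?inE.
    - by apply: measurable_xsection; exact: measurable_agree.
    - exact: measurable_cylinder.
    - by move=> y /xsectionP [h1 h2 h3]; split => // i im; rewrite h3.
  rewrite (_ : xsection _ _ = set0) ?measure0//.
  apply/seteqP; split => // y /xsectionP [h1 _ _].
  by move: hv; rewrite in_itv /= h1.
rewrite BE -integral_mkcond integral_cst//= lebesgue_measure_itv/= lte_fin.
rewrite (lt_trans ltr01 (tower_width_gt1 hb)) oppr0 adde0 -EFinM lee_fin expr2.
by rewrite mulrC mulrA mulrAC.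
Qed.

End PastDigits.

(** * Admissibility and transversality *)

Section AdmissiblePasts.
Variable R : realType.
Implicit Types (b g x : R).

Lemma fbeta_ge0 g x : 0 <= fbeta g x.
Proof. by rewrite /fbeta subr_ge0 floor_le_tmp. Qed.

Lemma beta_expansion_le g x N : 1 < g -> 0 <= x ->
  \sum_(k < N) (beta_digits g x k)%:~R * g^-1 ^+ k.+1 <= x.
Proof.
move=> g1 x0; have g0 : 0 < g by exact: lt_trans g1.
suff -> : \sum_(k < N) (beta_digits g x k)%:~R * g^-1 ^+ k.+1 =
    x - g^-1 ^+ N * iter N (fbeta g) x.
  rewrite gerBl mulr_ge0 ?exprn_ge0 ?invr_ge0 ?(ltW g0)//.
  by case: N => [|N] //=; exact: fbeta_ge0.
elim: N => [|N IH]; first by rewrite big_ord0 expr0 mul1r subrr.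
rewrite big_ord_recr /= IH /beta_digits; set z := iter N (fbeta g) x.
rewrite /fbeta !exprS.
by field; rewrite gt_eqF.
Qed.

Section ReversedWord.
Variables (g : R) (s : nat -> bool).
Hypothesis g1 : 1 < g.

(** Value in base g of the word [s (i-1), ..., s 1, s 0] followed by zeros. With [s 0] the most
    recent digit, this is the chronological order. *)
Fixpoint revval (i : nat) : R :=
  if i is j.+1 then (revval j + (s j)%:R) / g else 0.

Hypothesis revval01 : forall i, 0 <= revval i < 1.

Lemma floor_revval i : Num.floor (g * revval i.+1) = (s i : nat)%:Z.
Proof.
have g0 : g != 0 by rewrite gt_eqF// (lt_trans ltr01).
rewrite /= mulrCA divff// mulr1; apply: floor_def.
have /andP[h1 h2] := revval01 i; rewrite intrD /=.
by apply/andP; split; lra.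
Qed.

Lemma fbeta_revval i : fbeta g (revval i) = revval i.-1.
Proof.
case: i => [|i]; first by rewrite /fbeta /= mulr0 floor0 subr0.
rewrite /fbeta floor_revval /=.
have g0 : g != 0 by rewrite gt_eqF// (lt_trans ltr01).
by rewrite mulrCA divff// mulr1 addrK.
Qed.

Lemma iter_fbeta_revval k i : iter k (fbeta g) (revval i) = revval (i - k).
Proof.
elim: k => [|k IH]; first by rewrite subn0.
by rewrite iterS IH fbeta_revval subnS.
Qed.

(** The values of all the suffixes of the word lie in [[0, 1)], so the word is the greedy expansion
    of its value and [fbeta g] simply drops its first letter. *)
Lemma digits_revval i k : beta_digits g (revval i) k =
  if (k < i)%N then (s (i - k.+1) : nat)%:Z else 0.
Proof.
rewrite /beta_digits iter_fbeta_revval; case: ltnP => ik.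
  have -> : (i - k)%N = (i - k.+1).+1 by lia.
  exact: floor_revval.
have -> : (i - k)%N = 0%N by lia.
by rewrite /= mulr0 floor0.
Qed.

(** The window that starts at a position [n0 <= 0] reads [s |n0|, ..., s 0, 0, 0, ...], the digits
    of [revval |n0|.+1]; a window that starts later reads only zeros, the digits of 0. *)
Lemma revval_Sminus : Sminus g (fun k => (s k : nat)%:Z).
Proof.
rewrite /Sminus /Sbi /= => n0 N.
have [h|h] := lerP n0 0.
- exists (revval `|n0|.+1); split; first exact: revval01.
  move=> k _; rewrite digits_revval.
  case: (lerP (n0 + k%:Z) 0) => hk.
    rewrite ifT; last by lia.
    by congr (Posz (nat_of_bool (s _))); lia.
  by rewrite ifF//; lia.
- exists (revval 0); split; first exact: revval01.
  by move=> k _; rewrite digits_revval /= ifF//; lia.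
Qed.

End ReversedWord.

(** The values of the reversed words stay below the heights of the tower of b even when computed in
    the larger base g. This places the past in S_g^-, and as an element of S_g^+ it shares its first
    n digits with some x in [[0, 1)]. *)
Lemma past_digits_admissible b g v n : 1 < b < 2 -> b <= g -> Sset g ->
  0 <= v < tower_width b -> 0 < height b v ->
  \sum_(k < n) (past_digit b v k : nat)%:R * g^-1 ^+ k.+1 <= 1 :> R.
Proof.
move=> hb bg [g1 SS] hv hh.
have g0 : 0 < g by exact: lt_trans g1.
have b0 := base_gt0 hb.
pose s k := (k < n)%N && past_digit b v k.
(* The induction starts from [0 < height b v]. Adding a digit and dividing by b stays below the next
   height by [height_past]; dividing by [g >= b] gives even less. *)
have bound i : (i <= n)%N -> 0 <= revval g s i < height b (iter i (past b) v).
  elim: i => [|i IH] i_n; first by rewrite /= lexx.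
  have /andP[r0 r1] := IH (ltnW i_n).
  have /andP[_ h2] := height_past hb (iter_past_range hb i hv) (IH (ltnW i_n)).
  have si : s i = last_digit b (iter i (past b) v) by rewrite /s i_n.
  rewrite /= si divr_ge0 ?addr_ge0 ?(ltW g0)//=; apply: le_lt_trans h2.
  by rewrite ler_wpM2l ?addr_ge0// lef_pV2.
have r01 i : 0 <= revval g s i < 1.
  have [i_n|] := leqP i n.
    by have /andP[-> h] := bound _ i_n; rewrite (lt_le_trans h)// height_le1.
  elim: i => // i IH; rewrite ltnS => n_i /=.
  have -> : s i = false by rewrite /s ltnNge n_i.
  have /andP[h1 h2] : 0 <= revval g s i < 1.
    move: n_i; rewrite leq_eqVlt => /orP[/eqP <-|]; last exact: IH.
    by have /andP[-> h] := bound _ (leqnn n); rewrite (lt_le_trans h)// height_le1.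
  by rewrite addr0 divr_ge0 ?(ltW g0)//= ltr_pdivrMr// mul1r (lt_trans h2).
(* The equality of S_g^+ and S_g^- enters here. *)
have : Splus g (fun k => (s k : nat)%:Z) by rewrite SS; exact: revval_Sminus.
move=> /(_ n)[x [/andP[x0 x1] hx]]; apply: le_trans (ltW x1).
apply: le_trans (beta_expansion_le n g1 x0).
by apply: ler_sum => k _; rewrite hx// /s ltn_ord.
Qed.

End AdmissiblePasts.

(** * Power series with digit differences, near 1/g *)

Section Transversality.
Variable R : realType.

(** The constant 1 is the first differing digit. Later digits carry [x ^+ k.+1], so that at
    [x = g^-1] both parts are the sums bounded by [past_digits_admissible]. *)
Definition diff_poly (q : nat) (a c : nat -> bool) (x : R) : R :=
  1 + \sum_(k < q) ((a k)%:R - (c k)%:R) * x ^+ k.+1.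

Lemma geometric_sum_le (t : R) q : 0 <= t < 1 ->
  \sum_(k < q) t ^+ k <= (1 - t)^-1.
Proof.
move=> /andP[t0 t1].
have t1' : 0 < 1 - t by rewrite subr_gt0.
rewrite -[leRHS]mul1r ler_pdivlMr//.
have := subrX1 t q; have := exprn_ge0 q t0; lra.
Qed.

Lemma natmul_expr_le (t : R) k : 0 <= t < 1 -> k.+1%:R * t ^+ k <= (1 - t)^-1.
Proof.
move=> /[dup] /andP[t0 t1] t01; apply: le_trans (geometric_sum_le k.+1 t01).
rewrite mulr_natl -[in leLHS](card_ord k.+1) -sumr_const.
apply: ler_sum => i _; apply: ler_wiXn2l => //; first exact: ltW.
by rewrite -ltnS.
Qed.

(** The exponent [k.+1] in the lower bound, weaker than what the mean value theorem gives, makes it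
    comparable term by term with an expansion in base g. *)
Lemma exprD_bounds (x y : R) k : 0 <= y <= x -> x <= 1 ->
  (x - y) * y ^+ k.+1 <= x ^+ k.+1 - y ^+ k.+1 <= (x - y) * (k.+1%:R * x ^+ k).
Proof.
move=> /andP[y0 yx] x1; have x0 : 0 <= x by exact: le_trans yx.
have hd : 0 <= x - y by rewrite subr_ge0.
elim: k => [|k /andP[IH1 IH2]].
  rewrite !expr1 expr0 !mulr1 lexx andbT.
  by rewrite ler_piMr// (le_trans yx).
have e : x ^+ k.+2 - y ^+ k.+2 = (x - y) * x ^+ k.+1 + y * (x ^+ k.+1 - y ^+ k.+1).
  by rewrite !(exprS _ k.+1); ring.
rewrite e; apply/andP; split.
  rewrite exprS mulrA (mulrC _ y) -mulrA.
  by rewrite (le_trans (ler_wpM2l y0 IH1))// lerDr mulr_ge0// exprn_ge0.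
have := ler_wpM2l y0 IH2.
have : y * ((x - y) * (k.+1%:R * x ^+ k)) <= x * ((x - y) * (k.+1%:R * x ^+ k)).
  by rewrite ler_wpM2r// !mulr_ge0// exprn_ge0.
rewrite -[k.+2%:R]natr1 exprS; lra.
Qed.

Lemma geometric_tail_le (t : R) N q : 0 <= t < 1 ->
  \sum_(k < q) (N <= k)%:R * t ^+ k <= t ^+ N / (1 - t).
Proof.
move=> /andP[t0 t1]; rewrite ler_pdivlMr ?subr_gt0//.
suff -> : (\sum_(k < q) (N <= k)%:R * t ^+ k) * (1 - t) =
    if (N <= q)%N then t ^+ N - t ^+ q else 0.
  by case: ifP => _; rewrite ?gerBl exprn_ge0.
elim: q => [|q IH].
  by rewrite big_ord0 mul0r; case: N => //=; rewrite subrr.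
rewrite big_ord_recr /= mulrDl IH.
have [Nq|qN] := leqP N q; first by rewrite (leqW Nq) mul1r exprS; ring.
rewrite !mul0r addr0; case: ifP => // Nq.
by have -> : N = q.+1 by [apply/eqP; rewrite eqn_leq Nq]; rewrite subrr.
Qed.

Lemma exprn_small (t e : R) : 0 <= t < 1 -> 0 < e -> exists N, t ^+ N < e.
Proof.
move=> /andP[t0 t1] e0.
have : (fun n => t ^+ n) @ \oo --> (0 : R) by apply: cvg_expr; rewrite ger0_norm.
by move=> /cvgr_lt/(_ _ e0)[N _ /(_ N (leqnn N))]; exists N.
Qed.

(** The constants are uniform in the degree q and in the digits. The slope 1/2 arises as 3/4 from
    the digits [c] minus 1/4 from the digits [a]. *)
Lemma transversality (g : R) : 1 < g -> exists eps delta : R,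
  [/\ 0 < eps, 0 < delta, g^-1 + eps < 1 &
   forall q (a c : nat -> bool),
   (\sum_(k < q) (a k : nat)%:R * g^-1 ^+ k.+1 <= 1 :> R) ->
   (\sum_(k < q) (c k : nat)%:R * g^-1 ^+ k.+1 <= 1 :> R) ->
   forall x y, g^-1 <= y -> y <= x -> x <= g^-1 + eps ->
   `|diff_poly q a c y| < delta ->
   (x - y) / 2 <= diff_poly q a c y - diff_poly q a c x].
Proof.
move=> g1; have g0 : 0 < g by exact: lt_trans g1.
have ig0 : 0 < g^-1 by rewrite invr_gt0.
have ig1 : g^-1 < 1 by rewrite invf_lt1.
(* The midpoint of [g^-1] and 1 bounds all the parameters away from 1. *)
pose th := (1 + g^-1) / 2.
have th01 : 0 <= th < 1 by apply/andP; split; rewrite /th; lra.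
have /andP[th0 th1] := th01.
(* As [th ^+ k] is [t ^+ k] squared, one factor absorbs the [k.+1] of the derivative and the other
   one keeps the series geometric. *)
pose t := Num.sqrt th.
have t2 : t ^+ 2 = th by rewrite sqr_sqrtr.
have t01 : 0 <= t < 1.
  by rewrite sqrtr_ge0 /= -(@ltr_pXn2r _ 2) ?nnegrE ?sqrtr_ge0// t2 expr1n.
have /andP[t0 t1] := t01.
have u0 : 0 < 1 - t by rewrite subr_gt0.
have iu0 : 0 <= (1 - t)^-1 by rewrite invr_ge0 ltW.
(* From index N on, the terms of the derivative sum to at most 1/4. *)
have [N hN] : exists N, t ^+ N < (1 - t) ^+ 2 / 4.
  by apply: exprn_small => //; rewrite divr_gt0// exprn_gt0.
pose S := (1 - t)^-1 ^+ 2.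
have S0 : 0 < S by rewrite exprn_gt0// invr_gt0.
have weight k x : 0 <= x <= th -> k.+1%:R * x ^+ k <= (1 - t)^-1 * t ^+ k.
  move=> /andP[x0 xth].
  apply: (@le_trans _ _ (k.+1%:R * th ^+ k)).
    by rewrite ler_wpM2l// lerXn2r// nnegrE.
  rewrite -t2 -exprM mulnC exprM expr2 mulrA ler_wpM2r ?exprn_ge0//.
  exact: natmul_expr_le.
have weight_sum q x : 0 <= x <= th -> \sum_(k < q) k.+1%:R * x ^+ k <= S.
  move=> hx; apply: (@le_trans _ _ (\sum_(k < q) (1 - t)^-1 * t ^+ k)).
    by apply: ler_sum => k _; exact: weight.
  rewrite -mulr_sumr /S expr2 ler_wpM2l//.
  exact: geometric_sum_le t01.
have weight_tail q x : 0 <= x <= th ->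
    \sum_(k < q) (N <= k)%:R * (k.+1%:R * x ^+ k) <= 4^-1.
  move=> hx; apply: (@le_trans _ _ (\sum_(k < q) (1 - t)^-1 * ((N <= k)%:R * t ^+ k))).
    apply: ler_sum => k _; rewrite [leRHS]mulrCA ler_wpM2l//; exact: weight.
  rewrite -mulr_sumr; apply: (@le_trans _ _ ((1 - t)^-1 * (t ^+ N / (1 - t)))).
    by rewrite ler_wpM2l//; exact: geometric_tail_le.
  rewrite mulrCA -expr2 exprVn ler_pdivrMr ?exprn_gt0//; lra.
(* [d <= 1/4] will give [C >= 3/4]; [d <= g^-N] will exclude a digit 1 of [a] before index N. *)
pose d := Num.min 4^-1 (g^-1 ^+ N).
have d0 : 0 < d by rewrite lt_min exprn_gt0// invr_gt0 ltr0n.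
have dle : d <= 4^-1 by rewrite ge_min lexx.
have dN : d <= g^-1 ^+ N by rewrite ge_min lexx orbT.
(* The first bound keeps [x <= th]; the second makes the move from y to [g^-1] change the polynomial
   by at most [eps * S <= d / 2]. *)
pose eps := Num.min (th - g^-1) (d / (2 * S)).
exists eps, (d / 2); split.
- rewrite lt_min; apply/andP; split; last by rewrite divr_gt0// mulr_gt0.
  by rewrite subr_gt0 /th; lra.
- by rewrite divr_gt0.
- rewrite (@le_lt_trans _ _ th)// -lerBrDl ge_min lexx//.
move=> q a c hA hC x y gy yx xe /ltr_normlW hy.
set A := \sum_(k < q) _ in hA; set C := \sum_(k < q) _ in hC.
have y0 : 0 <= y by rewrite (le_trans _ gy)// ltW.
have x0 : 0 <= x by exact: le_trans yx.
have xth : x <= th.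
  by apply: le_trans xe _; rewrite -lerBrDl ge_min lexx.
have x1 : x <= 1 by rewrite (le_trans xth)// ltW.
have epsS : eps * S <= d / 2.
  have h : eps <= d / (2 * S) by rewrite ge_min lexx orbT.
  rewrite ler_pdivlMr// (_ : eps * S * 2 = eps * (2 * S)); last by ring.
  by rewrite -ler_pdivlMr// mulr_gt0.
have yeps : y - g^-1 <= eps by lra.
have pos (z : R) k : 0 <= z -> 0 <= z ^+ k by move=> ?; exact: exprn_ge0.
(* [1 + A - C] is the value of the polynomial at [g^-1]: at most d/2 is lost in moving there, and
   less than [delta = d / 2] is present at y. *)
have AC : 1 + A - C < d.
  have : 1 + A - C <= diff_poly q a c y + eps * S.
    have -> : 1 + A - C = diff_poly q a c y -
        \sum_(k < q) ((a k)%:R - (c k)%:R) * (y ^+ k.+1 - g^-1 ^+ k.+1).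
      rewrite /diff_poly /A /C -addrA -sumrB -addrA -sumrB; congr (_ + _).
      by apply: eq_bigr => k _; ring.
    rewrite lerD2l -sumrN.
    apply: (@le_trans _ _ ((y - g^-1) * \sum_(k < q) k.+1%:R * y ^+ k)); last first.
      have := weight_sum q y; rewrite y0 (le_trans yx xth) => /(_ isT) h.
      have ? : 0 <= y - g^-1 by rewrite subr_ge0.
      apply: (@le_trans _ _ ((y - g^-1) * S)); first by rewrite ler_wpM2l.
      by rewrite ler_wpM2r// ltW.
    rewrite mulr_sumr; apply: ler_sum => k _.
    have /andP[h1 h2] : (y - g^-1) * g^-1 ^+ k.+1 <= y ^+ k.+1 - g^-1 ^+ k.+1 <=
        (y - g^-1) * (k.+1%:R * y ^+ k).
      by apply: exprD_bounds; [rewrite gy ltW|exact: le_trans x1].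
    have h3 : 0 <= y ^+ k.+1 - g^-1 ^+ k.+1.
      by apply: le_trans h1; rewrite mulr_ge0 ?subr_ge0// exprn_ge0// ltW.
    apply: le_trans h2; move: (y ^+ _ - _) h3 => z z0.
    by clear -z0; case: (a k); case: (c k) => /=; lra.
  lra.
have A0 : 0 <= A by apply: sumr_ge0 => k _; rewrite mulr_ge0// exprn_ge0// ltW.
have Ad : A < d by lra.
have Cd : 3 / 4 <= C by lra.
(* A digit 1 at such a k would alone contribute [g^-(k+1) >= g^-N >= d > A]. *)
have a0 k : (k < q)%N -> (k < N)%N -> a k = false.
  move=> kq kN; apply/negbTE/negP => ak.
  suff : g^-1 ^+ N <= A by lra.
  apply: (@le_trans _ _ (g^-1 ^+ k.+1)).
    by rewrite ler_wiXn2l// ltW.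
  rewrite /A (bigD1 (Ordinal kq))//= ak mul1r lerDl sumr_ge0// => i _.
  by rewrite mulr_ge0// exprn_ge0// ltW.
have -> : diff_poly q a c y - diff_poly q a c x =
    \sum_(k < q) (c k)%:R * (x ^+ k.+1 - y ^+ k.+1) -
    \sum_(k < q) (a k)%:R * (x ^+ k.+1 - y ^+ k.+1).
  rewrite /diff_poly opprD addrACA subrr add0r -!sumrB.
  by apply: eq_bigr => k _; ring.
have xy0 : 0 <= x - y by rewrite subr_ge0.
have pk k : (x - y) * y ^+ k.+1 <= x ^+ k.+1 - y ^+ k.+1 <= (x - y) * (k.+1%:R * x ^+ k).
  by apply: exprD_bounds => //; rewrite y0.
have hc : (x - y) * (3 / 4) <= \sum_(k < q) (c k)%:R * (x ^+ k.+1 - y ^+ k.+1).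
  apply: (@le_trans _ _ ((x - y) * C)); first by rewrite ler_wpM2l.
  rewrite /C mulr_sumr; apply: ler_sum => k _.
  have /andP[h1 _] := pk k; rewrite mulrCA ler_wpM2l//; apply: le_trans h1.
  by rewrite ler_wpM2l// lerXn2r// nnegrE// ltW.
have ha : \sum_(k < q) (a k)%:R * (x ^+ k.+1 - y ^+ k.+1) <= (x - y) * 4^-1.
  apply: (@le_trans _ _ ((x - y) *
     \sum_(k < q) (N <= k)%:R * (k.+1%:R * x ^+ k))); last first.
    by rewrite ler_wpM2l//; apply: weight_tail; rewrite x0.
  rewrite mulr_sumr; apply: ler_sum => k _.
  have /andP[_ h2] := pk k.
  have [Nk|kN] := leqP N k.
    rewrite mul1r; apply: le_trans h2; case: (a k); rewrite ?mul1r// mul0r.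
    by rewrite subr_ge0 lerXn2r.
  by rewrite a0// !mul0r mulr0.
lra.
Qed.

End Transversality.

(** * The horizontal coordinate of a past *)

Section Coding.
Variables (R : realType) (b : R).
Hypothesis hb : 1 < b < 2.
Notation leb := (@lebesgue_measure R).
Notation MR := (measurableTypeR R).

Definition coord_trunc (l : R) (n : nat) (v : R) : R :=
  (1 - l) * \sum_(k < n) (past_digit b v k : nat)%:R * l ^+ k.

Definition coord (l v : R) : R := limn (coord_trunc l ^~ v).

Lemma coord_trunc_past l n v :
  coord_trunc l n.+1 v = l * coord_trunc l n (past b v) + (1 - l) * (last_digit b v : nat)%:R.
Proof.
rewrite /coord_trunc big_ord_recl expr0 mulr1 mulrDr addrC; congr (_ + _).
rewrite mulrCA; congr (_ * _); rewrite mulr_sumr; apply: eq_bigr => k _.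
by rewrite lift0 past_digitS exprS mulrCA.
Qed.

Section Fixed.
Variable l : R.
Hypothesis hl : 0 < l < 1.

Let l0 : 0 < l. Proof. by case/andP: hl. Qed.
Let l1 : l < 1. Proof. by case/andP: hl. Qed.

Lemma coord_truncS n v : coord_trunc l n.+1 v = coord_trunc l n v + (1 - l) * (past_digit b v n : nat)%:R * l ^+ n.
Proof. by rewrite /coord_trunc big_ord_recr /= mulrDr mulrA. Qed.

Lemma coord_trunc_nd v : nondecreasing_seq (coord_trunc l ^~ v).
Proof.
apply/nondecreasing_seqP => n; rewrite coord_truncS lerDl.
by rewrite !mulr_ge0 ?exprn_ge0 ?subr_ge0 ?(ltW l0) ?(ltW l1).
Qed.

Lemma coord_trunc_ge0 n v : 0 <= coord_trunc l n v.
Proof.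
have := coord_trunc_nd v (leq0n n); rewrite {1}/coord_trunc big_ord0 mulr0; exact.
Qed.

(** [coord_trunc l n v + l ^+ n] is the value obtained by setting every digit from index n on to 1,
    so it cannot increase with n. This bounds both the coordinate and its truncation error. *)
Lemma coord_trunc_increment m n v : (m <= n)%N -> coord_trunc l n v + l ^+ n <= coord_trunc l m v + l ^+ m.
Proof.
move=> /subnK <-; elim: (n - m)%N => [|k IH]; first by rewrite add0n.
apply: le_trans IH; rewrite addSn coord_truncS -addrA lerD2l exprS.
have := exprn_ge0 (k + m) (ltW l0); set z := l ^+ _ => z0.
have : 0 <= (1 - l) * z by rewrite mulr_ge0// subr_ge0 ltW.
by case: (past_digit b v _) => /=; lra.
Qed.

Lemma coord_trunc_le1 n v : coord_trunc l n v <= 1.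
Proof.
have := coord_trunc_increment v (leq0n n); rewrite {2}/coord_trunc big_ord0 mulr0 add0r expr0.
have := exprn_ge0 n (ltW l0); lra.
Qed.

Lemma coord_trunc_cvg v : coord_trunc l ^~ v @ \oo --> coord l v.
Proof.
apply: nondecreasing_is_cvgn; first exact: coord_trunc_nd.
by exists 1 => _ [n _ <-]; exact: coord_trunc_le1.
Qed.

Lemma coord_trunc_le_coord n v : coord_trunc l n v <= coord l v.
Proof. by apply: nondecreasing_cvgn_le; [exact: coord_trunc_nd|apply/cvg_ex; exists (coord l v); exact: coord_trunc_cvg]. Qed.

Lemma coord_le_coord_trunc n v : coord l v <= coord_trunc l n v + l ^+ n.
Proof.
apply: limr_le; first by apply/cvg_ex; exists (coord l v); exact: coord_trunc_cvg.
near=> m; have nm : (n <= m)%N by near: m; exact: nbhs_infty_ge.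
apply: le_trans (coord_trunc_increment v nm); rewrite lerDl exprn_ge0// ltW//.
Unshelve. all: by end_near. Qed.

Lemma coord_ge0 v : 0 <= coord l v.
Proof. exact: le_trans (coord_trunc_ge0 0 v) (coord_trunc_le_coord 0 v). Qed.

Lemma coord_le1 v : coord l v <= 1.
Proof. by have := coord_le_coord_trunc 0 v; rewrite /coord_trunc big_ord0 mulr0 add0r expr0. Qed.

Lemma coord_past v : coord l v = l * coord l (past b v) + (1 - l) * (last_digit b v : nat)%:R.
Proof.
have h : (fun n => coord_trunc l n.+1 v) @ \oo --> coord l v.
  by rewrite (@cvg_shiftS _ (coord_trunc l ^~ v)); exact: coord_trunc_cvg.
apply: (cvg_unique _ h) => //.
rewrite (_ : (fun n => _) = fun n => l * coord_trunc l n (past b v) + (1 - l) * (last_digit b v : nat)%:R).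
  by apply: cvgD; [apply: cvgM; [exact: cvg_cst|exact: coord_trunc_cvg]|exact: cvg_cst].
by apply/funext => n; exact: coord_trunc_past.
Qed.

Lemma measurable_coord_trunc n : measurable_fun setT (coord_trunc l n : MR -> R).
Proof.
apply: measurable_funM; first exact: measurable_cst.
apply: measurable_sum => k; apply: measurable_funM; last exact: measurable_cst.
have : measurable_fun setT (fun a : bool => ((a : nat)%:R : R)) by [].
move=> /measurableT_comp; apply; exact: measurable_past_digit.
Qed.

Lemma measurable_coord : measurable_fun setT (coord l : MR -> R).
Proof.
apply: (@measurable_fun_cvg _ _ _ _ (coord_trunc l)) => [n|v _]; first exact: measurable_coord_trunc.
exact: coord_trunc_cvg.
Qed.

End Fixed.

Lemma measurable_coord_trunc_joint n :
  measurable_fun setT (fun p : MR * MR => coord_trunc p.2 n p.1).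
Proof.
have m2 : measurable_fun setT (fun p : MR * MR => p.2 : R) by exact: measurable_snd.
apply: measurable_funM; first by apply: measurable_funB.
apply: measurable_sum => k; apply: measurable_funM; last exact: measurable_funX.
have : measurable_fun setT (fun a : bool => ((a : nat)%:R : R)) by [].
move=> /measurableT_comp; apply.
exact: measurableT_comp (measurable_past_digit hb k) measurable_fst.
Qed.

End Coding.

(** * Pairs of pasts with close coordinates, averaged over the contraction rate *)

Section PairEstimate.
Variables (R : realType) (b : R).
Hypothesis hb : 1 < b < 2.
Notation leb := (@lebesgue_measure R).
Notation MR := (measurableTypeR R).

(** The length [(m + q).+1] counts m common digits, the differing one and q further ones. Each
    common digit cancels and leaves a factor l by [coord_trunc_past]. *)
Lemma coord_trunc_diff l m q v v' :
  (forall i, (i < m)%N -> past_digit b v i = past_digit b v' i) -> past_digit b v m -> ~~ past_digit b v' m ->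
  coord_trunc b l (m + q).+1 v - coord_trunc b l (m + q).+1 v' =
  (1 - l) * (l ^+ m * diff_poly q (fun k => past_digit b v (m.+1 + k)) (fun k => past_digit b v' (m.+1 + k)) l).
Proof.
elim: m v v' => [|m IH] v v' eqd pv pv'.
  rewrite !coord_trunc_past expr0 mul1r.
  have -> : last_digit b v = true by exact: pv.
  have -> : last_digit b v' = false by exact: (negbTE pv').
  have e : l * (coord_trunc b l q (past b v) - coord_trunc b l q (past b v')) = (1 - l) *
    \sum_(k < q) ((past_digit b v (1 + k))%:R - (past_digit b v' (1 + k))%:R) * l ^+ k.+1.
    rewrite -mulrBr -sumrB mulrCA; congr (_ * _); rewrite mulr_sumr.
    by apply: eq_bigr => k _; rewrite -!past_digitS exprS; ring.
  by rewrite /diff_poly mulrDr -e /=; ring.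
rewrite addSn (coord_trunc_past b l _ v) (coord_trunc_past b l _ v').
have -> : last_digit b v = last_digit b v' by exact: (eqd 0%N).
rewrite opprD addrACA subrr addr0 -mulrBr IH -?past_digitS//; last by move=> i im; rewrite -!past_digitS eqd.
have e : diff_poly q (fun k => past_digit b (past b v) (m.+1 + k)) (fun k => past_digit b (past b v') (m.+1 + k)) l =
    diff_poly q (fun k => past_digit b v (m.+2 + k)) (fun k => past_digit b v' (m.+2 + k)) l.
  by congr (1 + _); apply: eq_bigr => k _; rewrite -!past_digitS.
by rewrite exprS e mulrCA -[l * _ * _]mulrA.
Qed.

(** If the orbit of 1 reaches 0, all later levels have empty fibres, and [past_digits_admissible]
    does not apply to them. *)
Definition live : set MR := [set v | 0 <= v < tower_width b /\ 0 < height b v].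

Lemma measurable_live : measurable live.
Proof.
have -> : live = `[0, (tower_width b)[ `&` (height b @^-1` `]0, +oo[).
  by apply/seteqP; split => v; rewrite /live /= !in_itv /= andbT.
apply: measurableI; first exact: measurable_itv.
by rewrite -[X in measurable X]setTI; apply: measurable_height => //; exact: measurable_itv.
Qed.

Lemma live_past v : live v -> live (past b v).
Proof.
move=> [hv hh]; split; first exact: past_range.
have := @height_past _ _ hb v 0 hv; rewrite lexx hh => /(_ isT) /andP[h1 h2].
exact: le_lt_trans h1 h2.
Qed.

Lemma live_iter_past v i : live v -> live (iter i (past b) v).
Proof. by move=> h; elim: i => //= i; exact: live_past. Qed.

Lemma past_digit_iter v i k : past_digit b v (i + k) = past_digit b (iter i (past b) v) k.
Proof. by rewrite /past_digit addnC iterD. Qed.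

Variables (g eps delta : R).
Hypotheses (bg : b <= g) (Sg : Sset g).
Hypotheses (delta0 : 0 < delta) (geps : g^-1 + eps < 1).
Hypothesis transv : forall q (a c : nat -> bool),
   (\sum_(k < q) (a k : nat)%:R * g^-1 ^+ k.+1 <= 1 :> R) ->
   (\sum_(k < q) (c k : nat)%:R * g^-1 ^+ k.+1 <= 1 :> R) ->
   forall x y, g^-1 <= y -> y <= x -> x <= g^-1 + eps ->
   `|diff_poly q a c y| < delta ->
   (x - y) / 2 <= diff_poly q a c y - diff_poly q a c x.

Let l1 := g^-1 + eps.
Variable l0 : R.
Hypothesis bl0 : b^-1 < l0.

Definition Jset : set MR := [set` `[l0, l1]].

Let l1_lt1 : l1 < 1. Proof. exact: geps. Qed.
Let d8 : 0 <= 8 + delta^-1.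
Proof. by rewrite addr_ge0// invr_ge0 ltW. Qed.

Lemma Jset_range l : Jset l -> [/\ g^-1 <= l, l0 <= l, l <= l1 & 0 < l < 1].
Proof.
have g0 : 0 < g by apply: lt_le_trans bg; exact: base_gt0.
rewrite /Jset /= in_itv /= => /andP[h1 h2].
have h3 : g^-1 <= b^-1 by rewrite lef_pV2 ?posrE// (base_gt0 hb).
have ib0 := inv_base_gt0 hb.
split => //; first exact: le_trans h3 (le_trans (ltW bl0) h1).
apply/andP; split; first by apply: lt_le_trans h1; exact: lt_trans bl0.
exact: le_lt_trans h2 geps.
Qed.

(** 8 comes from an interval of radius [4 * rho], [delta^-1] from the case [rho >= delta], and
    [1 - l1] from the factor [1 - l] of the coordinate. *)
Definition pair_const := (8 + delta^-1) / (1 - l1).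

Lemma pair_const_ge0 : 0 <= pair_const.
Proof. by rewrite divr_ge0// subr_ge0 ltW. Qed.

Lemma near_zero_small (G : R -> R) (A : set MR) rho : 0 < rho ->
  (forall x y, A x -> A y -> y <= x -> `|G y| < delta ->
    (x - y) / 2 <= G y - G x) ->
  measurable A -> A `<=` Jset -> (forall x, A x -> `|G x| < rho) ->
  (leb A <= ((8 + delta^-1) * rho)%:E)%E.
Proof.
move=> rho0 hG mA AJ hA.
(* For [rho >= delta] transversality says nothing, but then the claimed bound exceeds 1 and hence
   the length of [Jset]. *)
have [hr|hr] := leP delta rho.
  apply: (@le_trans _ _ (leb Jset)).
    by apply: le_measure; rewrite ?inE//; exact: measurable_itv.
  rewrite /Jset lebesgue_measure_itv /= lte_fin.
  have ib0 := inv_base_gt0 hb.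
  have d1 : 1 <= delta^-1 * rho by rewrite mulrC ler_pdivlMr// mul1r.
  case: ifPn => _; last by rewrite lee_fin mulr_ge0// ltW.
  rewrite -EFinB lee_fin; have := l1_lt1; have : 0 < l0 by exact: lt_trans bl0.
  have : (8 + delta^-1) * rho = 8 * rho + delta^-1 * rho by ring.
  lra.
have [->|/set0P[x0 Ax0]] := eqVneq A set0.
  by rewrite measure0 lee_fin mulr_ge0// ltW.
(* Between two points of A, G varies by less than [2 * rho] and decreases with slope at least 1/2,
   so their distance is below [4 * rho]. *)
apply: (@le_trans _ _ (leb `[x0 - 4 * rho, x0 + 4 * rho]%classic)).
  apply: le_measure; rewrite ?inE//.
  move=> x Ax; rewrite /= in_itv /=.
  have := hA _ Ax; have := hA _ Ax0; rewrite !ltr_norml => /andP[? ?] /andP[? ?].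
  have [xx0|x0x] := leP x x0.
    have := hG _ _ Ax0 Ax xx0 (lt_trans (hA _ Ax) hr).
    by move=> ?; apply/andP; split; lra.
  have := hG _ _ Ax Ax0 (ltW x0x) (lt_trans (hA _ Ax0) hr).
  by move=> ?; apply/andP; split; lra.
rewrite lebesgue_measure_itv /= lte_fin ifT; last by lra.
rewrite -EFinB lee_fin.
have : 0 <= delta^-1 * rho by rewrite mulr_ge0 ?invr_ge0// ltW.
have : (8 + delta^-1) * rho = 8 * rho + delta^-1 * rho by ring.
lra.
Qed.

Lemma pair_first_difference m n v v' r (A : set MR) : 0 < r ->
  live v -> live v' -> (m < n)%N ->
  (forall i, (i < m)%N -> past_digit b v i = past_digit b v' i) -> past_digit b v m != past_digit b v' m ->
  measurable A -> A `<=` Jset ->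
  (forall l, A l -> `|coord_trunc b l n v - coord_trunc b l n v'| < r) ->
  (leb A <= (pair_const * r * l0^-1 ^+ m)%:E)%E.
Proof.
move=> r0 lv lv' mn eqd dm mA AJ hA.
wlog pv : v v' lv lv' eqd dm hA / past_digit b v m.
  move=> H; have [pv|pv] := boolP (past_digit b v m); first exact: (H v v').
  apply: (H v' v) => //.
  - by move=> i im; rewrite eqd.
  - by rewrite eq_sym.
  - by move=> l Al; rewrite distrC hA.
  - by move: dm pv; case: (past_digit b v m); case: (past_digit b v' m).
have pv' : ~~ past_digit b v' m by move: dm; rewrite pv; case: (past_digit b v' m).
have [q qE] : exists q, n = (m + q).+1 by exists (n - m.+1)%N; rewrite -addSn subnKC.
set a := fun k => past_digit b v (m.+1 + k); set c := fun k => past_digit b v' (m.+1 + k).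
have adm w : live w -> \sum_(k < q) (past_digit b w (m.+1 + k) : nat)%:R * g^-1 ^+ k.+1 <= 1 :> R.
  move=> lw; have [h1 h2] := live_iter_past m.+1 lw.
  apply: le_trans (past_digits_admissible q hb bg Sg h1 h2).
  by apply: ler_sum => k _; rewrite past_digit_iter.
have l00 : 0 < l0 by apply: lt_trans bl0; exact: inv_base_gt0 hb.
(* On [Jset] the factor [(1 - l) * l ^+ m] is at least [(1 - l1) * l0 ^+ m]; dividing r by the
   latter gives the radius [rho] for [diff_poly]. *)
have -> : pair_const * r * l0^-1 ^+ m =
    (8 + delta^-1) * (r / ((1 - l1) * l0 ^+ m)).
  by rewrite /pair_const exprVn invfM; ring.
apply: (@near_zero_small (diff_poly q a c)) => //.
- by rewrite divr_gt0// mulr_gt0 ?exprn_gt0// subr_gt0.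
- move=> x y Ax Ay yx hy.
  have [? ? ? _] := Jset_range (AJ _ Ax); have [? ? ? _] := Jset_range (AJ _ Ay).
  by apply: transv => //; exact: adm.
- move=> x Ax; have [h1 h2 h3 /andP[h4 h5]] := Jset_range (AJ _ Ax).
  have := hA _ Ax; rewrite qE coord_trunc_diff// -/a -/c !normrM.
  rewrite ger0_norm ?subr_ge0 ?(ltW h5)// ger0_norm ?exprn_ge0 ?(ltW h4)// => hh.
  rewrite ltr_pdivlMr; last by rewrite mulr_gt0 ?exprn_gt0// subr_gt0.
  apply: le_lt_trans hh; rewrite mulrC -mulrA.
  apply: ler_pM; rewrite ?mulr_ge0 ?exprn_ge0 ?subr_ge0 ?(ltW l1_lt1) ?(ltW l00)//.
    by lra.
  by rewrite ler_wpM2r// lerXn2r// nnegrE ltW.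
Qed.

Notation leb2' := (@leb2 R).

Definition close_pairs (n : nat) (r : R) : set ((MR * MR) * MR) :=
  [set q | [/\ Jset q.2, live q.1.1, live q.1.2 &
    `|coord_trunc b q.2 n q.1.1 - coord_trunc b q.2 n q.1.2| < r]].

Lemma measurable_close_pairs n r : measurable (close_pairs n r).
Proof.
have -> : close_pairs n r = ((live `*` live) `*` Jset) `&`
    (fun q => `|coord_trunc b q.2 n q.1.1 - coord_trunc b q.2 n q.1.2|) @^-1` [set` `]-oo, r[].
  apply/seteqP; split => q; rewrite /close_pairs /=.
    by case=> h1 h2 h3 h4; rewrite in_itv /=; split.
  by case=> -[[h1 h2] h3]; rewrite in_itv /= => h4; split.
apply: measurableI.
  apply: measurableX; last exact: measurable_itv.
  by apply: measurableX; exact: measurable_live.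
rewrite -[X in measurable X]setTI.
suff : measurable_fun setT
    (fun q : (MR * MR) * MR => `|coord_trunc b q.2 n q.1.1 - coord_trunc b q.2 n q.1.2|).
  by apply => //; exact: measurable_itv.
apply: measurableT_comp => //.
apply: measurable_funB.
  have h : measurable_fun setT (fun q : (MR * MR) * MR => (q.1.1, q.2)).
    apply: measurable_fun_pair => //=.
    exact: measurableT_comp measurable_fst measurable_fst.
  exact: measurableT_comp (measurable_coord_trunc_joint hb n) h.
have h : measurable_fun setT (fun q : (MR * MR) * MR => (q.1.2, q.2)).
  apply: measurable_fun_pair => //=.
  exact: measurableT_comp measurable_snd measurable_fst.
exact: measurableT_comp (measurable_coord_trunc_joint hb n) h.
Qed.

(** Pairs that first differ at m are enlarged to [agree b m], which has a known area. The last term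
    serves pairs not separated by n digits, for which only the bound 1 for the length of [Jset] is
    available. *)
Definition close_bound (n : nat) (r : R) (p : MR * MR) : \bar R :=
  (\sum_(m < n) ((pair_const * r * l0^-1 ^+ m)%:E * (\1_(agree b m) p)%:E) +
  (\1_(agree b n) p)%:E)%E.

Lemma lebesgue_Jset : (leb Jset <= 1)%E.
Proof.
rewrite /Jset lebesgue_measure_itv /= lte_fin; case: ifPn => // _.
have ib0 := inv_base_gt0 hb; have := l1_lt1; have : 0 < l0 by exact: lt_trans bl0.
rewrite -EFinB lee_fin; lra.
Qed.

Lemma close_bound_ge n r p : 0 < r ->
  (leb (xsection (close_pairs n r) p) <= close_bound n r p)%E.
Proof.
move=> r0; set A := xsection _ _.
have ib0 := inv_base_gt0 hb; have l00 : 0 < l0 by exact: lt_trans bl0.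
have c0 m : (0 <= (pair_const * r * l0^-1 ^+ m)%:E * (\1_(agree b m) p)%:E)%E.
  rewrite mule_ge0 ?lee_fin// mulr_ge0 ?exprn_ge0 ?invr_ge0 ?(ltW l00)//.
  by rewrite mulr_ge0 ?pair_const_ge0// ltW.
have mA : measurable A by apply: measurable_xsection; exact: measurable_close_pairs.
have [->|/set0P[x0 /xsectionP[_ lv lv' _]]] := eqVneq A set0.
  by rewrite measure0 adde_ge0// ?sume_ge0// lee_fin.
have AJ : A `<=` Jset by move=> x /xsectionP[].
have hA x : A x -> `|coord_trunc b x n p.1 - coord_trunc b x n p.2| < r by move=> /xsectionP[].
have ag m : (forall i, (i < m)%N -> past_digit b p.1 i = past_digit b p.2 i) -> \1_(agree b m) p = 1 :> R.
  by move=> h; rewrite indicE mem_set//; split => //; [case: lv|case: lv'].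
have [hE|hN] := pselect (exists m, (m < n)%N && (past_digit b p.1 m != past_digit b p.2 m)).
  case: (ex_minnP hE) => m /andP[mn dm] hmin.
  have eqd i : (i < m)%N -> past_digit b p.1 i = past_digit b p.2 i.
    move=> im; apply/eqP/negPn/negP => hi.
    by have := hmin i; rewrite (ltn_trans im mn) hi => /(_ isT); rewrite leqNgt im.
  apply: (le_trans (pair_first_difference r0 lv lv' mn eqd dm mA AJ hA)).
  rewrite /close_bound (bigD1 (Ordinal mn))//= ag// mule1 -addeA.
  by rewrite leeDl// adde_ge0// ?lee_fin// sume_ge0.
have agn : \1_(agree b n) p = 1 :> R.
  apply: ag => i im; apply/eqP/negPn/negP => hi; apply: hN; exists i.
  by rewrite im.
rewrite /close_bound agn; apply: (@le_trans _ _ 1%E).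
  apply: le_trans lebesgue_Jset; apply: le_measure; rewrite ?inE//.
  exact: measurable_itv.
by rewrite leeDr// sume_ge0.
Qed.

(** By Fubini the pair is fixed first and the set of rates is measured. The separation at m
    contributes [l0^-m * b^-m], and [l0 > b^-1] makes this a convergent geometric series. *)
Lemma close_pairs_integral n r : 0 < r ->
  (\int[leb]_l leb2' (ysection (close_pairs n r) l) <=
   (tower_width b ^+ 2 * pair_const / (1 - l0^-1 * b^-1) * r + tower_width b ^+ 2 * b^-1 ^+ n)%:E)%E.
Proof.
move=> r0; have mW := measurable_close_pairs n r.
have ib0 := inv_base_gt0 hb; have l00 : 0 < l0 by exact: lt_trans bl0.
have := indic_fubini_tonelli leb2' leb mW.
rewrite indic_fubini_tonelli_GE// indic_fubini_tonelli_FE// => <-.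
have k0 m : 0 <= pair_const * r * l0^-1 ^+ m.
  apply: mulr_ge0; first by rewrite mulr_ge0 ?pair_const_ge0// ltW.
  by rewrite exprn_ge0// invr_ge0 ltW.
have c0 m p : (0 <= (pair_const * r * l0^-1 ^+ m)%:E * (\1_(agree b m) p)%:E)%E.
  by rewrite mule_ge0 ?lee_fin.
have mind m : measurable_fun setT (fun p : MR * MR => (\1_(agree b m) p)%:E : \bar R).
  by apply/measurable_EFinP/measurable_indic; exact: measurable_agree.
have mterm m : measurable_fun setT (fun p : MR * MR =>
    (pair_const * r * l0^-1 ^+ m)%:E * (\1_(agree b m) p)%:E)%E.
  by apply: emeasurable_funM => //; exact: mind.
apply: (@le_trans _ _ (\int[leb2']_p close_bound n r p)%E).
  apply: ge0_le_integral => //.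
  - exact: measurable_fun_xsection.
  - apply: emeasurable_funD.
      by apply: emeasurable_sum => m; exact: mterm.
    exact: mind.
  - by move=> p _; exact: close_bound_ge.
rewrite ge0_integralD//; last 2 first.
- by move=> p _; rewrite sume_ge0.
- by apply: emeasurable_sum => m; exact: mterm.
rewrite ge0_integral_sum//.
rewrite integral_indic//; last exact: measurable_agree.
rewrite setIT EFinD; apply: leeD; last exact: leb2_agree.
apply: (@le_trans _ _ (\sum_(m < n) (tower_width b ^+ 2 * pair_const * r * (l0^-1 * b^-1) ^+ m)%:E)%E).
  apply: lee_sum => m _.
  rewrite ge0_integralZl_EFin//.
  rewrite integral_indic//; last exact: measurable_agree.
  rewrite setIT; apply: (@le_trans _ _ ((pair_const * r * l0^-1 ^+ m)%:E *
      (tower_width b ^+ 2 * b^-1 ^+ m)%:E)%E).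
    by apply: lee_wpmul2l; [rewrite lee_fin|exact: leb2_agree].
  rewrite -EFinM lee_fin (exprMn_comm m (mulrC l0^-1 b^-1)).
  set u := l0^-1 ^+ m; set w := b^-1 ^+ m.
  by rewrite le_eqVlt; apply/orP; left; apply/eqP; ring.
have t01 : 0 <= l0^-1 * b^-1 < 1.
  rewrite mulr_ge0 ?invr_ge0 ?(ltW l00) ?(ltW (base_gt0 hb))//=.
  by rewrite mulrC ltr_pdivrMr// mul1r.
rewrite sumEFin lee_fin -mulr_sumr.
rewrite (_ : _ / _ * r = tower_width b ^+ 2 * pair_const * r * (1 - l0^-1 * b^-1)^-1); last by ring.
rewrite ler_wpM2l ?geometric_sum_le//.
by rewrite mulr_ge0 ?(ltW r0)// mulr_ge0 ?pair_const_ge0// sqr_ge0.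
Qed.

End PairEstimate.

(** * Absolute continuity for almost every contraction rate *)

Lemma in_bigsetU (I : finType) (T : Type) (P : pred I) (F : I -> set T) (x : T) :
  (\big[setU/set0]_(k | P k) F k) x <-> exists2 k, P k & F k x.
Proof.
split; last by move=> [k Pk Fk]; rewrite (bigD1 k)//=; left.
by elim/big_ind: _ => [//|A B hA hB [/hA|/hB]//|k Pk Fk]; exists k.
Qed.

Section AbsoluteContinuityCriterion.
Variable R : realType.
Notation leb := (@lebesgue_measure R).
Notation MR := (measurableTypeR R).
Variables (E : set MR) (X : MR -> R).
Hypotheses (mE : measurable E) (Efin : (leb E < +oo)%E).
Hypotheses (mX : measurable_fun setT X) (X01 : forall v, 0 <= X v <= 1).

Definition near_diagonal (r : R) : set (MR * MR) :=
  [set p | [/\ E p.1, E p.2 & `|X p.1 - X p.2| < r]].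

Lemma measurable_near_diagonal r : measurable (near_diagonal r).
Proof.
have -> : near_diagonal r = (E `*` E) `&` (fun p => `|X p.1 - X p.2|) @^-1` [set` `]-oo, r[].
  apply/seteqP; split => q; rewrite /near_diagonal /= in_itv /=; first by case.
  by case=> -[].
apply: measurableI; first exact: measurableX.
rewrite -[X in measurable X]setTI.
suff : measurable_fun setT (fun q : MR * MR => `|X q.1 - X q.2|).
  by apply => //; exact: measurable_itv.
apply: measurableT_comp => //; apply: measurable_funB.
  exact: measurableT_comp mX measurable_fst.
exact: measurableT_comp mX measurable_snd.
Qed.

Definition grid (r : R) (k : nat) : set R := [set` `[(k%:R * r), (k.+1%:R * r)[].

Definition grid_inside (U : set R) (r : R) : set MR :=
  [set v | E v /\ exists k, grid r k (X v) /\ grid r k `<=` U].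

Lemma grid_trivIset r : 0 < r -> trivIset setT (grid r).
Proof.
move=> r0; apply/trivIsetP => i j _ _ /eqP ij; apply/seteqP; split => // x [].
rewrite /grid /= !in_itv /= => h1 h2; apply: ij.
apply: (@step_unique R (fun k => k%:R * r)) h1 h2 => n.
by rewrite ler_wpM2r ?ler_nat// ltW.
Qed.

Lemma measurable_grid r k : measurable (grid r k : set MR).
Proof. exact: measurable_itv. Qed.

(** Points in the same mesh interval are r-close, so the squared masses of the intervals add up to
    at most the area of [near_diagonal r]; the intervals inside U have total length at most that of
    U. *)
Lemma mass_grid_inside (U : set R) (K r s : R) : 0 < r -> 0 < s ->
  measurable (U : set MR) ->
  (@leb2 R (near_diagonal r) <= (K * r)%:E)%E ->
  (leb (grid_inside U r) <= s%:E * leb U + (K / s)%:E)%E.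
Proof.
move=> r0 s0 mU hK.
(* Since [X <= 1], only mesh intervals of index at most [r^-1] are met, hence finitely many. *)
have [q hq] : exists q : nat, r^-1 < q%:R.
  by exists (Num.truncn r^-1).+1; rewrite truncnS_gt.
pose P := fun k : 'I_q => `[< grid r k `<=` U >].
pose F := fun k : 'I_q => E `&` X @^-1` (grid r k).
have mF k : measurable (F k).
  apply: measurableI => //; rewrite -[X in measurable X]setTI.
  by apply: mX => //; exact: measurable_grid.
have tF : trivIset setT F.
  apply/trivIsetP => i j _ _ ij; apply/seteqP; split => // x [[_ h1] [_ h2]].
  have /trivIsetP/(_ i j I I) := grid_trivIset r0.
  by move=> /(_ _)/seteqP[] // /(_ (X x))h _; apply: h.
have SE : grid_inside U r = \big[setU/set0]_(k < q | P k) F k.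
  apply/seteqP; split => [v [Ev [k [hk kU]]]|v /in_bigsetU[k /asboolP kU [Ev hk]]].
    have kq : (k < q)%N.
      move: hk; rewrite /grid /= in_itv /= => /andP[h1 h2].
      rewrite -(ltr_nat R); apply: le_lt_trans hq.
      rewrite -[leRHS]mul1r ler_pdivlMr//; apply: le_trans h1 _.
      by have /andP[] := X01 v.
    by apply/in_bigsetU; exists (Ordinal kq) => //; apply/asboolP.
  by split => //; exists k.
have pfin k : (leb (F k)) \is a fin_num.
  rewrite ge0_fin_numE//; apply: le_lt_trans Efin.
  by apply: le_measure; rewrite ?inE//; exact: subIsetl.
pose p k := fine (leb (F k)).
have pE k : leb (F k) = (p k)%:E by rewrite fineK.
have hU : ((\sum_(k < q | P k) r)%:E <= leb U)%E.
  have -> : (\sum_(k < q | P k) r)%:E = leb (\big[setU/set0]_(k < q | P k) grid r k).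
    rewrite (@measure_bigsetU_ord _ _ _ leb q P (fun k : 'I_q => grid r k)); last 2 first.
    - by move=> k; exact: measurable_grid.
    - apply/trivIsetP => i j _ _ ij.
      by have /trivIsetP/(_ i j I I) := grid_trivIset r0; exact.
    transitivity (\sum_(k < q | P k) r%:E)%E; first by rewrite sumEFin.
    apply: eq_bigr => k _; transitivity (leb (grid r k)) => //.
    rewrite /grid lebesgue_measure_itv /= lte_fin ltr_pM2r// ltr_nat ltnSn -EFinB.
    by congr EFin; rewrite -natr1; ring.
  apply: le_measure; rewrite ?inE//.
    by apply: bigsetU_measurable => k _; exact: measurable_grid.
  by move=> x /in_bigsetU[k /asboolP h]; exact: h.
have hp : \sum_(k < q | P k) p k ^+ 2 <= K * r.
  rewrite -lee_fin -sumEFin; apply: le_trans hK.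
  have -> : (\sum_(k < q | P k) (p k ^+ 2)%:E)%E =
     @leb2 R (\big[setU/set0]_(k < q | P k) (F k `*` F k)).
    rewrite (@measure_bigsetU_ord _ _ _ (@leb2 R) q P (fun k : 'I_q => F k `*` F k))//.
    - apply: eq_bigr => k _; transitivity (leb (F k) * leb (F k))%E.
        by rewrite !pE -EFinM expr2.
      by rewrite -[RHS]/((leb \x leb)%E (F k `*` F k)) product_measure1E.
    - by move=> k; exact: measurableX.
    - apply/trivIsetP => i j _ _ ij; apply/seteqP; split => // x [[h1 _] [h2 _]].
      by move/trivIsetP : tF => /(_ i j I I ij)/seteqP[] /(_ x.1) h _; apply: h.
  apply: le_measure; rewrite ?inE//.
  - by apply: bigsetU_measurable => k _; exact: measurableX.
  - exact: measurable_near_diagonal.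
  move=> x /in_bigsetU[k _ [[/= E1 h1] [/= E2 h2]]]; split => //.
  move: h1 h2; rewrite /grid /= !in_itv /= -natr1 => /andP[? ?] /andP[? ?].
  by rewrite ltr_norml; apply/andP; split; lra.
rewrite SE measure_bigsetU_ord// (eq_bigr _ (fun k _ => pE k)) sumEFin.
apply: (@le_trans _ _ (s%:E * (\sum_(k < q | P k) r)%:E + (K / s)%:E)%E); last first.
  by rewrite leeD2r// lee_wpmul2l// lee_fin ltW.
rewrite -EFinM -EFinD lee_fin mulr_sumr.
apply: (@le_trans _ _ (\sum_(k < q | P k) (s * r + p k ^+ 2 / (s * r)))).
  apply: ler_sum => k _.
  have sr0 : 0 < s * r by rewrite mulr_gt0.
  have p0 : 0 <= p k by rewrite fine_ge0.
  (* p <= s r + p^2 / (s r) replaces the Cauchy-Schwarz inequality. *)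
  have [psr|psr] := leP (p k) (s * r).
    by rewrite (le_trans psr)// lerDl divr_ge0 ?sqr_ge0// ltW.
  rewrite (@le_trans _ _ (p k ^+ 2 / (s * r)))// ?lerDr ?(ltW sr0)//.
  by rewrite ler_pdivlMr// expr2 ler_wpM2l// ltW.
rewrite big_split /= lerD2l -mulr_suml ler_pdivrMr ?mulr_gt0//.
apply: (le_trans hp).
by rewrite mulrA [_ / s * s]mulrVK ?unitfE ?gt_eqF.
Qed.

(** A mean square density bounded along infinitely many scales is enough: it bounds the mass over
    open sets, and outer regularity passes to null sets. *)
Lemma pushforward_null (K : R) (r : nat -> R) : (forall n, 0 < r n) ->
  r @ \oo --> (0 : R) ->
  (forall m, exists2 n, (m <= n)%N & (@leb2 R (near_diagonal (r n)) <= (K * r n)%:E)%E) ->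
  forall A : set MR, measurable A -> leb A = 0%E -> leb (E `&` X @^-1` A) = 0%E.
Proof.
move=> r0 rcvg hr A mA A0.
have mS U n : open U -> measurable (grid_inside U (r n)).
  move=> oU.
  pose Q := \bigcup_(k in [set k | grid (r n) k `<=` U]) (E `&` X @^-1` grid (r n) k).
  have -> : grid_inside U (r n) = Q.
    by apply/seteqP; split => [v [Ev [k [h1 h2]]]|v [k h2 [Ev h1]]];
      [exists k|split => //; exists k].
  apply: bigcup_measurable => k _; apply: measurableI => //.
  by rewrite -[X in measurable X]setTI; apply: mX => //; exact: measurable_grid.
have K0 : 0 <= K.
  have [n _ hn] := hr 0%N.
  have : (0 <= (K * r n)%:E)%E by apply: le_trans hn; exact: measure_ge0.
  by rewrite lee_fin pmulr_lge0.
have bound U s : open U -> 0 < s ->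
    (leb (E `&` X @^-1` U) <= s%:E * leb U + (K / s)%:E)%E.
  move=> oU s0; have mU : measurable (U : set MR) by exact: open_measurable.
  (* Meshes of different scales are not nested. The intersections over tails increase to the
     preimage of U, and each lies in the set belonging to some good scale [n >= m]. *)
  pose Un m := \bigcap_(n in [set n | (m <= n)%N]) grid_inside U (r n).
  have mUn m : measurable (Un m).
    by apply: bigcap_measurableType => n _; exact: mS.
  have UnU : \bigcup_m Un m = E `&` X @^-1` U.
    apply/seteqP; split => [v [m _ /(_ m (leqnn m)) [Ev [k [h1 h2]]]]|v [Ev Uv]].
      by split => //; exact: h2.
    have /nbhs_ballP[e /= e0 he] := open_nbhs_nbhs (conj oU Uv).
    have /cvgr_lt/(_ _ e0)[m _ hm] := rcvg.
    exists m => // n /= mn; split => //.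
    have rn := r0 n; have x0 : 0 <= X v / r n.
      by rewrite divr_ge0 ?(ltW rn)//; have /andP[] := X01 v.
    exists (Num.truncn (X v / r n)).
    have hg : grid (r n) (Num.truncn (X v / r n)) (X v).
      rewrite /grid /= in_itv /= -ler_pdivlMr// -ltr_pdivrMr//.
      by apply/andP; split; [rewrite truncn_le|exact: truncnS_gt].
    split => // x; move: hg; rewrite /grid /= !in_itv /= -natr1 => /andP[? ?] /andP[? ?].
    apply: he; rewrite /ball /= ltr_norml; have := hm n mn => /= ?.
    by apply/andP; split; lra.
  have cvgU : leb \o Un @ \oo --> leb (E `&` X @^-1` U).
    rewrite -UnU; apply: nondecreasing_cvg_mu => //; first exact: bigcupT_measurable.
    apply/nondecreasing_seqP => m; apply/subsetPset => v h n /= mn.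
    by apply: h => /=; exact: ltnW.
  rewrite -(cvg_lim _ cvgU)//; apply: lime_le.
    by apply/cvg_ex; eexists; exact: cvgU.
  near=> m; have [n mn hn] := hr m.
  apply: le_trans (mass_grid_inside (r0 n) s0 mU hn).
  by apply: le_measure; rewrite ?inE//; [exact: mS|move=> v; apply; exact: mn].
have hs s : 0 < s -> (leb (E `&` X @^-1` A) <= ((K + 1) / s)%:E)%E.
  move=> s0.
  (* With [leb U <= s^-2] both terms of [bound] are of order 1/s, and s is arbitrarily large. *)
  have e0 : 0 < s^-1 ^+ 2 by rewrite exprn_gt0// invr_gt0.
  have Afin : (leb A < +oo)%E by rewrite A0.
  have [U [oU AU hU]] := lebesgue_regularity_outer mA Afin e0.
  have mU : measurable (U : set MR) by exact: open_measurable.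
  have UE : (leb U <= (s^-1 ^+ 2)%:E)%E.
    have : leb (A `|` (U `\` A)) = (leb A + leb (U `\` A))%E.
      by apply: measureU => //; [exact: measurableD|exact: setDIK].
    by rewrite setDUK// A0 add0e => ->; exact: ltW.
  apply: (@le_trans _ _ (leb (E `&` X @^-1` U))).
    apply: le_measure; rewrite ?inE.
    - by apply: measurableI => //; rewrite -[X in measurable X]setTI; exact: mX.
    - by apply: measurableI => //; rewrite -[X in measurable X]setTI; exact: mX.
    - by apply: setIS => v /AU.
  apply: le_trans (bound U s oU s0) _.
  apply: (@le_trans _ _ (s%:E * (s^-1 ^+ 2)%:E + (K / s)%:E)%E).
    by rewrite leeD2r// lee_wpmul2l// lee_fin ltW.
  rewrite -EFinM -EFinD lee_fin le_eqVlt; apply/orP; left; apply/eqP.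
  by field; rewrite gt_eqF.
apply/eqP; rewrite eq_le measure_ge0 andbT; apply/lee_addgt0Pr => e e_gt0.
rewrite add0e; have K1 : 0 < K + 1 by rewrite ltr_wpDl.
apply: le_trans (hs ((K + 1) / e) _) _; first by rewrite divr_gt0.
by rewrite lee_fin invf_div mulrCA divff ?mulr1// gt_eqF.
Unshelve. all: by end_near. Qed.

End AbsoluteContinuityCriterion.

Lemma limn_einf_sup_einfs (R : realType) (u : nat -> \bar R) :
  limn_einf u = ereal_sup (range (einfs u)).
Proof. by rewrite limn_einf_lim; apply/cvg_lim => //; exact: cvg_einfs_sup. Qed.

Lemma limn_einf_le (R : realType) (u : nat -> \bar R) (C : \bar R) :
  (forall n, u n <= C)%E -> (limn_einf u <= C)%E.
Proof.
move=> uC; rewrite limn_einf_sup_einfs; apply: ge_ereal_sup => _ [n _ <-].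
by apply: le_trans (uC n); apply: ereal_inf_lbound; exists n => /=.
Qed.

Lemma limn_einf_ge0 (R : realType) (u : nat -> \bar R) :
  (forall n, 0 <= u n)%E -> (0 <= limn_einf u)%E.
Proof.
move=> u0; rewrite limn_einf_sup_einfs; apply: (@le_trans _ _ (einfs u 0)).
  by apply: le_ereal_inf_tmp => _ [n _ <-].
by apply: ereal_sup_ubound; exists 0%N.
Qed.

Lemma limn_einf_frequently (R : realType) (u : nat -> \bar R) (K : R) :
  (limn_einf u < K%:E)%E -> forall m, exists2 n, (m <= n)%N & (u n <= K%:E)%E.
Proof.
rewrite limn_einf_sup_einfs => h m.
have hm : (einfs u m < K%:E)%E.
  by apply: le_lt_trans h; apply: ereal_sup_ubound; exists m.
move: hm; rewrite /einfs => /ereal_inf_lt[_ [n /= mn <-]] /ltW; by exists n.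
Qed.

Section AlmostEveryContraction.
Variables (R : realType) (b : R).
Hypothesis hb : 1 < b < 2.
Notation leb := (@lebesgue_measure R).
Notation MR := (measurableTypeR R).
Variables (g eps delta : R).
Hypotheses (bg : b <= g) (Sg : Sset g).
Hypotheses (delta0 : 0 < delta) (geps : g^-1 + eps < 1).
Hypothesis transv : forall q (a c : nat -> bool),
   (\sum_(k < q) (a k : nat)%:R * g^-1 ^+ k.+1 <= 1 :> R) ->
   (\sum_(k < q) (c k : nat)%:R * g^-1 ^+ k.+1 <= 1 :> R) ->
   forall x y, g^-1 <= y -> y <= x -> x <= g^-1 + eps ->
   `|diff_poly q a c y| < delta ->
   (x - y) / 2 <= diff_poly q a c y - diff_poly q a c x.
Variable l0 : R.
Hypothesis bl0 : b^-1 < l0.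

Lemma live_fin : (leb (live b) < +oo)%E.
Proof.
apply: (@le_lt_trans _ _ (leb `[0, tower_width b]%classic)).
  apply: le_measure; rewrite ?inE//; first exact: measurable_live.
  by move=> v [/andP[h1 h2] _]; rewrite /= in_itv /= h1 ltW.
by rewrite lebesgue_measure_itv /=; case: ifP => _; rewrite ?ltry// -EFinB ltry.
Qed.

(** The scales are [t ^+ n]. Since t is at least every l in [Jset], truncation errors are at most
    [t ^+ n]; since it is at least [b^-1], so is the share of unseparated pairs up to a constant. *)
Let t := Num.max (g^-1 + eps) b^-1.

Let t01 : 0 < t < 1.
Proof. by rewrite lt_max (inv_base_gt0 hb) orbT /= gt_max geps (inv_base_lt1 hb). Qed.

Lemma near_diagonal_close_pairs n l : Jset g eps l0 l ->
  near_diagonal (live b) (coord b l) (t ^+ n) `<=` ysection (close_pairs b g eps l0 n (2 * t ^+ n)) l.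
Proof.
move=> Jl p [E1 E2 h]; apply/ysectionP; split => //=.
have [_ _ h3 hl] := Jset_range hb bg geps bl0 Jl.
have lt : l ^+ n <= t ^+ n.
  case/andP: hl => hl0 _; case/andP: t01 => t0 _.
  have lt : l <= t by rewrite /t le_max h3.
  by rewrite lerXn2r ?nnegrE ?(ltW hl0) ?(ltW t0).
have := coord_le_coord_trunc b hl n p.1; have := coord_le_coord_trunc b hl n p.2.
have := coord_trunc_le_coord b hl n p.1; have := coord_trunc_le_coord b hl n p.2.
move: h; rewrite !ltr_norml => /andP[? ?] ? ? ? ?; apply/andP; split; lra.
Qed.

(** The exceptional rates are fixed before A: they are those where the lower limit of the rescaled
    pair masses is infinite, and its integral is finite. *)
Lemma ae_pushforward_null : {ae leb, forall l, Jset g eps l0 l ->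
  forall A : set MR, measurable A -> leb A = 0%E -> leb (live b `&` coord b l @^-1` A) = 0%E}.
Proof.
have /andP[t0 t1] := t01.
have tn n : 0 < t ^+ n by exact: exprn_gt0.
pose Phi n (l : MR) := ((t ^+ n)^-1%:E *
  @leb2 R (ysection (close_pairs b g eps l0 n (2 * t ^+ n)) l))%E.
have mPhi n : measurable_fun setT (Phi n).
  apply: emeasurable_funM => //.
  by apply: measurable_fun_ysection; exact: measurable_close_pairs.
have Phi0 n l : (0 <= Phi n l)%E by rewrite mule_ge0// lee_fin invr_ge0 ltW.
(* The bound of [close_pairs_integral] at radius [2 * t ^+ n], divided by [t ^+ n], with
   [b^-n <= t ^+ n] in its last term. *)
pose C := tower_width b ^+ 2 * pair_const g eps delta / (1 - l0^-1 * b^-1) * 2 + tower_width b ^+ 2.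
have iPhi n : (\int[leb]_l Phi n l <= C%:E)%E.
  rewrite /Phi ge0_integralZl_EFin//; last 2 first.
  - by apply: measurable_fun_ysection; exact: measurable_close_pairs.
  - by rewrite invr_ge0 ltW.
  have r2 : 0 < 2 * t ^+ n by rewrite mulr_gt0.
  have := close_pairs_integral hb bg Sg delta0 geps transv bl0 n r2.
  move=> /(lee_wpmul2l (x := (t ^+ n)^-1%:E)) h; apply: le_trans (h _) _.
    by rewrite lee_fin invr_ge0 ltW.
  rewrite -EFinM lee_fin ler_pdivrMl// /C mulrDr lerD//.
    by rewrite le_eqVlt; apply/orP; left; apply/eqP; ring.
  rewrite mulrC ler_wpM2r ?sqr_ge0// lerXn2r ?nnegrE ?(ltW (inv_base_gt0 hb)) ?(ltW t0)//.
  by rewrite /t le_max lexx orbT.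
pose h l := limn_einf (Phi ^~ l).
have ih : (\int[leb]_l h l < +oo)%E.
  apply: le_lt_trans (fatou leb measurableT mPhi (fun n l _ => Phi0 n l)) _.
  apply: (@le_lt_trans _ _ C%:E); last exact: ltry.
  exact: limn_einf_le.
have h0 l : (0 <= h l)%E by exact: limn_einf_ge0.
have mh : measurable_fun setT h.
  apply: (measurableT_comp (f := -%E)) => //.
  apply: (measurable_fun_limn_esup (f := fun n l => (- Phi n l)%E)) => n.
  exact: measurableT_comp.
have inth : leb.-integrable setT h.
  apply/integrableP; split => //.
  by under eq_integral do rewrite gee0_abs//.
have := integrable_ae measurableT inth.
apply: filterS => l /(_ I) hfin Jl A mA A0.
have [_ _ _ hl] := Jset_range hb bg geps bl0 Jl.
apply: (@pushforward_null R (live b) (coord b l) _ _ _ _ (fine (h l) + 1) (fun n => t ^+ n)) => //.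
- exact: measurable_live.
- exact: live_fin.
- exact: measurable_coord.
- by move=> v; rewrite coord_ge0// coord_le1.
- by apply: cvg_expr; rewrite ger0_norm// ltW.
(* Adding 1 makes the inequality strict, so that it holds at infinitely many scales. *)
have hK : (limn_einf (Phi ^~ l) < (fine (h l) + 1)%:E)%E.
  by rewrite EFinD fineK// -/(h l) lteDl// lte_fin.
move=> m; have [n mn hn] := limn_einf_frequently hK m.
exists n => //; move: hn; rewrite /Phi lee_pdivrMl//.
rewrite -EFinM [(t ^+ n * _)%R]mulrC => hn; apply: le_trans hn; apply: le_measure; rewrite ?inE.
- apply: measurable_near_diagonal; [exact: measurable_live|exact: measurable_coord].
- by apply: measurable_ysection; exact: measurable_close_pairs.
- exact: near_diagonal_close_pairs.
Qed.

End AlmostEveryContraction.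

(** * Cesaro averages *)

Section BetaMap.
Variables (R : realType) (b : R).
Hypothesis hb : 1 < b < 2.
Notation leb := (@lebesgue_measure R).
Notation MR := (measurableTypeR R).

Definition bmap (y : R) : R := if y < b^-1 then b * y else b * y - 1.

Lemma bmap_range y : 0 <= y < 1 -> 0 <= bmap y < 1.
Proof.
have b0 := base_gt0 hb; have ? : b < 2 by case/andP: hb.
move=> /andP[y0 y1]; rewrite /bmap; case: ltP => h; apply/andP; split.
- by rewrite mulr_ge0// ltW.
- by rewrite mulrC -ltr_pdivlMr// mul1r.
- by rewrite subr_ge0 mulrC -ler_pdivrMr// mul1r.
- nra.
Qed.

Lemma iter_bmap_range k y : 0 <= y < 1 -> 0 <= iter k bmap y < 1.
Proof. by move=> h; elim: k => //= k; exact: bmap_range. Qed.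

Lemma measurable_bmap : measurable_fun setT (bmap : MR -> MR).
Proof.
apply: measurable_fun_ifT.
- by apply: measurable_fun_ltr; [exact: measurable_id|exact: measurable_cst].
- have := measurable_affine b 0; congr (measurable_fun _ _).
  by apply/funext => y; rewrite addr0.
- exact: (measurable_affine b (-1)).
Qed.

Lemma measurable_iter_bmap k : measurable_fun setT (iter k bmap : MR -> MR).
Proof.
elim: k => [|k IH]; first exact: measurable_id.
exact: measurableT_comp measurable_bmap IH.
Qed.

Lemma bmap_past v y : 0 <= v < tower_width b -> 0 <= y < height b v ->
  bmap ((y + (last_digit b v)%:R) / b) = y.
Proof.
move=> _ /andP[y0 yh]; have b0 := base_gt0 hb.
have y1 : y < 1 by apply: lt_le_trans yh _; exact: height_le1.
rewrite /bmap ltr_pdivrMr// mulVf ?gt_eqF// [b * _]mulrC mulfVK ?gt_eqF//.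
case: (last_digit b v) => /=; last by rewrite addr0 y1.
by rewrite ltNge lerDr y0 addrK.
Qed.

(** The renewal relation: [bmap] spreads [[0, orbit1 j)] over [[0, orbit1 j.+1)] and, if [digit1 j]
    is 1, once more over the whole of [[0, 1)]. *)
Lemma integral_bmap j (G : MR -> \bar R) :
  measurable_fun setT G -> (forall y, 0 <= G y)%E ->
  (\int[leb]_(y in `[0%R, orbit1 b j[) G (bmap y) =
  (b^-1)%:E * ((digit1 b j)%:R%:E * \int[leb]_(y in `[0%R, 1%R[) G y +
              \int[leb]_(y in `[0%R, orbit1 b j.+1[) G y))%E.
Proof.
move=> mG G0; have b0 := base_gt0 hb; have ib0 := inv_base_gt0 hb.
have o0 := orbit1_ge0 b j.
have ilow (h : R) : h <= b^-1 ->
    (\int[leb]_(y in `[0%R, h[) G (bmap y) = (b^-1)%:E * \int[leb]_(y in `[0%R, (b * h)%R[) G y)%E.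
  move=> hb'; transitivity (\int[leb]_(y in `[0%R, h[) G (b * y + 0)%R)%E.
    apply: eq_integral => y /[!inE]; rewrite /= in_itv /= => /andP[_ yh].
    by rewrite addr0 /bmap (lt_le_trans yh).
  by rewrite integral_affine// mulr0 !addr0.
have [dj|dj] := boolP (digit1 b j); last first.
  rewrite mul0e add0e orbit1S// (negPf dj) subr0 ilow//.
  by rewrite -[leRHS]mul1r ler_pdivlMr// mulrC ltW// ltNge.
have jb : b^-1 <= orbit1 b j by move: dj; rewrite /digit1 -ler_pdivrMl// mulr1.
have -> : [set` `[0%R, orbit1 b j[] = [set` `[0%R, b^-1[] `|` [set` `[b^-1, orbit1 b j[] :> set R.
  apply/seteqP; split => z /=; rewrite !in_itv /=.
    by move=> /andP[h1 h2]; case: (ltP z b^-1) => h; [left|right]; rewrite ?h1 ?h2.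
  by case=> /andP[h1 h2]; apply/andP; split => //; lra.
have mGb : measurable_fun setT (G \o bmap) by exact: measurableT_comp mG measurable_bmap.
rewrite ge0_integral_setU//; last 2 first.
- exact: measurable_funTS.
- by apply/disj_setPS => z [] /=; rewrite !in_itv /=; lra.
rewrite ilow// divff ?gt_eqF//.
have -> : (\int[leb]_(y in `[(b^-1)%R, orbit1 b j[) G (bmap y) =
    \int[leb]_(y in `[(b^-1)%R, orbit1 b j[) G (b * y + -1)%R)%E.
  apply: eq_integral => y /[!inE]; rewrite /= in_itv /= => /andP[yh _].
  by rewrite /bmap ltNge yh.
rewrite integral_affine// divff ?gt_eqF// subrr orbit1S// dj.
by rewrite mul1e [RHS]ge0_muleDr//; exact: integral_ge0.
Qed.

Definition tower_integral (F : MR * MR -> \bar R) : \bar R :=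
  (\int[leb]_(v in `[0%R, tower_width b[) \int[leb]_(y in `[0%R, height b v[) F (v, y))%E.

(** The law of y under the area of the tower is, up to normalisation, the Parry measure. It inherits
    invariance from the area, as [bmap] undoes the fibre part of the inverse natural extension. *)
Lemma tower_integral_bmap (G : MR -> \bar R) :
  measurable_fun setT G -> (forall y, 0 <= G y)%E ->
  tower_integral (fun p => G (bmap p.2)) = tower_integral (fun p => G p.2).
Proof.
move=> mG G0; rewrite -[LHS](natural_extension_invariant hb); last 2 first.
- apply: measurableT_comp mG _.
  exact: measurableT_comp measurable_bmap measurable_snd.
- by move=> p; exact: G0.
apply: eq_integral => v /[!inE]; rewrite /= in_itv /= => hv.
apply: eq_integral => y /[!inE]; rewrite /= in_itv /= => hy.
by rewrite bmap_past.
Qed.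

End BetaMap.

Section CesaroAverages.
Variables (R : realType) (b : R).
Hypothesis hb : 1 < b < 2.
Notation leb := (@lebesgue_measure R).
Notation MR := (measurableTypeR R).
Variables (F : MR -> R) (B : R).
Hypotheses (mF : measurable_fun setT F) (F0B : forall y, 0 <= F y <= B).
Notation f := (bmap b).

Let B0 : 0 <= B.
Proof. by have /andP[h1 h2] := F0B 0; exact: le_trans h2. Qed.

Let Fk k (y : MR) : \bar R := (F (iter k f y))%:E.

Let mFk k : measurable_fun setT (Fk k).
Proof.
by apply/measurable_EFinP; exact: measurableT_comp mF (measurable_iter_bmap b k).
Qed.

Let Fk0 k y : (0 <= Fk k y)%E.
Proof. by rewrite lee_fin; have /andP[] := F0B (iter k f y). Qed.

Definition orbit_integral (k : nat) (c : R) : R :=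
  fine (\int[leb]_(y in `[0%R, c[) (F (iter k f y))%:E).

Lemma orbit_integralE k c : 0 <= c ->
  (\int[leb]_(y in `[0%R, c[) (F (iter k f y))%:E = (orbit_integral k c)%:E)%E /\
  0 <= orbit_integral k c <= B * c.
Proof.
move=> c0.
have h : (\int[leb]_(y in `[0%R, c[) (F (iter k f y))%:E <= (B * c)%:E)%E.
  apply: (@le_trans _ _ (\int[leb]_(y in `[0%R, c[) (cst B%:E) y)%E).
    apply: ge0_le_integral => //.
    - by move=> y _; exact: Fk0.
    - exact: measurable_funTS (mFk k).
    - by move=> y _; rewrite lee_fin; have /andP[] := F0B (iter k f y).
  rewrite integral_cst//= lebesgue_measure_itv /= lte_fin.
  case: ifPn => _; last by rewrite mule0 lee_fin mulr_ge0.
  by rewrite oppr0 adde0 -EFinM.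
have h0 : (0 <= \int[leb]_(y in `[0%R, c[) (F (iter k f y))%:E)%E.
  by apply: integral_ge0 => y _; exact: Fk0.
have hE : (\int[leb]_(y in `[0%R, c[) (F (iter k f y))%:E = (orbit_integral k c)%:E)%E.
  by rewrite fineK// ge0_fin_numE// (le_lt_trans h)// ltry.
by split => //; rewrite -!lee_fin -hE h0 h.
Qed.

Let avg k j := orbit_integral k (orbit1 b j).

Let avg_bounds k j : 0 <= avg k j <= B.
Proof.
have [_ /andP[-> h]] := orbit_integralE k (orbit1_ge0 b j).
by rewrite (le_trans h)// ler_piMr// orbit1_le1.
Qed.

Let avgS k j : avg k.+1 j = b^-1 * ((digit1 b j)%:R * avg k 0 + avg k j.+1).
Proof.
have [h1 _] := orbit_integralE k.+1 (orbit1_ge0 b j).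
have [h2 _] := orbit_integralE k (orbit1_ge0 b 0).
have [h3 _] := orbit_integralE k (orbit1_ge0 b j.+1).
apply: EFin_inj; rewrite -h1 EFinM EFinD EFinM -h2 -h3.
rewrite -(integral_bmap hb j (mFk k) (Fk0 k)).
by apply: eq_integral => y _; rewrite iterSr.
Qed.

Let S n j := \sum_(k < n) avg k j.

(* The intervals [0, orbit1 j) enter the recursion for Birkhoff sums as if the
   sum over [0, orbit1 j) were orbit1 j times the sum over [0, 1), up to a bound
   independent of the number of steps. *)
Lemma drift j : exists C, forall n, `|S n j - orbit1 b j * S n 0| <= C.
Proof.
have b0 := base_gt0 hb.
elim: j => [|j [C hC]].
  by exists 0 => n; rewrite /orbit1 /= mul1r subrr normr0.
exists (b * (C + B)) => n.
(* The recursion is summed over time; the shift of time by one step leaves only the boundary terms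
   [avg n j] and [avg 0 j]. *)
have e : S n j.+1 - orbit1 b j.+1 * S n 0 =
    b * ((S n j - orbit1 b j * S n 0) + (avg n j - avg 0 j)).
  have h : b * \sum_(k < n) avg k.+1 j = (digit1 b j)%:R * S n 0 + S n j.+1.
    rewrite /S !mulr_sumr -big_split /=; apply: eq_bigr => k _.
    by rewrite avgS mulrA divff ?mul1r// gt_eqF.
  have h' : \sum_(k < n) avg k.+1 j = S n j + avg n j - avg 0 j.
    have h1 : S n.+1 j = S n j + avg n j by rewrite /S big_ord_recr.
    have h2 : S n.+1 j = avg 0 j + \sum_(k < n) avg k.+1 j.
      by rewrite /S big_ord_recl; congr (_ + _); apply: eq_bigr => k _; rewrite lift0.
    by rewrite -h1 h2; ring.
  by move: h; rewrite h' orbit1S// => h; rewrite -[S n j.+1](addKr ((digit1 b j)%:R * S n 0)) -h; ring.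
rewrite e normrM (gtr0_norm b0) ler_pM2l//.
apply: le_trans (ler_normD _ _) _; rewrite lerD//.
have /andP[? ?] := avg_bounds n j; have /andP[? ?] := avg_bounds 0 j.
by rewrite ler_norml; apply/andP; split; lra.
Qed.

Definition tower_mass : R := fine (\int[leb]_(v in `[0%R, tower_width b[) (height b v)%:E).

Lemma tower_massE : (\int[leb]_(v in `[0%R, tower_width b[) (height b v)%:E = tower_mass%:E)%E
  /\ 1 <= tower_mass.
Proof.
have mh : measurable_fun setT (fun v : MR => (height b v)%:E).
  by apply/measurable_EFinP; exact: measurable_height.
have h : (\int[leb]_(v in `[0%R, tower_width b[) (height b v)%:E <= (tower_width b)%:E)%E.
  apply: (@le_trans _ _ (\int[leb]_(y in `[0%R, tower_width b[) (cst 1%:E) y)%E).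
    apply: ge0_le_integral => //.
    - by move=> y _; rewrite lee_fin height_ge0.
    - exact: measurable_funTS.
    - by move=> y _; rewrite lee_fin height_le1.
  rewrite integral_cst//= lebesgue_measure_itv /= lte_fin mul1e.
  by rewrite (lt_trans ltr01 (tower_width_gt1 hb)) oppr0 adde0.
have h1 : (1 <= \int[leb]_(v in `[0%R, tower_width b[) (height b v)%:E)%E.
  apply: (@le_trans _ _ (\int[leb]_(v in level b 0) (height b v)%:E)%E).
    rewrite (eq_integral (cst 1%:E)); last first.
      by move=> v /[!inE] /levelP hv; rewrite (height_level hb hv).
    rewrite integral_cst//; last exact: measurable_level.
    have l1 : leb (level b 0) = 1%E.
      by rewrite /level lebesgue_measure_itv /= level_left0 level_left1// lte_fin ltr01 oppr0 adde0.
    by rewrite mul1e -[leRHS]/(leb (level b 0)) l1.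
  apply: ge0_subset_integral => //.
  - exact: measurable_level.
  - exact: measurable_funTS.
  - by move=> v _; rewrite lee_fin height_ge0.
  - by move=> v /levelP /(level_range hb); rewrite /= in_itv.
have hE : (\int[leb]_(v in `[0%R, tower_width b[) (height b v)%:E = tower_mass%:E)%E.
  by rewrite fineK// ge0_fin_numE ?(le_trans _ h1)// (le_lt_trans h)// ltry.
by split => //; rewrite -lee_fin -hE.
Qed.

Definition tower_mean : R := fine (tower_integral b (fun p => (F p.2)%:E)).

Let A k (v : MR) : R := orbit_integral k (height b v).

Let mA k : measurable_fun setT (A k).
Proof.
exact: (measurable_cellwise hb (F := fun p _ => orbit_integral k
  (if p.2 == digit1 b p.1 then orbit1 b p.1.+1 else 1))).
Qed.

Let A_bounds k v : 0 <= A k v <= B.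
Proof.
have [_ /andP[-> h]] := orbit_integralE k (height_ge0 b v).
by rewrite (le_trans h)// ler_piMr// height_le1.
Qed.

Let AE k v : (\int[leb]_(y in `[0%R, height b v[) (F (iter k f y))%:E = (A k v)%:E)%E.
Proof. by have [] := orbit_integralE k (height_ge0 b v). Qed.

Lemma tower_meanE k : (\int[leb]_(v in `[0%R, tower_width b[) (A k v)%:E = tower_mean%:E)%E.
Proof.
have e i : (tower_integral b (fun p => (F (iter i f p.2))%:E) =
    \int[leb]_(v in `[0%R, tower_width b[) (A i v)%:E)%E.
  by apply: eq_integral => v _; exact: AE.
have inv i : tower_integral b (fun p => (F (iter i f p.2))%:E) =
    tower_integral b (fun p => (F p.2)%:E).
  elim: i => [|i IH]; first by [].
  rewrite -[RHS]IH -(tower_integral_bmap hb (mFk i) (Fk0 i)).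
  by congr tower_integral; apply/funext => p; rewrite iterSr.
rewrite -e inv /tower_mean fineK// (e 0%N).
have h : (\int[leb]_(v in `[0%R, tower_width b[) (A 0 v)%:E <= (B * tower_width b)%:E)%E.
  apply: (@le_trans _ _ (\int[leb]_(y in `[0%R, tower_width b[) (cst B%:E) y)%E).
    apply: ge0_le_integral => //.
    - by move=> y _; rewrite lee_fin; have /andP[] := A_bounds 0 y.
    - by apply: measurable_funTS; apply/measurable_EFinP.
    - by move=> y _; rewrite lee_fin; have /andP[] := A_bounds 0 y.
  rewrite integral_cst//= lebesgue_measure_itv /= lte_fin.
  by rewrite (lt_trans ltr01 (tower_width_gt1 hb)) oppr0 adde0.
rewrite ge0_fin_numE; first by rewrite (le_lt_trans h)// ltry.
by apply: integral_ge0 => v _; rewrite lee_fin; have /andP[] := A_bounds 0 v.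
Qed.

Let D : set MR := [set` `[0%R, tower_width b[].

Let mD : measurable D. Proof. exact: measurable_itv. Qed.

Let Dfin : (leb D < +oo)%E.
Proof. by rewrite lebesgue_measure_itv /=; case: ifP => _; rewrite ?ltry// -EFinB ltry. Qed.

Let bounded_integrable (h : MR -> R) (K : R) : measurable_fun setT h ->
  (forall v, `|h v| <= K) -> leb.-integrable D (EFin \o h).
Proof.
move=> mh hK; apply: measurable_bounded_integrable => //.
- exact: measurable_funTS.
exists K; split; first exact: num_real.
by move=> x Kx v _ /=; rewrite (le_trans (hK v))// ltW.
Qed.

(** Integrated over the tower, the averages over fibres give [tower_mean] at all times by
    invariance, and their approximations by [drift] give [s n * tower_mass]. *)
Lemma cesaro_orbit_integral :
  (fun n => n%:R^-1 * \sum_(k < n) orbit_integral k 1) @ \oo -->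
  tower_mean / tower_mass.
Proof.
have [ME M1] := tower_massE; have M0 : 0 < tower_mass by apply: lt_le_trans M1.
set s := fun n => _.
have s0B n : 0 <= s n <= B.
  have [->|n0] := posnP n; first by rewrite /s big_ord0 mulr0 lexx.
  have n0' : (0 : R) < n%:R by rewrite ltr0n.
  rewrite /s mulr_ge0 ?invr_ge0 ?ler0n ?sumr_ge0//=; last first.
    by move=> k _; have /andP[] := avg_bounds k 0.
  rewrite ler_pdivrMl//; apply: (@le_trans _ _ (\sum_(k < n) B)).
    by apply: ler_sum => k _; have /andP[] := avg_bounds k 0.
  by rewrite sumr_const card_ord mulr_natl.
pose a n (v : MR) := n%:R^-1 * \sum_(k < n) A k v.
have a0B n v : 0 <= a n v <= B.
  have [->|n0] := posnP n; first by rewrite /a big_ord0 mulr0 lexx.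
  have n0' : (0 : R) < n%:R by rewrite ltr0n.
  rewrite /a mulr_ge0 ?invr_ge0 ?ler0n ?sumr_ge0//=; last first.
    by move=> k _; have /andP[] := A_bounds k v.
  rewrite ler_pdivrMl//; apply: (@le_trans _ _ (\sum_(k < n) B)).
    by apply: ler_sum => k _; have /andP[] := A_bounds k v.
  by rewrite sumr_const card_ord mulr_natl.
pose c n (v : MR) := s n * height b v.
have c0B n v : 0 <= c n v <= B.
  have /andP[h1 h2] := s0B n; rewrite /c mulr_ge0 ?height_ge0//=.
  by rewrite (le_trans _ h2)// ler_piMr// height_le1.
have ma n : measurable_fun setT (a n).
  apply: measurable_funM; first exact: measurable_cst.
  by apply: measurable_sum => k; exact: mA.
have mc n : measurable_fun setT (c n).
  by apply: measurable_funM; [exact: measurable_cst|exact: measurable_height].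
(* The factor [(0 < n)%:R] accounts for n = 0, where the average is 0. *)
have iac n : (\int[leb]_(v in D) ((a n v)%:E - (c n v)%:E) =
   ((0 < n)%:R * tower_mean - s n * tower_mass)%:E)%E.
  rewrite integralB_EFin//; last 2 first.
  - by apply: (bounded_integrable (K := B)) => // v; have /andP[? ?] := a0B n v;
      rewrite ger0_norm.
  - by apply: (bounded_integrable (K := B)) => // v; have /andP[? ?] := c0B n v;
      rewrite ger0_norm.
  rewrite EFinB; congr (_ - _)%E.
    rewrite /a; under eq_integral do rewrite EFinM.
    rewrite ge0_integralZl_EFin ?invr_ge0 ?ler0n//; last 2 first.
    - by move=> v _; rewrite lee_fin sumr_ge0// => k _; have /andP[] := A_bounds k v.
    - by apply: measurable_funTS; apply/measurable_EFinP; apply: measurable_sum.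
    under eq_integral do rewrite -sumEFin.
    rewrite ge0_integral_sum//; last 2 first.
    - by move=> k; apply: measurable_funTS; exact/measurable_EFinP.
    - by move=> k v _; rewrite lee_fin; have /andP[] := A_bounds k v.
    under eq_bigr do rewrite tower_meanE.
    rewrite sumEFin -EFinM sumr_const card_ord; congr EFin.
    have [->|n0] := posnP n; first by rewrite mulr0n mulr0 mul0r.
    by rewrite -[tower_mean *+ n]mulr_natl mulrA mulVf// pnatr_eq0 -lt0n.
  rewrite /c; under eq_integral do rewrite EFinM.
  rewrite ge0_integralZl_EFin//.
  - by rewrite ME -EFinM.
  - by move=> v _; rewrite lee_fin height_ge0.
  - by apply: measurable_funTS; apply/measurable_EFinP; exact: measurable_height.
  - by have /andP[] := s0B n.
(* The constant of [drift] depends on the level of v, so the convergence is only pointwise and is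
   integrated by dominated convergence. *)
have pw v : D v -> (fun n => (a n v)%:E - (c n v)%:E)%E @ \oo --> 0%E.
  rewrite /D /= in_itv /= => /(level_cover hb)[j hj].
  have [C hC] := drift j.
  have aE n : a n v - c n v = n%:R^-1 * (S n j - orbit1 b j * S n 0).
    by rewrite /a /c /s /A (height_level hb hj) mulrBr; congr (_ - _);
      rewrite -mulrA [_ * orbit1 b j]mulrC.
  under eq_fun do rewrite -EFinB aE.
  apply: cvg_EFin; first by near=> n.
  apply/cvgr0Pnorm_le => e e0.
  near=> n.
  have n0 : (0 : R) < n%:R.
    by rewrite ltr0n; near: n; exact: nbhs_infty_gt.
  rewrite /= normrM (@gtr0_norm _ n%:R^-1) ?invr_gt0// ler_pdivrMl//.
  apply: le_trans (hC n) _; rewrite -ler_pdivrMr// ltW//.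
  by near: n; exact: nbhs_infty_gtr.
have key : (fun n => \int[leb]_(v in D) ((a n v)%:E - (c n v)%:E))%E @ \oo --> 0%E.
  rewrite -[X in _ --> X](integral0 leb D).
  apply: (@dominated_cvg _ _ _ leb D _ _ (cst 0%E) (cst B%:E)) => //.
  - move=> n; apply: measurable_funTS; apply: emeasurable_funB;
      exact/measurable_EFinP.
  - have := @bounded_integrable (cst B) `|B|.
    by apply => // v; exact: lexx.
  - move=> n v _; rewrite -EFinB lee_fin.
    have /andP[? ?] := a0B n v; have /andP[? ?] := c0B n v.
    by rewrite ler_norml; apply/andP; split; lra.
have key' : (fun n => (0 < n)%:R * tower_mean - s n * tower_mass) @ \oo --> (0 : R).
  by move: key; under eq_fun do rewrite iac; move=> /fine_cvg.
have one : (fun n => (0 < n)%:R * tower_mean) @ \oo --> tower_mean.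
  apply: cvg_near_cst; near=> n.
  by rewrite (_ : (0 < n)%N = true) ?mul1r//; near: n; exact: nbhs_infty_gt.
have -> : s = (fun n => ((0 < n)%:R * tower_mean -
   ((0 < n)%:R * tower_mean - s n * tower_mass)) / tower_mass).
  by apply/funext => n; rewrite opprB addrCA subrr addr0 mulfK// gt_eqF.
rewrite -[tower_mean in X in _ --> X]subr0.
by apply: cvgM; [apply: cvgB; [exact: one|exact: key']|exact: cvg_cst].
Unshelve. all: by end_near. Qed.

End CesaroAverages.

Lemma fine_integral_close d (T : measurableType d) (R : realType)
    (mu : {measure set T -> \bar R}) (D : set T) (g h : T -> R) (B e m : R) :
  measurable D -> mu D = m%:E -> 0 <= e ->
  measurable_fun D g -> measurable_fun D h ->
  (forall x, D x -> 0 <= g x <= B) -> (forall x, D x -> 0 <= h x <= B) ->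
  (forall x, D x -> `|g x - h x| <= e) ->
  `|fine (\int[mu]_(x in D) (g x)%:E) - fine (\int[mu]_(x in D) (h x)%:E)| <= e * m.
Proof.
move=> mD mDm e0 mg mh g0 h0 gh.
have fin (u : T -> R) : measurable_fun D u -> (forall x, D x -> 0 <= u x <= B) ->
    (\int[mu]_(x in D) (u x)%:E)%E \is a fin_num.
  move=> mu' u0; rewrite ge0_fin_numE; last first.
    by apply: integral_ge0 => x /u0/andP[]; rewrite lee_fin.
  apply: (@le_lt_trans _ _ (\int[mu]_(x in D) (cst B%:E) x)%E).
    apply: ge0_le_integral => //.
    - by move=> x /u0/andP[]; rewrite lee_fin.
    - exact/measurable_EFinP.
    - by move=> x /u0/andP[]; rewrite lee_fin.
  by rewrite integral_cst// mDm -EFinM ltry.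
have le (u w : T -> R) : measurable_fun D u -> (forall x, D x -> 0 <= u x <= B) ->
   measurable_fun D w -> (forall x, D x -> 0 <= w x <= B) ->
   (forall x, D x -> u x <= w x + e) ->
   fine (\int[mu]_(x in D) (u x)%:E) <= fine (\int[mu]_(x in D) (w x)%:E) + e * m.
  move=> mu' u0 mw w0 uw; rewrite -lee_fin EFinD !fineK ?fin//.
  apply: (@le_trans _ _ (\int[mu]_(x in D) ((w x)%:E + (cst e%:E) x))%E).
    apply: ge0_le_integral => //.
    - by move=> x /u0/andP[]; rewrite lee_fin.
    - exact/measurable_EFinP.
    - by apply: emeasurable_funD => //; exact/measurable_EFinP.
  have w0' x : D x -> (0 <= (w x)%:E)%E by move=> /w0/andP[]; rewrite lee_fin.
  have mw' : measurable_fun D (fun x => (w x)%:E) by exact/measurable_EFinP.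
  by rewrite ge0_integralD// integral_cst// mDm -EFinM.
have h1 : fine (\int[mu]_(x in D) (g x)%:E) <= fine (\int[mu]_(x in D) (h x)%:E) + e * m.
  by apply: le => // x /gh; rewrite ler_norml => /andP[? ?]; lra.
have h2 : fine (\int[mu]_(x in D) (h x)%:E) <= fine (\int[mu]_(x in D) (g x)%:E) + e * m.
  by apply: le => // x /gh; rewrite ler_norml => /andP[? ?]; lra.
by rewrite ler_norml; apply/andP; split; lra.
Qed.

(** * From Cesaro averages of the beta-map to those of the planar map *)

Section SkewProduct.
Variables (R : realType) (b l : R).
Hypotheses (hb : 1 < b < 2) (hl : 0 < l < 1).
Notation leb := (@lebesgue_measure R).
Notation MR := (measurableTypeR R).
Notation T := (Tbl b l).

Lemma Tbl_snd p : (T p).2 = bmap b p.2.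
Proof. by rewrite /Tbl /bmap; case: ifP. Qed.

Lemma Tbl_fst p : (T p).1 = l * p.1 + (if p.2 < b^-1 then 0 else 1 - l).
Proof. by rewrite /Tbl; case: ifP; rewrite ?addr0 ?addrA. Qed.

Lemma iter_Tbl_snd k p : (iter k T p).2 = iter k (bmap b) p.2.
Proof. by elim: k => //= k IH; rewrite Tbl_snd IH. Qed.

(** The branch is chosen by the second coordinate alone, so points on the same horizontal line
    always use the same branch. *)
Lemma iter_Tbl_fst k x x' y :
  (iter k T (x, y)).1 - (iter k T (x', y)).1 = l ^+ k * (x - x').
Proof.
elim: k => [|k IH]; first by rewrite mul1r.
by rewrite !iterS !Tbl_fst !iter_Tbl_snd opprD addrACA subrr addr0 -mulrBr IH exprS mulrA.
Qed.

Lemma Tbl_range p : 0 <= p.1 < 1 -> 0 <= (T p).1 < 1.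
Proof.
have /andP[l0 l1] := hl => /andP[h1 h2]; rewrite Tbl_fst.
by case: ifP => _; apply/andP; split; nra.
Qed.

Lemma iter_Tbl_range k p : 0 <= p.1 < 1 -> 0 <= (iter k T p).1 < 1.
Proof. by move=> h; elim: k => //= k; exact: Tbl_range. Qed.

Lemma iter_Tbl_Qsq k p : Qsq p -> Qsq (iter k T p).
Proof.
move=> [h1 h2]; split; first exact: iter_Tbl_range.
by rewrite iter_Tbl_snd; exact: iter_bmap_range.
Qed.

Lemma measurable_Tbl : measurable_fun setT (T : mR2 R -> mR2 R).
Proof.
have m1 : measurable_fun setT (fun p : mR2 R => p.1 : R) by exact: measurable_fst.
have m2 : measurable_fun setT (fun p : mR2 R => p.2 : R) by exact: measurable_snd.
apply: measurable_fun_ifT.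
- exact: measurable_fun_ltr.
- apply: measurable_fun_pair.
    have : measurable_fun setT (fun p : mR2 R => l * p.1) by exact: measurable_funM.
    exact.
  have : measurable_fun setT (fun p : mR2 R => b * p.2) by exact: measurable_funM.
  exact.
- apply: measurable_fun_pair.
    have : measurable_fun setT (fun p : mR2 R => l * p.1 + 1 - l).
      apply: measurable_funB => //; apply: measurable_funD => //.
      exact: measurable_funM.
    exact.
  have : measurable_fun setT (fun p : mR2 R => b * p.2 - 1).
    by apply: measurable_funB => //; exact: measurable_funM.
  exact.
Qed.

Lemma measurable_iter_Tbl k : measurable_fun setT (iter k T : mR2 R -> mR2 R).
Proof.
elim: k => [|k IH]; first exact: measurable_id.
exact: measurableT_comp measurable_Tbl IH.
Qed.

Definition tower : set (mR2 R) :=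
  [set p | 0 <= p.1 < tower_width b /\ 0 <= p.2 < height b p.1].

Definition code (p : mR2 R) : mR2 R := (coord b l p.1, p.2).

Lemma measurable_code : measurable_fun setT code.
Proof.
apply: measurable_fun_pair; last exact: measurable_snd.
have := measurable_coord hb hl.
move=> /measurableT_comp; apply; exact: measurable_fst.
Qed.

Lemma measurable_tower : measurable tower.
Proof.
have mh : measurable_fun setT (fun p : mR2 R => height b p.1).
  exact: measurableT_comp (measurable_height hb) measurable_fst.
have m2 : measurable_fun setT (fun p : mR2 R => p.2 : R) by exact: measurable_snd.
have -> : tower = (`[0, tower_width b[ `*` `[0, +oo[) `&`
    (fun p : mR2 R => p.2 < height b p.1) @^-1` [set true].
  apply/seteqP; split => p; rewrite /tower /= !in_itv /= andbT.
    by case=> h1 /andP[h2 h3].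
  by case=> -[h1 h2] h3; split => //; rewrite h2.
apply: measurableI; first by apply: measurableX; exact: measurable_itv.
rewrite -[X in measurable X]setTI.
have : measurable_fun setT (fun p : mR2 R => (p.2 : R) < height b p.1).
  exact: measurable_fun_ltr.
by apply.
Qed.

Lemma integral_tower (F : mR2 R -> \bar R) :
  measurable_fun setT F -> (forall p, 0 <= F p)%E ->
  (\int[@leb2 R]_(p in tower) F p)%E = tower_integral b F.
Proof.
move=> mF F0; rewrite (integral_leb2 measurable_tower mF F0).
rewrite /tower_integral [RHS]integral_mkcond; apply: eq_integral => v _.
rewrite patchE; case: ifPn => [|].
  rewrite inE /= in_itv /= => hv; congr (integral _ _ _).
  by apply/seteqP; split => y; rewrite /tower /= in_itv /= hv; [case|].
rewrite notin_setE /= in_itv /= => hv.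
rewrite (_ : [set y | tower (v, y)] = set0) ?integral_set0//.
by apply/seteqP; split => // y [].
Qed.

Lemma leb2_tower : @leb2 R tower = (tower_mass b)%:E.
Proof.
have := @integral_tower (cst 1%E) (measurable_cst _) (fun _ => lee01).
rewrite integral_cst ?mul1e; last exact: measurable_tower.
move=> ->; rewrite -(proj1 (tower_massE hb)).
apply: eq_integral => v _; rewrite integral_cst//= mul1e lebesgue_measure_itv /=.
rewrite lte_fin; case: ltP => h; first by rewrite oppr0 adde0.
by congr EFin; apply/eqP; rewrite eq_le h height_ge0.
Qed.

(** The argument of [code] on the left is the preimage of [(v, y)] in the natural extension; the
    horizontal action of [Tbl] is the recursion [coord_past]. *)
Lemma Tbl_code v y : 0 <= v < tower_width b -> 0 <= y < height b v ->
  T (code (past b v, (y + (last_digit b v)%:R) / b)) = code (v, y).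
Proof.
move=> hv hy; rewrite [LHS]surjective_pairing Tbl_fst Tbl_snd /code /=.
rewrite bmap_past//; congr pair; rewrite [RHS]coord_past//; congr (_ + _).
have b0 := base_gt0 hb; have /andP[y0 yh] := hy.
rewrite ltr_pdivrMr// mulVf ?gt_eqF//.
case: (last_digit b v) => /=; first by rewrite ltNge lerDr y0 mulr1.
by rewrite addr0 (lt_le_trans yh) ?height_le1// mulr0.
Qed.

Lemma tower_integral_Tbl (F : mR2 R -> \bar R) :
  measurable_fun setT F -> (forall p, 0 <= F p)%E ->
  tower_integral b (fun p => F (T (code p))) = tower_integral b (fun p => F (code p)).
Proof.
move=> mF F0.
have mG : measurable_fun setT (fun p => F (T (code p))).
  exact: measurableT_comp mF (measurableT_comp measurable_Tbl measurable_code).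
rewrite /tower_integral -(natural_extension_invariant hb mG); last by move=> p; exact: F0.
apply: eq_integral => v /[!inE]; rewrite /= in_itv /= => hv.
apply: eq_integral => y /[!inE]; rewrite /= in_itv /= => hy.
by rewrite Tbl_code.
Qed.

Lemma tower_integral_iter_Tbl (F : mR2 R -> \bar R) k :
  measurable_fun setT F -> (forall p, 0 <= F p)%E ->
  tower_integral b (fun p => F (iter k T (code p))) = tower_integral b (fun p => F (code p)).
Proof.
move=> mF F0; elim: k => [|k IH]; first by [].
rewrite -[RHS]IH.
have mG : measurable_fun setT (fun p => F (iter k T p)).
  exact: measurableT_comp mF (measurable_iter_Tbl k).
rewrite -(tower_integral_Tbl mG); last by move=> p; exact: F0.
by congr tower_integral; apply/funext => p; rewrite iterSr.
Qed.

Lemma measurable_Qsq : measurable (@Qsq R : set (mR2 R)).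
Proof.
have -> : (@Qsq R : set (mR2 R)) = `[0, 1[ `*` `[0, 1[.
  by apply/seteqP; split => p; rewrite /Qsq /= !in_itv.
by apply: measurableX; exact: measurable_itv.
Qed.

Lemma leb2_Qsq : @leb2 R (@Qsq R) = 1%E.
Proof.
have -> : (@Qsq R : set (mR2 R)) = `[0, 1[ `*` `[0, 1[.
  by apply/seteqP; split => p; rewrite /Qsq /= !in_itv.
have h : leb `[0, 1[%classic = 1%E.
  by rewrite lebesgue_measure_itv /= lte_fin ltr01 oppr0 adde0.
rewrite /leb2 product_measure1E; [|exact: measurable_itv|exact: measurable_itv].
by rewrite -[LHS]/(leb `[0%R, 1%R[%classic * leb `[0%R, 1%R[%classic)%E h mule1.
Qed.

Lemma integral_Qsq_snd (F : MR -> \bar R) :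
  measurable_fun setT F -> (forall y, 0 <= F y)%E ->
  (\int[@leb2 R]_(p in (@Qsq R : set (mR2 R))) F p.2 = \int[leb]_(y in `[0%R, 1%R[) F y)%E.
Proof.
move=> mF F0; have mF2 : measurable_fun setT (fun p : mR2 R => F p.2).
  exact: measurableT_comp mF measurable_snd.
rewrite (integral_leb2 measurable_Qsq mF2 (fun p => F0 p.2)).
transitivity (\int[leb]_(v in `[0%R, 1%R[) \int[leb]_(y in `[0%R, 1%R[) F y)%E.
  rewrite [RHS]integral_mkcond; apply: eq_integral => v _.
  rewrite patchE; case: ifPn => [|].
    rewrite inE /= in_itv /= => hv; congr (integral _ _ _).
    by apply/seteqP; split => y; rewrite /Qsq /= in_itv /= hv; [case|].
  rewrite notin_setE /= in_itv /= => hv.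
  rewrite (_ : [set y | Qsq (v, y)] = set0) ?integral_set0//.
  by apply/seteqP; split => // y [].
have I0 : (0 <= \int[leb]_(y in `[0%R, 1%R[) F y)%E by exact: integral_ge0.
rewrite integral_cst; last exact: measurable_itv.
have h : leb `[0, 1[%classic = 1%E.
  by rewrite lebesgue_measure_itv /= lte_fin ltr01 oppr0 adde0.
by rewrite -[X in (_ * X)%E]/(leb `[0%R, 1%R[%classic) h mule1.
Qed.

Section LipschitzObservable.
Variables (f : mR2 R -> R) (B K : R).
Hypotheses (mf : measurable_fun setT f) (f0B : forall p, 0 <= f p <= B).
Hypotheses (K0 : 0 <= K)
  (fK : forall x x' y, `|f (x, y) - f (x', y)| <= K * `|x - x'|).

Definition orbit_mean k : R := fine (\int[@leb2 R]_(p in (@Qsq R : set (mR2 R))) (f (iter k T p))%:E).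

(** The observable after m steps with the initial first coordinate set to 0: a function of y alone,
    within [K * l ^+ m] of the true value. *)
Let Fm m (y : MR) : R := f (iter m T (0, y)).

Let mFm m : measurable_fun setT (Fm m).
Proof.
apply: measurableT_comp mf _.
apply: (measurableT_comp (measurable_iter_Tbl m)).
by apply: measurable_fun_pair; [exact: measurable_cst|exact: measurable_id].
Qed.

Let Fm0B m y : 0 <= Fm m y <= B. Proof. exact: f0B. Qed.

Let l0 : 0 <= l. Proof. by case/andP: hl => /ltW. Qed.

Lemma observable_shift m p : 0 <= p.1 <= 1 ->
  `|f (iter m T p) - Fm m p.2| <= K * l ^+ m.
Proof.
case: p => x y /= /andP[x0 x1]; rewrite /Fm.
rewrite [iter m T (x, y)]surjective_pairing [iter m T (0, y)]surjective_pairing.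
rewrite !iter_Tbl_snd /=; apply: le_trans (fK _ _ _) _.
rewrite ler_wpM2l// iter_Tbl_fst subr0 normrM ger0_norm ?exprn_ge0//.
by rewrite ger0_norm// ler_piMr// exprn_ge0.
Qed.

Let mfT k : measurable_fun setT (fun p : mR2 R => f (iter k T p)).
Proof. exact: measurableT_comp mf (measurable_iter_Tbl k). Qed.

Lemma orbit_mean_bounds k : 0 <= orbit_mean k <= B.
Proof.
have B0 : 0 <= B by have /andP[h1 h2] := f0B (0, 0); exact: le_trans h2.
have h0 : (0 <= \int[@leb2 R]_(p in (@Qsq R : set (mR2 R))) (f (iter k T p))%:E)%E.
  by apply: integral_ge0 => p _; rewrite lee_fin; have /andP[] := f0B (iter k T p).
have h : (\int[@leb2 R]_(p in (@Qsq R : set (mR2 R))) (f (iter k T p))%:E <= B%:E)%E.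
  apply: (@le_trans _ _ (\int[@leb2 R]_(p in (@Qsq R : set (mR2 R))) (cst B%:E) p)%E).
    apply: ge0_le_integral => //.
    - exact: measurable_Qsq.
    - by move=> p _; rewrite lee_fin; have /andP[] := f0B (iter k T p).
    - by apply: measurable_funTS; exact/measurable_EFinP.
    - by move=> p _; rewrite lee_fin; have /andP[] := f0B (iter k T p).
  rewrite integral_cst; last exact: measurable_Qsq.
  by rewrite -[X in (_ * X)%E]/(@leb2 R (@Qsq R)) leb2_Qsq mule1.
by rewrite /orbit_mean fine_ge0//= -lee_fin fineK// ge0_fin_numE// (le_lt_trans h) ?ltry.
Qed.

Lemma orbit_mean_shift m i :
  `|orbit_mean (i + m) - orbit_integral b (Fm m) i 1| <= K * l ^+ m.
Proof.
have -> : orbit_integral b (Fm m) i 1 =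
    fine (\int[@leb2 R]_(p in (@Qsq R : set (mR2 R))) (Fm m (iter i (bmap b) p.2))%:E).
  rewrite (integral_Qsq_snd (F := fun y => (Fm m (iter i (bmap b) y))%:E))//.
    apply/measurable_EFinP.
    exact: measurableT_comp (mFm m) (measurable_iter_bmap b i).
  by move=> y; rewrite lee_fin; have /andP[] := Fm0B m (iter i (bmap b) y).
rewrite -[leRHS]mulr1.
apply: (@fine_integral_close _ _ _ (@leb2 R) (@Qsq R)
  (fun p => f (iter (i + m) T p)) (fun p => Fm m (iter i (bmap b) p.2)) B) => //.
- exact: measurable_Qsq.
- exact: leb2_Qsq.
- by rewrite mulr_ge0// exprn_ge0.
- exact: measurable_funTS.
- apply: measurable_funTS; apply: (measurableT_comp (mFm m)).
  exact: measurableT_comp (measurable_iter_bmap b i) measurable_snd.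
- move=> p [h1 h2]; rewrite addnC iterD -iter_Tbl_snd.
  by apply: observable_shift; have /andP[-> /ltW ->] := iter_Tbl_range i h1.
Qed.

Definition code_mean : R := fine (tower_integral b (fun p => (f (code p))%:E)).

Lemma code_mean_shift m :
  `|code_mean - tower_mean b (Fm m)| <= K * l ^+ m * tower_mass b.
Proof.
have f0 p : (0 <= (f p)%:E)%E by rewrite lee_fin; have /andP[] := f0B p.
have mfE : measurable_fun setT (fun p => (f p)%:E) by exact/measurable_EFinP.
rewrite /code_mean -(tower_integral_iter_Tbl m mfE f0).
have mcT : measurable_fun setT (fun p => f (iter m T (code p))).
  exact: measurableT_comp (mfT m) measurable_code.
have mF2 : measurable_fun setT (fun p : mR2 R => Fm m p.2).
  exact: measurableT_comp (mFm m) measurable_snd.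
rewrite /tower_mean -integral_tower; last 2 first.
- exact/measurable_EFinP.
- by move=> p; exact: f0.
rewrite -integral_tower; last 2 first.
- exact/measurable_EFinP.
- by move=> p; exact: f0.
apply: (@fine_integral_close _ _ _ (@leb2 R) tower
  (fun p => f (iter m T (code p))) (fun p => Fm m p.2) B) => //.
- exact: measurable_tower.
- exact: leb2_tower.
- by rewrite mulr_ge0// exprn_ge0.
- exact: measurable_funTS.
- exact: measurable_funTS.
- by move=> p _; apply: (observable_shift m (p := code p)); rewrite /= coord_ge0// coord_le1.
Qed.

Lemma cesaro_orbit_mean :
  (fun n => n%:R^-1 * \sum_(k < n) orbit_mean k) @ \oo -->
  code_mean / tower_mass b.
Proof.
have [_ M1] := tower_massE hb; have M0 : 0 < tower_mass b by exact: lt_le_trans M1.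
have /andP[lpos l1] := hl.
have B0 : 0 <= B by have /andP[h1 h2] := f0B (0, 0); exact: le_trans h2.
apply/cvgrPdist_le => e e0.
have e4 : 0 < e / 4 by rewrite divr_gt0.
(* m is fixed before n: erasing the first coordinate then costs at most e/4 at all times, and n is
   taken large for this m. *)
have [m hm] : exists m, K * l ^+ m < e / 4.
  have : (fun n => K * l ^+ n) @ \oo --> K * 0.
    by apply: cvgM; [exact: cvg_cst|apply: cvg_expr; rewrite ger0_norm].
  by rewrite mulr0 => /cvgr_lt/(_ _ e4)[m _ /(_ m (leqnn m))]; exists m.
have hF := cesaro_orbit_integral hb (mFm m) (Fm0B m).
pose s n := n%:R^-1 * \sum_(k < n) orbit_integral b (Fm m) k 1.
have hs : \forall n \near \oo, `|tower_mean b (Fm m) / tower_mass b - s n| <= e / 4.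
  by move/cvgrPdist_le : hF; apply.
near=> n.
have n0 : (0 : R) < n%:R by rewrite ltr0n; near: n; exact: nbhs_infty_gt.
pose c := n%:R^-1 * \sum_(k < n) orbit_mean k.
pose c' := n%:R^-1 * \sum_(i < n) orbit_mean (i + m).
(* Delaying the average by m steps exchanges m terms for m others, a change of at most
   [m * B / n]. *)
have d1 : `|c' - c| <= e / 4.
  have -> : c' - c = n%:R^-1 * \sum_(i < m) (orbit_mean (n + i) - orbit_mean i).
    rewrite /c' /c -mulrBr; congr (_ * _); rewrite sumrB.
    have h1 : \sum_(k < m + n) orbit_mean k =
        \sum_(k < m) orbit_mean k + \sum_(i < n) orbit_mean (i + m).
      rewrite big_split_ord /=; congr (_ + _).
      by apply: eq_bigr => i _; rewrite addnC.
    have h2 : \sum_(k < n + m) orbit_mean k =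
        \sum_(k < n) orbit_mean k + \sum_(i < m) orbit_mean (n + i).
      by rewrite big_split_ord.
    by rewrite addnC h1 in h2; lra.
  rewrite normrM gtr0_norm ?invr_gt0// ler_pdivrMl//.
  apply: (@le_trans _ _ (m%:R * B)).
    apply: le_trans (ler_norm_sum _ _ _) _.
    apply: (@le_trans _ _ (\sum_(i < m) B)).
      apply: ler_sum => i _; have /andP[? ?] := orbit_mean_bounds (n + i).
      have /andP[? ?] := orbit_mean_bounds i.
      by rewrite ler_norml; apply/andP; split; lra.
    by rewrite sumr_const card_ord mulr_natl.
  rewrite -ler_pdivrMr// ltW//; near: n; exact: nbhs_infty_gtr.
have d2 : `|c' - s n| <= e / 4.
  rewrite /c' /s -mulrBr -sumrB normrM gtr0_norm ?invr_gt0// ler_pdivrMl//.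
  apply: le_trans (ler_norm_sum _ _ _) _.
  apply: (@le_trans _ _ (\sum_(i < n) (e / 4))).
    by apply: ler_sum => i _; apply: le_trans (orbit_mean_shift m i) _; exact: ltW.
  by rewrite sumr_const card_ord mulr_natl.
have d3 : `|tower_mean b (Fm m) / tower_mass b - s n| <= e / 4 by near: n.
have d4 : `|code_mean / tower_mass b - tower_mean b (Fm m) / tower_mass b| <= e / 4.
  rewrite -mulrBl normrM (@gtr0_norm _ (_^-1)) ?invr_gt0// ler_pdivrMr//.
  apply: le_trans (code_mean_shift m) _.
  by rewrite ler_pM2r// ltW.
rewrite -/c; move: d1 d2 d3 d4; rewrite !ler_norml.
move=> /andP[? ?] /andP[? ?] /andP[? ?] /andP[? ?]; apply/andP; split; lra.
Unshelve. all: by end_near. Qed.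

End LipschitzObservable.

End SkewProduct.

(** * Weak convergence and the SRB measure *)

Lemma ge0_integral_mrestr d (T : measurableType d) (R : realType)
    (m : {measure set T -> \bar R}) (D E : set T) (mD : measurable D) (F : T -> \bar R) :
  measurable E -> measurable_fun E F -> (forall x, E x -> 0 <= F x)%E ->
  (\int[mrestr m mD]_(x in E) F x = \int[m]_(x in E `&` D) F x)%E.
Proof.
move=> mE mF F0.
rewrite (@ge0_negligible_integral _ _ _ (mrestr m mD) E (~` D))//; last 2 first.
- exact: measurableC.
- by rewrite -[LHS]/(m (~` D `&` D)) setICl measure0.
rewrite setDE setCK; apply: eq_measure_integral => A mA AD.
by rewrite -[LHS]/(m (A `&` D)) setIidl// => x /AD[].
Qed.

Lemma ge0_integral_image_measure d d' (T1 : measurableType d) (T2 : measurableType d')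
    (R : realType) (m : {measure set T1 -> \bar R}) (f : T1 -> T2)
    (mf : measurable_fun setT f) (D : set T2) (F : T2 -> \bar R) :
  measurable D -> measurable_fun D F -> (forall y, D y -> 0 <= F y)%E ->
  (\int[image_measure m mf]_(y in D) F y = \int[m]_(x in f @^-1` D) F (f x))%E.
Proof.
move=> mD mF F0; apply: (ge0_integral_pushforward mf m mD mF) => y /set_mem.
exact: F0.
Qed.

Section PlaneFunctions.
Variable R : realType.

Definition l1dist (p q : R * R) : R := `|p.1 - q.1| + `|p.2 - q.2|.

Lemma l1dist_ge0 p q : 0 <= l1dist p q. Proof. by rewrite addr_ge0. Qed.

Lemma l1distC p q : l1dist p q = l1dist q p.
Proof. by rewrite /l1dist distrC [`|p.2 - _|]distrC. Qed.

Lemma l1dist_triangle p q r : l1dist p r <= l1dist p q + l1dist q r.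
Proof.
rewrite /l1dist; have := ler_distD q.1 p.1 r.1; have := ler_distD q.2 p.2 r.2; lra.
Qed.

Lemma l1dist_refl p : l1dist p p = 0.
Proof. by rewrite /l1dist !subrr normr0 addr0. Qed.

Lemma measurable_l1dist q : measurable_fun setT (fun p : mR2 R => l1dist p q).
Proof.
have m1 : measurable_fun setT (fun p : mR2 R => p.1 : R) by exact: measurable_fst.
have m2 : measurable_fun setT (fun p : mR2 R => p.2 : R) by exact: measurable_snd.
apply: measurable_funD; apply: measurableT_comp => //; exact: measurable_funB.
Qed.

(** A sublevel set is a countable union, over centres c with rational coordinates, of the sets where
    the Lipschitz upper bound seen from c is below the level. *)
Lemma lipschitz_measurable (u : mR2 R -> R) (K : R) : 0 < K ->
  (forall p q, `|u p - u q| <= K * l1dist p q) -> measurable_fun setT u.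
Proof.
move=> K0 uK _; apply: (measurability _ (RGenInftyO.measurableE R)) => //.
move=> /= _ [_ [a ->] <-]; rewrite setTI.
rewrite [X in measurable X](_ : _ = \bigcup_(r : rat * rat)
  [set p : mR2 R | u (ratr r.1, ratr r.2) + K * l1dist p (ratr r.1, ratr r.2) < a]).
  apply: countable_bigcupT_measurable => [|r]; first exact: countableP.
  pose c : R * R := (ratr r.1, ratr r.2).
  have m : measurable_fun setT (fun p : mR2 R => u c + K * l1dist p c).
    apply: measurable_funD => //; apply: measurable_funM => //.
    exact: measurable_l1dist.
  have := measurable_fun_ltr m (measurable_cst a).
  by move=> /(_ measurableT [set true] I); rewrite setTI.
apply/seteqP; split => p /=; rewrite in_itv /=.
  (* Precision e in each coordinate gives [K * d < (a - u p) / 2]; the bound seen from the centre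
     exceeds [u p] by at most [2 * K * d], so it stays below a. *)
  move=> ha; pose e := (a - u p) / (4 * K).
  have e0 : 0 < e by rewrite divr_gt0 ?subr_gt0// mulr_gt0.
  have near (x : R) : exists r : rat, `|x - ratr r| < e.
    have /rat_in_itvoo[r] : x < x + e by rewrite ltrDl.
    rewrite in_itv /= => /andP[h1 h2]; exists r.
    by rewrite distrC ger0_norm ?subr_ge0 ?ltW//; lra.
  have [r1 h1] := near p.1; have [r2 h2] := near p.2.
  exists (r1, r2) => //=.
  have := uK p (ratr r1, ratr r2); rewrite {1}/l1dist /=.
  set d := l1dist _ _; have hd : d < 2 * e by rewrite /d /l1dist /=; lra.
  have hKd : K * d < (a - u p) / 2.
    apply: (@lt_le_trans _ _ (K * (2 * e))); first by rewrite ltr_pM2l.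
    by rewrite /e le_eqVlt; apply/orP; left; apply/eqP; field; rewrite gt_eqF.
  rewrite -[`|p.1 - _| + _]/d ler_norml => /andP[? ?]; lra.
move=> [[r1 r2] _ /= h]; have := uK p (ratr r1, ratr r2).
by rewrite ler_norml => /andP[? ?]; lra.
Qed.

Section InfConvolution.
Variables (Q : set (R * R)) (g : R * R -> R) (B : R).
Hypotheses (Q0 : Q !=set0) (gB : forall p, Q p -> 0 <= g p <= B).

(** The largest k-Lipschitz minorant of g on Q (Pasch-Hausdorff envelope), cut off at B so that it
    is bounded on the whole plane. *)
Definition inf_conv (k : nat) (p : R * R) : R :=
  inf [set Num.min B (g q + k%:R * l1dist p q) | q in Q].

Let B0 : 0 <= B.
Proof. by case: Q0 => q /gB /andP[]; exact: le_trans. Qed.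

Let lb k p : lbound [set Num.min B (g q + k%:R * l1dist p q) | q in Q] 0.
Proof.
move=> _ [q /gB/andP[h1 h2] <-]; rewrite le_min B0 /=.
by rewrite addr_ge0// mulr_ge0// l1dist_ge0.
Qed.

Let ne k p : [set Num.min B (g q + k%:R * l1dist p q) | q in Q] !=set0.
Proof. by case: Q0 => q Qq; exists (Num.min B (g q + k%:R * l1dist p q)), q. Qed.

Lemma inf_conv_le k p q : Q q -> inf_conv k p <= Num.min B (g q + k%:R * l1dist p q).
Proof. by move=> Qq; apply: ge_inf; [exists 0; exact: lb|exists q]. Qed.

Lemma inf_conv_ge k p (c : R) :
  (forall q, Q q -> c <= Num.min B (g q + k%:R * l1dist p q)) -> c <= inf_conv k p.
Proof. by move=> h; apply: lb_le_inf; [exact: ne|move=> _ [q Qq <-]; exact: h]. Qed.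

Lemma inf_conv_bounds k p : 0 <= inf_conv k p <= B.
Proof.
apply/andP; split; first by apply: inf_conv_ge => q Qq; apply: lb; exists q.
by case: Q0 => q Qq; apply: le_trans (inf_conv_le k p Qq) _; rewrite ge_min lexx.
Qed.

Lemma inf_conv_le_fun k p : Q p -> inf_conv k p <= g p.
Proof.
move=> Qp; apply: le_trans (inf_conv_le k p Qp) _.
by rewrite l1dist_refl mulr0 addr0 ge_min lexx orbT.
Qed.

Lemma inf_conv_lipschitz k p p' :
  `|inf_conv k p - inf_conv k p'| <= k%:R * l1dist p p'.
Proof.
have h (a c : R * R) : inf_conv k a - k%:R * l1dist a c <= inf_conv k c.
  apply: inf_conv_ge => q Qq.
  have := inf_conv_le k a Qq.
  have := ler_wpM2l (ler0n R k) (l1dist_triangle a c q).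
  have : 0 <= k%:R * l1dist a c by rewrite mulr_ge0// l1dist_ge0.
  rewrite !le_min => ? ? /andP[? ?]; apply/andP; split; lra.
have := h p p'; have := h p' p; rewrite [l1dist p' p]l1distC.
by rewrite ler_norml => ? ?; apply/andP; split; lra.
Qed.

Lemma inf_conv_cvg p : Q p -> {within Q, continuous g} ->
  (fun k => inf_conv k p) @ \oo --> g p.
Proof.
move=> Qp /subspace_continuousP/(_ p Qp) gc.
apply/cvgrPdist_le => e e0.
have /cvgrPdist_lt/(_ _ e0) := gc.
rewrite near_withinE => /nbhs_ballP[d /= d0 hd].
near=> k.
(* Points at distance at least d pay a penalty of at least [B >= g p], so only points where
   continuity controls g can lower the infimum. *)
have Bk : B <= k%:R * d.
  rewrite -ler_pdivrMr// ltW//; near: k; exact: nbhs_infty_gtr.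
have gp := inf_conv_le_fun k Qp.
have /andP[g0 gpB] := gB Qp.
rewrite ger0_norm ?subr_ge0// lerBlDr -lerBlDl.
apply: inf_conv_ge => q Qq; rewrite le_min; apply/andP; split; first by lra.
have /andP[gq0 _] := gB Qq.
have [dq|dq] := ltP (l1dist p q) d.
  have := hd q; rewrite /ball /= /prod_ball /ball /= => /(_ _ Qq).
  have h0 : 0 <= k%:R * l1dist p q by rewrite mulr_ge0// l1dist_ge0.
  have b1 : `|p.1 - q.1| < d by apply: le_lt_trans dq; rewrite /l1dist lerDl.
  have b2 : `|p.2 - q.2| < d by apply: le_lt_trans dq; rewrite /l1dist lerDr.
  move=> /(_ (conj b1 b2)); rewrite /from_subspace ltr_norml => /andP[? ?]; lra.
have := ler_wpM2l (ler0n R k) dq; lra.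
Unshelve. all: by end_near. Qed.

End InfConvolution.

End PlaneFunctions.

Section WeakLimits.
Variable R : realType.
Notation Q := (@Qsq R : set (mR2 R)).

Lemma bounded_integral_fin (m : {measure set (mR2 R) -> \bar R}) (h : mR2 R -> R) B :
  m Q = 1%E -> measurable_fun Q h -> (forall p, Q p -> 0 <= h p <= B) ->
  (\int[m]_(p in Q) (h p)%:E)%E \is a fin_num.
Proof.
move=> mQ mh h0; have mQ' := @measurable_Qsq R.
rewrite ge0_fin_numE; last first.
  by apply: integral_ge0 => x /h0/andP[]; rewrite lee_fin.
apply: (@le_lt_trans _ _ (\int[m]_(x in Q) (cst B%:E) x)%E).
  apply: ge0_le_integral => //.
  - by move=> x /h0/andP[]; rewrite lee_fin.
  - exact/measurable_EFinP.
  - by move=> x /h0/andP[]; rewrite lee_fin.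
by rewrite integral_cst// mQ mule1 ltry.
Qed.

Lemma Qsq_nonempty : Q !=set0.
Proof. by exists (0, 0); split; rewrite /= lexx ltr01. Qed.

Section FromLipschitz.
Variables (m_ : nat -> {measure set (mR2 R) -> \bar R}) (mu : {measure set (mR2 R) -> \bar R}).
Hypotheses (mQ1 : forall n, (0 < n)%N -> m_ n Q = 1%E) (muQ1 : mu Q = 1%E).
Hypothesis lip : forall (u : mR2 R -> R) (B K : R),
  measurable_fun setT u -> (forall p, 0 <= u p <= B) -> 0 <= K ->
  (forall p q, `|u p - u q| <= K * l1dist p q) ->
  (fun n => fine (\int[m_ n]_(p in Q) (u p)%:E)) @ \oo -->
  fine (\int[mu]_(p in Q) (u p)%:E).

Lemma measurable_inf_conv (g : R * R -> R) B k :
  (forall p, Q p -> 0 <= g p <= B) ->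
  measurable_fun setT (inf_conv Q g B k : mR2 R -> R).
Proof.
move=> gB; apply: (@lipschitz_measurable _ _ k.+1%:R) => // p q.
apply: le_trans (inf_conv_lipschitz Qsq_nonempty gB k p q) _.
by rewrite ler_wpM2r ?l1dist_ge0// ler_nat.
Qed.

Lemma measurable_continuous_Qsq (g : R * R -> R) B :
  (forall p, Q p -> 0 <= g p <= B) -> {within Q, continuous g} ->
  measurable_fun Q (g : mR2 R -> R).
Proof.
move=> gB gc; apply: (@measurable_fun_cvg _ _ _ _ (inf_conv Q g B)) => [k|p Qp].
  by apply: measurable_funTS; exact: measurable_inf_conv.
exact: (inf_conv_cvg Qsq_nonempty gB Qp gc).
Qed.

(** Convergence for a Lipschitz minorant gives a lower bound for the integrals of g; the minorant is
    chosen with nearly the same integral against [mu]. *)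
Lemma liminf_integral_ge (g : R * R -> R) B e : 0 < e ->
  (forall p, Q p -> 0 <= g p <= B) -> {within Q, continuous g} ->
  \forall n \near \oo, fine (\int[mu]_(p in Q) (g p)%:E) - e <=
    fine (\int[m_ n]_(p in Q) (g p)%:E).
Proof.
move=> e0 gB gc; have e2 : 0 < e / 2 by rewrite divr_gt0.
have mQ := @measurable_Qsq R; have Q0 := Qsq_nonempty.
have mg := measurable_continuous_Qsq gB gc.
pose u k := inf_conv Q g B k.
have mu_ k : measurable_fun setT (u k : mR2 R -> R) by exact: measurable_inf_conv.
have uB k p : 0 <= u k p <= B by exact: inf_conv_bounds.
have cvgu : (fun k => fine (\int[mu]_(p in Q) (u k p)%:E)) @ \oo -->
    fine (\int[mu]_(p in Q) (g p)%:E).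
  apply: fine_cvg; rewrite fineK; last exact: bounded_integral_fin mg gB.
  apply: (@dominated_cvg _ _ _ mu Q _ _ _ (cst B%:E)) => //.
  - by move=> k; apply: measurable_funTS; exact/measurable_EFinP.
  - move=> p Qp; apply: cvg_EFin; first by near=> k.
    exact: (inf_conv_cvg Q0 gB Qp gc).
  - apply: (measurable_bounded_integrable (f := cst B)) => //.
      by rewrite muQ1 ltry.
    by exists `|B|; split => // x Bx p _ /=; exact: ltW.
  - by move=> k p _; have /andP[? ?] := uB k p; rewrite lee_fin ger0_norm.
have [k hk] : exists k, fine (\int[mu]_(p in Q) (g p)%:E) - e / 2 <=
    fine (\int[mu]_(p in Q) (u k p)%:E).
  have /cvgrPdist_le/(_ _ e2)[k _ /(_ k (leqnn k))] := cvgu.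
  by rewrite /= ler_norml => /andP[? ?]; exists k; lra.
have := lip (mu_ k) (uB k) (ler0n R k) (inf_conv_lipschitz Q0 gB k).
move=> /cvgrPdist_le/(_ _ e2) hn.
near=> n.
have n0 : (0 < n)%N by near: n; exact: nbhs_infty_gt.
have hn' : `|fine (\int[mu]_(p in Q) (u k p)%:E) -
   fine (\int[m_ n]_(p in Q) (u k p)%:E)| <= e / 2 by near: n.
have : fine (\int[m_ n]_(p in Q) (u k p)%:E) <= fine (\int[m_ n]_(p in Q) (g p)%:E).
  apply: fine_le.
  - apply: (bounded_integral_fin (B := B) (mQ1 n0)) => //; exact: measurable_funTS.
  - exact: bounded_integral_fin (mQ1 n0) mg gB.
  apply: ge0_le_integral => //.
  - by move=> p _; rewrite lee_fin; have /andP[] := uB k p.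
  - by apply: measurable_funTS; exact/measurable_EFinP.
  - exact/measurable_EFinP.
  - by move=> p Qp; rewrite lee_fin; exact: inf_conv_le_fun.
move: hn'; rewrite ler_norml => /andP[? ?] ?; lra.
Unshelve. all: by end_near. Qed.

(** The one-sided bound, applied to the nonnegative functions [f + M] and [M - f], controls the
    integrals of f from both sides. *)
Lemma weak_limit_of_lipschitz : weak_limit_on_Q (fun n => m_ n) mu.
Proof.
move=> f fc [M fM].
have [q0 Qq0] := Qsq_nonempty.
have M0 : 0 <= M by apply: le_trans (fM _ Qq0).
have mQ := @measurable_Qsq R.
have g1 p : Q p -> 0 <= f p + M <= 2 * M.
  by move=> /fM; rewrite ler_norml => /andP[? ?]; apply/andP; split; lra.
have g2 p : Q p -> 0 <= M - f p <= 2 * M.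
  by move=> /fM; rewrite ler_norml => /andP[? ?]; apply/andP; split; lra.
have c1 : {within Q, continuous (fun p => f p + M)}.
  move=> p; apply: cvgD; [exact: fc|exact: cvg_cst].
have c2 : {within Q, continuous (fun p => M - f p)}.
  move=> p; apply: cvgB; [exact: cvg_cst|exact: fc].
have mf : measurable_fun Q (f : mR2 R -> R).
  have h : measurable_fun Q (fun p : mR2 R => (f p + M) - M).
    apply: measurable_funB => //; exact: measurable_continuous_Qsq g1 c1.
  by move: h; under eq_fun do rewrite addrK.
have int_f (m : {measure set (mR2 R) -> \bar R}) : m Q = 1%E ->
    m.-integrable Q (EFin \o f).
  move=> m1; apply: measurable_bounded_integrable => //; first by rewrite m1 ltry.
  exists M; split; first exact: num_real.
  by move=> x Mx p Qp /=; exact: le_trans (fM _ Qp) (ltW Mx).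
have int_M (m : {measure set (mR2 R) -> \bar R}) : m Q = 1%E ->
    m.-integrable Q (EFin \o (cst M)).
  move=> m1; apply: measurable_bounded_integrable => //; first by rewrite m1 ltry.
  by exists `|M|; split => // x Mx p Qp /=; exact: ltW.
have fin_f (m : {measure set (mR2 R) -> \bar R}) : m Q = 1%E ->
    (\int[m]_(p in Q) (f p)%:E)%E \is a fin_num.
  by move=> m1; apply: integrable_fin_num => //; exact: int_f.
have iM (m : {measure set (mR2 R) -> \bar R}) : m Q = 1%E ->
    (\int[m]_(p in Q) (cst M p)%:E = M%:E)%E.
  move=> m1; rewrite -[LHS]/(\int[m]_(p in Q) (cst M%:E) p)%E.
  by rewrite integral_cst// m1 mule1.
have e1 (m : {measure set (mR2 R) -> \bar R}) : m Q = 1%E ->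
    fine (\int[m]_(p in Q) (f p + M)%:E) = fine (\int[m]_(p in Q) (f p)%:E) + M.
  move=> m1; under eq_integral do rewrite EFinD.
  rewrite (integralD_EFin mQ (int_f _ m1) (int_M _ m1)).
  by rewrite iM// fineD// fin_f.
have e2 (m : {measure set (mR2 R) -> \bar R}) : m Q = 1%E ->
    fine (\int[m]_(p in Q) (M - f p)%:E) = M - fine (\int[m]_(p in Q) (f p)%:E).
  move=> m1; under eq_integral do rewrite EFinB.
  rewrite (integralB_EFin mQ (int_M _ m1) (int_f _ m1)).
  by rewrite iM// fineB// fin_f.
rewrite -(fineK (fin_f mu muQ1)); apply/fine_cvgP; split.
  by near=> n; apply: fin_f; apply: mQ1; near: n; exact: nbhs_infty_gt.
apply/cvgrPdist_le => e e0.
have h1 := liminf_integral_ge e0 g1 c1.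
have h2 := liminf_integral_ge e0 g2 c2.
near=> n.
have mn : m_ n Q = 1%E by apply: mQ1; near: n; exact: nbhs_infty_gt.
have : fine (\int[mu]_(p in Q) (f p + M)%:E) - e <=
    fine (\int[m_ n]_(p in Q) (f p + M)%:E) by near: n.
have : fine (\int[mu]_(p in Q) (M - f p)%:E) - e <=
    fine (\int[m_ n]_(p in Q) (M - f p)%:E) by near: n.
rewrite !e1// !e2// => ? ?; rewrite /= ler_norml; apply/andP; split; lra.
Unshelve. all: by end_near. Qed.

End FromLipschitz.
End WeakLimits.

(** * The image of the tower area: weak limit and absolute continuity *)

Section SRBMeasure.
Variables (R : realType) (b l : R).
Hypotheses (hb : 1 < b < 2) (hl : 0 < l < 1).
Notation leb := (@lebesgue_measure R).
Notation MR := (measurableTypeR R).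
Notation T := (Tbl b l).
Notation Q := (@Qsq R : set (mR2 R)).

Lemma tower_mass_gt0 : 0 < tower_mass b.
Proof. by have [_ h] := tower_massE hb; exact: lt_le_trans h. Qed.

Let inv_nat_ge0 n : 0 <= n%:R^-1 :> R.
Proof. by rewrite invr_ge0. Qed.

Let inv_mass_ge0 : 0 <= (tower_mass b)^-1.
Proof. by rewrite invr_ge0 ltW// tower_mass_gt0. Qed.

(** The set function [nu_n], built so as to carry a measure structure and be convertible to the
    original. For n = 0 it is the zero measure, whence the condition [0 < n] on its total mass. *)
Definition nu_measure (n : nat) : {measure set (mR2 R) -> \bar R} :=
  mscale (NngNum (inv_nat_ge0 n))
    (msum (fun k => image_measure (mrestr (@leb2 R) (@measurable_Qsq R))
                      (measurable_iter_Tbl b l k)) n).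

Lemma integral_nu_measure n (F : mR2 R -> \bar R) :
  measurable_fun setT F -> (forall p, 0 <= F p)%E ->
  (\int[nu_measure n]_(p in Q) F p =
   (n%:R^-1)%:E * \sum_(k < n) \int[@leb2 R]_(p in Q) F (iter k T p))%E.
Proof.
move=> mF F0; have mQ := @measurable_Qsq R.
rewrite /nu_measure ge0_integral_mscale//=; last exact: measurable_funTS.
congr (_ * _)%E.
pose mm k := image_measure (mrestr (@leb2 R) mQ) (measurable_iter_Tbl b l k).
transitivity (\sum_(k < n) \int[mm k]_(p in Q) F p)%E.
  exact: (ge0_integral_measure_sum mm mQ (fun p _ => F0 p) (measurable_funTS mF) n).
apply: eq_bigr => k _.
have mT := measurable_iter_Tbl b l k.
rewrite (ge0_integral_image_measure _ _ mQ (measurable_funTS mF) (fun p _ => F0 p)).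
rewrite ge0_integral_mrestr//; last 2 first.
- by rewrite -[X in measurable X]setTI; exact: mT.
- by apply: measurable_funTS; exact: measurableT_comp mF mT.
congr (integral _ _ _); apply/seteqP; split => p; first by case.
by move=> Qp; split => //; exact: iter_Tbl_Qsq.
Qed.

Definition srb : {measure set (mR2 R) -> \bar R} :=
  mscale (NngNum inv_mass_ge0)
    (image_measure (mrestr (@leb2 R) (measurable_tower hb)) (measurable_code hb hl)).

Lemma srbE A : srb A = ((tower_mass b)^-1%:E * @leb2 R (code b l @^-1` A `&` tower b))%E.
Proof. by []. Qed.

Lemma integral_srb (F : mR2 R -> \bar R) :
  measurable_fun setT F -> (forall p, 0 <= F p)%E ->
  (\int[srb]_p F p =
   (tower_mass b)^-1%:E * tower_integral b (fun p => F (code b l p)))%E.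
Proof.
move=> mF F0; have mc := measurable_code hb hl.
rewrite /srb ge0_integral_mscale//=; congr (_ * _)%E.
rewrite (ge0_integral_image_measure _ _ measurableT mF (fun p _ => F0 p)).
have mFc : measurable_fun setT (fun p => F (code b l p)).
  exact: measurableT_comp mF mc.
rewrite ge0_integral_mrestr; last 3 first.
- by rewrite -[X in measurable X]setTI; exact: mc.
- exact: measurable_funTS.
- by move=> p _; exact: F0.
rewrite -(integral_tower hb mFc (fun p => F0 _)).
by congr (integral _ _ _); apply/seteqP; split => p; [case|split].
exact: mc.
Qed.

Hypothesis ac : forall A : set MR, measurable A -> leb A = 0%E ->
  leb (live b `&` coord b l @^-1` A) = 0%E.

(** Almost all vertical sections of A are null. By [ac], almost every live v has its coordinate
    outside the exceptional set, so the fibre over v is null; a past that is not live has an empty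
    fibre. *)
Lemma srb_null (A : set (mR2 R)) : measurable A -> @leb2 R A = 0%E -> srb A = 0%E.
Proof.
move=> mA A0; rewrite srbE.
set S := _ `&` _.
have mS : measurable S.
  apply: measurableI; last exact: measurable_tower.
  by rewrite -[X in measurable X]setTI; exact: measurable_code.
suff -> : @leb2 R S = 0%E by rewrite mule0.
pose psi (x : MR) := leb (xsection A x).
have mpsi : measurable_fun setT psi by exact: measurable_fun_xsection.
pose N : set MR := [set x | psi x != 0%E].
have mN : measurable N.
  rewrite (_ : N = psi @^-1` (~` [set 0%E])); last first.
    by apply/seteqP; split => x /= /eqP.
  by rewrite -[X in measurable X]setTI; apply: mpsi => //; exact: measurableC.
have N0 : leb N = 0%E.
  have : (\int[leb]_x `|psi x| = 0)%E.
    by rewrite -[RHS]A0; apply: eq_integral => x _; rewrite gee0_abs.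
  move=> /(ae_eq_integral_abs leb measurableT mpsi) [Z [mZ Z0 ZN]].
  apply: (subset_measure0 _ _ _ Z0) => // x Nx; apply: ZN => /= h.
  by move/eqP: Nx; apply; exact: h.
have LN := ac mN N0.
have mX : measurable_fun setT (coord b l : MR -> MR).
  by have := measurable_coord hb hl; exact.
rewrite /leb2 /product_measure1 /=.
rewrite (@ge0_negligible_integral _ _ _ leb setT (live b `&` coord b l @^-1` N))//; last 2 first.
- apply: measurableI; first exact: measurable_live.
  by rewrite -[X in measurable X]setTI; exact: mX.
- exact: measurable_fun_xsection.
rewrite integral0_eq// => v [_ hv] /=.
have [lv|nlv] := pselect (live b v); last first.
  rewrite (_ : xsection S v = set0) ?measure0//.
  apply/seteqP; split => // y /xsectionP[_ [/= h1 /andP[h2 h3]]].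
  by apply: nlv; split => //; exact: le_lt_trans h3.
apply: (subset_measure0 _ _ (B := xsection A (coord b l v))).
- exact: measurable_xsection.
- exact: measurable_xsection.
- by move=> y /xsectionP[h _]; apply/xsectionP.
have [//|h] := eqVneq (psi (coord b l v)) 0%E.
by exfalso; apply: hv; split.
Qed.

(** [code] sends the tower into [[0, 1] x [0, 1)], so only the edge with first coordinate 1 could
    carry mass outside Q; as a null set of the plane it carries none. *)
Lemma srb_outside : srb (~` Q) = 0%E.
Proof.
have m1 : measurable ([set 1] `*` setT : set (mR2 R)).
  by apply: measurableX => //; exact: measurable_set1.
have h : srb ([set 1] `*` setT : set (mR2 R)) = 0%E.
  apply: srb_null => //; rewrite /leb2 product_measure1E//.
  by rewrite -[LHS]/(leb [set 1%R] * leb setT)%E lebesgue_measure_set1 mul0e.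
apply/eqP; rewrite eq_le measure_ge0 andbT -h !srbE.
have inv0 : (0 <= (tower_mass b)^-1%:E)%E by rewrite lee_fin.
apply: lee_wpmul2l => //; apply: le_measure; rewrite ?inE.
- apply: measurableI; last exact: measurable_tower.
  rewrite -[X in measurable X]setTI; apply: measurable_code => //.
  by apply: measurableC; exact: measurable_Qsq.
- apply: measurableI; last exact: measurable_tower.
  by rewrite -[X in measurable X]setTI; apply: measurable_code.
move=> p [/= nQ tp]; split => //; split => //=; case: tp => h1 /andP[h2 h3].
apply/eqP/negPn/negP => h4; apply: nQ; split => /=.
  by rewrite coord_ge0//= lt_neqAle h4 coord_le1.
by rewrite h2 (lt_le_trans h3)// height_le1.
Qed.

Lemma srb_total : srb setT = 1%E.
Proof.
rewrite srbE preimage_setT setTI leb2_tower// -EFinM mulVf//.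
by rewrite gt_eqF// tower_mass_gt0.
Qed.

Lemma srb_Qsq : srb Q = 1%E.
Proof.
have mQ := @measurable_Qsq R.
rewrite -srb_total -(setUv Q) measureU//; last 2 first.
- exact: measurableC.
- exact: setICr.
by rewrite -[X in (_ + X)%E]/(srb (~` Q)) srb_outside adde0.
Qed.

Lemma nu_measure_Qsq n : (0 < n)%N -> nu_measure n Q = 1%E.
Proof.
move=> n0; have mQ := @measurable_Qsq R.
have := @integral_nu_measure n (cst 1%E) (measurable_cst _) (fun _ => lee01).
rewrite integral_cst// mul1e => ->.
have -> : (\sum_(k < n) \int[@leb2 R]_(p in Q) cst 1%E (iter k T p) = n%:R%:E)%E.
  transitivity (\sum_(k < n) (1%R : R)%:E)%E; last by rewrite sumEFin sumr_const card_ord.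
  by apply: eq_bigr => k _; rewrite integral_cst// mul1e; exact: leb2_Qsq.
by rewrite -EFinM mulVf// pnatr_eq0 -lt0n.
Qed.

Lemma is_SRB_srb : is_SRB b l srb.
Proof.
split; first exact: srb_outside.
have mQ := @measurable_Qsq R.
have -> : nu_n b l = fun n => nu_measure n by [].
apply: weak_limit_of_lipschitz; [exact: nu_measure_Qsq|exact: srb_Qsq|].
move=> u B K mu u0B K0 uK.
have u0 p : (0 <= (u p)%:E)%E by rewrite lee_fin; have /andP[] := u0B p.
have muE : measurable_fun setT (fun p => (u p)%:E) by exact/measurable_EFinP.
have uK' x x' y : `|u (x, y) - u (x', y)| <= K * `|x - x'|.
  by apply: le_trans (uK _ _) _; rewrite /l1dist /= subrr normr0 addr0.
have nuE n : fine (\int[nu_measure n]_(p in Q) (u p)%:E) =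
    n%:R^-1 * \sum_(k < n) orbit_mean b l u k.
  rewrite (integral_nu_measure n muE u0).
  have fk k : (\int[@leb2 R]_(p in Q) (u (iter k T p))%:E = (orbit_mean b l u k)%:E)%E.
    rewrite fineK// (bounded_integral_fin (B := B) (@leb2_Qsq R))// .
    by apply: measurable_funTS; exact: measurableT_comp mu (measurable_iter_Tbl b l k).
  by under eq_bigr do rewrite fk; rewrite sumEFin -EFinM.
have srbu : fine (\int[srb]_(p in Q) (u p)%:E) = code_mean b l u / tower_mass b.
  have <- : (\int[srb]_p (u p)%:E = \int[srb]_(p in Q) (u p)%:E)%E.
    rewrite (@ge0_negligible_integral _ _ _ srb setT (~` Q))//.
    - by rewrite setDE setTI setCK.
    - exact: measurableC.
    - exact: srb_outside.
  rewrite (integral_srb muE u0) /code_mean mulrC fineM//.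
  rewrite -integral_tower//; last exact: measurableT_comp muE (measurable_code hb hl).
  rewrite ge0_fin_numE; last by apply: integral_ge0.
  apply: (@le_lt_trans _ _ (\int[@leb2 R]_(p in tower b) (cst B%:E) p)%E).
    apply: ge0_le_integral => //.
    - exact: measurable_tower.
    - by apply: measurable_funTS; exact: measurableT_comp muE (measurable_code hb hl).
    - by move=> p _; rewrite lee_fin; have /andP[] := u0B (code b l p).
  rewrite integral_cst; last exact: measurable_tower.
  by rewrite -[X in (_ * X)%E]/(@leb2 R (tower b)) leb2_tower// -EFinM ltry.
rewrite srbu; under eq_fun do rewrite nuE.
exact: cesaro_orbit_mean mu u0B K0 uK'.
Qed.

End SRBMeasure.

Theorem theorem4p2 (R : realType) (gamma : R) :
  Sset gamma ->
  exists eps : R, 0 < eps /\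
    forall beta : R, 1 < beta < 2 ->
      gamma^-1 <= beta^-1 < gamma^-1 + eps ->
      {ae @lebesgue_measure R, forall lambda : R,
         beta^-1 < lambda < gamma^-1 + eps -> lambda < 1 ->
         exists mu : {measure set mR2 R -> \bar R},
           is_SRB beta lambda mu /\ mu `<< @leb2 R}.
Proof.
move=> Sg; have [g1 _] := Sg.
have [eps [delta [eps0 delta0 geps transv]]] := transversality g1.
exists eps; split => // b hb /andP[bg _].
have b0 := base_gt0 hb.
have {}bg : b <= gamma by move: bg; rewrite lef_pV2 ?posrE// (lt_trans ltr01 g1).
(* The bound over pairs degenerates as [l0] approaches [b^-1]; countably many values of [l0] exhaust
   the range and keep the exceptional set null. *)
have step n : b^-1 < b^-1 + n.+1%:R^-1 by rewrite ltrDl invr_gt0.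
have := fun n => ae_pushforward_null hb bg Sg delta0 geps transv (step n).
move=> /ae_foralln; apply: filterS => l hae /andP[bl lg] l1.
have hl : 0 < l < 1 by rewrite l1 andbT (lt_trans (inv_base_gt0 hb) bl).
(* The integer part of [(l - b^-1)^-1] works, since its successor exceeds that number. *)
have [n hn] : exists n : nat, b^-1 + n.+1%:R^-1 <= l.
  have d0 : 0 < l - b^-1 by rewrite subr_gt0.
  exists (Num.truncn (l - b^-1)^-1); rewrite -lerBrDl.
  by rewrite invf_ple ?posrE// ltW// truncnS_gt.
have Jl : Jset gamma eps (b^-1 + n.+1%:R^-1) l by rewrite /Jset /= in_itv /= hn ltW.
have ac := hae n Jl.
exists (srb hb hl); split; first exact: is_SRB_srb.
by apply/null_content_dominatesP => A mA A0; exact: srb_null.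
Qed.
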